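(* Let $X_1,\dots,X_m$ and $Y_1,\dots,Y_n$ be normal projective varieties over $\mathbb{C}$ with $\rho(X_i)=1=\rho(Y_j)$ and $\mathrm{Pic}^0(X_i)=0=\mathrm{Pic}^0(Y_j)$ for all $1\le i\le m$ and $1\le j\le n$. If there exists an isomorphism $$\prod_{i=1}^m X_i\ \cong\ \prod_{j=1}^n Y_j,$$ then $m=n$ and there is a permutation $\sigma$ of $\{1,\dots,m\}$ such that $X_i\cong Y_{\sigma(i)}$ for all $1\le i\le m$.
   Context: For a normal projective variety $X$ over $\mathbb{C}$, $N^1(X)=\mathrm{Pic}(X)/\mathrm{Pic}^\tau(X)$ is the group of line bundles modulo numerically trivial ones; it is a free abelian group of finite rank, and $\rho(X)$ (the Picard number) is its rank. $\mathrm{Pic}^0(X)$ is the identity component of the Picard scheme of $X$. *)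

(* Defs.v *)
From HB Require Import structures.
From mathcomp Require Import all_boot all_order all_algebra perm.
From mathcomp Require Import all_classical all_reals.
From mathcomp Require Import topology.
From mathcomp Require Export complex.
From mathcomp Require mpoly.

Set Implicit Arguments.
Unset Strict Implicit.
Unset Printing Implicit Defensive.

Import GRing.Theory Num.Theory.
Local Open Scope classical_set_scope.
Local Open Scope ring_scope.

(** Varieties over an algebraically closed field [K] are treated in the
    classical language of "spaces with functions" (Serre, Kempf): a topological
    space (the closed points, with the Zariski topology) with a sheaf of
    [K]-valued functions.  A section of the structure sheaf over an open [U] is
    a function regular at every point of [U]; the stalk at [p] is the set of
    functions regular at [p] modulo equality near [p]. *)
Record fspace (K : fieldType) := FSpace {
  fs_pt :> topologicalType ;
  regular_at : fs_pt -> set (fs_pt -> K) ;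
  regular_cst : forall p c, regular_at p (fun=> c) ;
  regularD : forall p f g, regular_at p f -> regular_at p g ->
    regular_at p (fun q => f q + g q) ;
  regularM : forall p f g, regular_at p f -> regular_at p g ->
    regular_at p (fun q => f q * g q) ;
  regularV : forall p f, regular_at p f -> f p != 0 ->
    regular_at p (fun q => (f q)^-1) ;
  regular_neq0 : forall p f, regular_at p f -> f p != 0 ->
    \forall q \near p, f q != 0 ;
  regular_near : forall p f, regular_at p f ->
    \forall q \near p, regular_at q f ;
  regular_eq : forall p f g, (\forall q \near p, f q = g q) ->
    regular_at p f -> regular_at p g }.

Section Morphisms.
Variable K : fieldType.
Implicit Types X Y Z : fspace K.

Record morphism X Y := Morphism {
  mor_fun :> X -> Y ;
  mor_continuous : continuous mor_fun ;
  mor_regular : forall x a,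
    regular_at (mor_fun x) a -> regular_at x (fun z => a (mor_fun z)) }.

Definition isomorphic X Y : Prop :=
  exists (f : morphism X Y) (g : morphism Y X), cancel f g /\ cancel g f.

Lemma mor_comp_continuous X Y Z (g : morphism Y Z) (f : morphism X Y) :
  continuous (g \o f).
Proof.
by move=> x; apply: continuous_comp; apply: mor_continuous.
Qed.

Lemma mor_comp_regular X Y Z (g : morphism Y Z) (f : morphism X Y) x a :
  regular_at ((g \o f) x) a -> regular_at x (fun z => a ((g \o f) z)).
Proof. by move=> /mor_regular/mor_regular. Qed.

Definition mor_comp X Y Z (g : morphism Y Z) (f : morphism X Y) :=
  Morphism (@mor_comp_continuous X Y Z g f) (@mor_comp_regular X Y Z g f).

Lemma mor_id_continuous X : continuous (@id X).
Proof. by move=> x. Qed.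

Definition mor_id X : morphism X X :=
  Morphism (@mor_id_continuous X) (fun x a h => h).

Definition mor_cst X Y (y : Y) : morphism X Y :=
  @Morphism X Y (fun=> y) (@cst_continuous X Y y)
    (fun x a _ => regular_cst x (a y)).

End Morphisms.

(** [Z] with the structure below; the maps [pr] are recorded in the type so that
    canonical instances can depend on them. *)
Definition init_pt (K : fieldType) (I : finType) (Y : I -> fspace K) (Z : Type)
  (pr : forall i, Z -> Y i) : Type := Z.

(** The coarsest structure on a set [Z] making finitely many maps
    [pr i : Z -> Y i] morphisms.  It gives both products and subspaces. *)
Section Initial.
Variables (K : fieldType) (I : finType) (Y : I -> fspace K) (Z : Type).
Variable pr : forall i, Z -> Y i.

Inductive init_fun (z : Z) : (Z -> K) -> Prop :=
| init_cst c : init_fun z (fun=> c)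
| init_pr i a : regular_at (pr i z) a -> init_fun z (fun w => a (pr i w))
| init_add f g : init_fun z f -> init_fun z g ->
    init_fun z (fun w => f w + g w)
| init_mul f g : init_fun z f -> init_fun z g ->
    init_fun z (fun w => f w * g w)
| init_inv f : init_fun z f -> f z != 0 -> init_fun z (fun w => (f w)^-1).

Definition init_nbhs (z : Z) : set_system Z := [set A |
  exists (B : forall i, set (Y i)) (f : Z -> K),
    [/\ forall i, nbhs (pr i z) (B i), init_fun z f, f z != 0 &
        [set w | (forall i, B i (pr i w)) /\ f w != 0] `<=` A]].

Lemma init_nbhs_intro z (B : forall i, set (Y i)) f :
  (forall i, nbhs (pr i z) (B i)) -> init_fun z f -> f z != 0 ->
  init_nbhs z [set w | (forall i, B i (pr i w)) /\ f w != 0].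
Proof. by move=> hB hf fz; exists B, f; split. Qed.

Lemma init_nbhs_pr z i (A : set (Y i)) :
  nbhs (pr i z) A -> init_nbhs z [set w | A (pr i w)].
Proof.
move=> hA.
exists (fun j => [set y | forall e : j = i, A (ecast k (Y k) e y)]), (fun=> 1).
split; [|exact: init_cst|exact: oner_neq0|].
  move=> j; case: (eqVneq j i) => [e|ne].
    by subst j; apply: filterS hA => y hy e; rewrite (eq_irrelevance e erefl).
  by apply: filterE => y e; case/eqP: ne.
by move=> w [/(_ i)/(_ erefl)].
Qed.

Lemma init_nbhs_filter z : ProperFilter (init_nbhs z).
Proof.
split.
  move=> [B [f [hB hf fz /(_ z)]]]; apply; split=> // i.
  exact: nbhs_singleton.
split.
- exists (fun=> setT), (fun=> 1); split=> //; first by move=> i; apply: filterT.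
    exact: init_cst.
  exact: oner_neq0.
- move=> P Q [B [f [hB hf fz BP]]] [B' [g [hB' hg gz BQ]]].
  exists (fun i => B i `&` B' i), (fun w => f w * g w); split.
  + by move=> i; apply: filterI.
  + exact: init_mul.
  + by rewrite mulf_neq0.
  + move=> w [hw]; rewrite mulf_eq0 negb_or => /andP[fw gw].
    split; first by apply: BP; split=> // i; have [] := hw i.
    by apply: BQ; split=> // i; have [] := hw i.
- move=> P Q PQ [B [f [hB hf fz BP]]]; exists B, f; split=> //.
  exact: subset_trans PQ.
Qed.

Lemma init_nbhs_singleton z A : init_nbhs z A -> A z.
Proof.
move=> [B [f [hB hf fz]]]; apply; split=> // i.
exact: nbhs_singleton.
Qed.

Lemma init_nbhs_neq0 z f : init_fun z f -> f z != 0 ->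
  init_nbhs z [set w | f w != 0].
Proof.
move=> hf fz; exists (fun=> setT), f; split=> //.
  by move=> i; apply: filterT.
by move=> w [].
Qed.

Lemma init_fun_near z f : init_fun z f -> init_nbhs z [set w | init_fun w f].
Proof.
have F := init_nbhs_filter z.
elim=> {f} [c|i a ra|f g _ IHf _ IHg|f g _ IHf _ IHg|f hf IHf fz].
- by apply: filterE => w; apply: init_cst.
- apply: (@filterS _ _ _ [set w | regular_at (pr i w) a]).
    by move=> w; apply: init_pr.
  apply: (@init_nbhs_pr z i [set y | regular_at y a]).
  exact: regular_near.
- by apply: filterS2 IHf IHg => w; apply: init_add.
- by apply: filterS2 IHf IHg => w; apply: init_mul.
- by apply: filterS2 IHf (init_nbhs_neq0 hf fz) => w; apply: init_inv.
Qed.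

Lemma init_nbhs_nbhs z A : init_nbhs z A -> init_nbhs z (init_nbhs^~ A).
Proof.
move=> [B [f [hB hf fz BA]]].
have F := init_nbhs_filter z.
have h1 : init_nbhs z
    [set w | (forall i, nbhs (pr i w) (B i)) /\ f w != 0].
  apply: (@init_nbhs_intro z (fun i => nbhs^~ (B i))) => // i.
  exact: nbhs_interior.
apply: filterS2 h1 (init_fun_near hf) => w [hw fw] hfw.
by exists B, f; split.
Qed.

Local Notation init_pt := (init_pt pr).

HB.instance Definition _ := gen_eqMixin init_pt.
HB.instance Definition _ := gen_choiceMixin init_pt.
HB.instance Definition _ := hasNbhs.Build init_pt init_nbhs.
HB.instance Definition _ := Nbhs_isNbhsTopological.Build init_pt
  init_nbhs_filter init_nbhs_singleton init_nbhs_nbhs.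

Definition init_regular (z : init_pt) : set (init_pt -> K) :=
  [set f | exists2 g, init_fun z g & \forall w \near z, f w = g w].

Lemma init_regular_cst z c : init_regular z (fun=> c).
Proof. by exists (fun=> c); [apply: init_cst|apply: filterE]. Qed.

Lemma init_regularD z f g : init_regular z f -> init_regular z g ->
  init_regular z (fun w => f w + g w).
Proof.
move=> [f' hf ef] [g' hg eg]; exists (fun w => f' w + g' w).
  exact: init_add.
by apply: filterS2 ef eg => w -> ->.
Qed.

Lemma init_regularM z f g : init_regular z f -> init_regular z g ->
  init_regular z (fun w => f w * g w).
Proof.
move=> [f' hf ef] [g' hg eg]; exists (fun w => f' w * g' w).
  exact: init_mul.
by apply: filterS2 ef eg => w -> ->.
Qed.

Lemma init_regularV z f : init_regular z f -> f z != 0 ->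
  init_regular z (fun w => (f w)^-1).
Proof.
move=> [f' hf ef] fz; exists (fun w => (f' w)^-1).
  by apply: init_inv => //; rewrite -(nbhs_singleton ef).
by apply: filterS ef => w ->.
Qed.

Lemma init_regular_neq0 z f : init_regular z f -> f z != 0 ->
  \forall w \near z, f w != 0.
Proof.
move=> [f' hf ef]; rewrite (nbhs_singleton ef) => fz.
have h : \forall w \near (z : init_pt), f' w != 0 by exact: init_nbhs_neq0.
by apply: filterS2 ef h => w ->.
Qed.

Lemma init_regular_near z f : init_regular z f ->
  \forall w \near z, init_regular w f.
Proof.
move=> [f' hf ef].
have h : \forall w \near (z : init_pt), init_fun w f' by exact: init_fun_near.
have h2 : \forall w \near z, \forall v \near w, f v = f' v.
  exact: nbhs_interior.
by apply: filterS2 h h2 => w hw ew; exists f'.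
Qed.

Lemma init_regular_eq z f g : (\forall w \near z, f w = g w) ->
  init_regular z f -> init_regular z g.
Proof.
move=> fg [f' hf ef]; exists f' => //.
by apply: filterS2 fg ef => w -> ->.
Qed.

Definition initial : fspace K :=
  FSpace init_regular_cst init_regularD init_regularM init_regularV
    init_regular_neq0 init_regular_near init_regular_eq.

Lemma init_proj_continuous i : continuous (pr i : initial -> Y i).
Proof. by move=> z A hA; apply: (@init_nbhs_pr z i). Qed.

Lemma init_proj_regular i (z : initial) a :
  regular_at (pr i z) a -> regular_at z (fun w : initial => a (pr i w)).
Proof.
by move=> ha; exists (fun w => a (pr i w)); [apply: init_pr|apply: filterE].
Qed.

Definition init_proj i : morphism initial (Y i) :=
  Morphism (@init_proj_continuous i) (@init_proj_regular i).

Section Lift.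
Variables (W : fspace K) (h : W -> Z) (k : forall i, morphism W (Y i)).
Hypothesis hk : forall i w, pr i (h w) = k i w.

Lemma init_fun_lift w f : init_fun (h w) f -> regular_at w (fun v => f (h v)).
Proof.
elim=> {f} [c|i a ra|f g _ IHf _ IHg|f g _ IHf _ IHg|f hf IHf fz].
- exact: regular_cst.
- have -> : (fun v => a (pr i (h v))) = (fun v => a (k i v)).
    by apply/funext => v; rewrite hk.
  by apply: mor_regular; rewrite -hk.
- exact: regularD.
- exact: regularM.
- exact: regularV.
Qed.

Lemma init_lift_continuous : continuous (h : W -> initial).
Proof.
move=> w A [B [f [hB hf fz BA]]].
have hI : \forall v \near w, forall i, B i (pr i (h v)).
  apply: filter_forall => i; have hBi := hB i; rewrite hk in hBi.
  have : \forall v \near w, B i (k i v) by exact: (mor_continuous hBi).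
  by apply: filterS => v; rewrite hk.
have hf0 := regular_neq0 (init_fun_lift hf) fz.
by apply: filterS2 hI hf0 => v v1 v2; apply: BA.
Qed.

Lemma init_lift_regular w (a : initial -> K) :
  regular_at (h w : initial) a -> regular_at w (fun v => a (h v)).
Proof.
move=> [g hg eg].
apply: regular_eq (init_fun_lift hg).
have : \forall v \near w, a (h v) = g (h v) by exact: (init_lift_continuous eg).
by apply: filterS => v ->.
Qed.

Definition init_lift : morphism W initial :=
  Morphism init_lift_continuous init_lift_regular.

End Lift.

End Initial.

Section Constructions.
Variable K : fieldType.
Implicit Types X Y T : fspace K.

Definition fs_prod (I : finType) (X : I -> fspace K) : fspace K :=
  @initial K I X (forall i, X i) (fun i x => x i).

Definition fs_sub X (A : set X) : fspace K :=
  @initial K unit (fun=> X) {x : X | A x} (fun=> sval).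

Definition sub_incl X (A : set X) : morphism (fs_sub A) X :=
  @init_proj K unit (fun=> X) {x : X | A x} (fun=> sval) tt.

Definition pair_fam X T (b : bool) : fspace K := if b then X else T.
Definition pair_pr X T (b : bool) : X * T -> pair_fam X T b :=
  if b return X * T -> pair_fam X T b then fst else snd.

Definition fs_pair X T : fspace K :=
  @initial K bool (pair_fam X T) (X * T) (@pair_pr X T).

Definition pair_fst X T : morphism (fs_pair X T) X :=
  @init_proj K bool (pair_fam X T) (X * T) (@pair_pr X T) true.
Definition pair_snd X T : morphism (fs_pair X T) T :=
  @init_proj K bool (pair_fam X T) (X * T) (@pair_pr X T) false.

Section PairLift.
Variables (W X T : fspace K) (f : morphism W X) (g : morphism W T).

Definition pair_fg (b : bool) : morphism W (pair_fam X T b) :=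
  if b return morphism W (pair_fam X T b) then f else g.

Lemma pair_fgE b w : pair_pr b (f w, g w) = pair_fg b w.
Proof. by case: b. Qed.

Definition mor_pair : morphism W (fs_pair X T) :=
  init_lift pair_fgE.

End PairLift.

Definition pair_slice X T (t : T) : morphism X (fs_pair X T) :=
  mor_pair (mor_id X) (mor_cst X t).

Definition base_change X T T' (g : morphism T' T) :
    morphism (fs_pair X T') (fs_pair X T) :=
  mor_pair (pair_fst X T') (mor_comp g (pair_snd X T')).

End Constructions.

Section Varieties.
Variable K : fieldType.
Implicit Types X : fspace K.

Local Notation polynomial n := (mpoly.mpoly n K).
Local Notation peval := mpoly.meval.

(** [X] is isomorphic, via the coordinates [phi], to a Zariski closed subset of
    affine space with its induced topology and regular functions. *)
Definition affine X : Prop :=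
  exists (n : nat) (phi : X -> 'I_n -> K) (S : set (polynomial n)),
    [/\ injective phi,
        range phi = [set v | forall P, S P -> peval v P = 0],
        forall p (A : set X), nbhs p A <->
          exists2 P : polynomial n, peval (phi p) P != 0 &
            [set q | peval (phi q) P != 0] `<=` A &
        forall p (f : X -> K), regular_at p f <->
          exists P Q : polynomial n, peval (phi p) Q != 0 /\
            \forall q \near p, f q = peval (phi q) P / peval (phi q) Q].

(** Reduced schemes locally of finite type over [K]. *)
Definition locally_affine X : Prop :=
  forall p : X, exists U : set X, [/\ open U, U p & affine (fs_sub U)].

(** [d.-homog], spelled out because the notations of [mpoly] clash with those of
    [topology]. *)
Definition homogeneous n (d : nat) (P : polynomial n) : Prop :=
  all (fun m => mpoly.mdeg m == d) (mpoly.msupp P).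

(** [X] is isomorphic to a Zariski closed subset of the projective space of
    dimension [N]; [phi] picks homogeneous coordinates of each point (no
    regularity is required of this choice). *)
Definition projective X : Prop :=
  exists (N : nat) (phi : X -> 'I_N.+1 -> K) (S : set (polynomial N.+1)),
    [/\ forall P, S P -> exists d, homogeneous d P,
        [/\ forall p, exists i, phi p i != 0,
            forall p q c, (forall i, phi p i = c * phi q i) -> p = q &
            forall v : 'I_N.+1 -> K, (exists i, v i != 0) ->
              ((forall P, S P -> peval v P = 0) <->
               exists p c, forall i, v i = c * phi p i)],
        forall p (A : set X), nbhs p A <->
          exists (d : nat) (P : polynomial N.+1),
            [/\ homogeneous d P, peval (phi p) P != 0 &
                [set q | peval (phi q) P != 0] `<=` A] &
        forall p (f : X -> K), regular_at p f <->
          exists (d : nat) (P Q : polynomial N.+1),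
            [/\ homogeneous d P, homogeneous d Q, peval (phi p) Q != 0 &
                \forall q \near p, f q = peval (phi q) P / peval (phi q) Q]].

Definition irreducible_set (T : topologicalType) (A : set T) : Prop :=
  A !=set0 /\ forall F G : set T, closed F -> closed G ->
    A `<=` F `|` G -> A `<=` F \/ A `<=` G.

(** The local ring at [p] is integrally closed in its fraction field: if [a / b]
    is a root of a monic polynomial with coefficients [c i] in the local ring,
    then it lies in the local ring. *)
Definition normal_at X (p : X) : Prop :=
  forall (n : nat) (a b : X -> K) (c : 'I_n -> X -> K),
    regular_at p a -> regular_at p b -> (forall i, regular_at p (c i)) ->
    ~ (\forall q \near p, b q = 0) ->
    (\forall q \near p,
       a q ^+ n + \sum_(i < n) c i q * a q ^+ i * b q ^+ (n - i) = 0) ->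
    exists2 r, regular_at p r & \forall q \near p, a q = r q * b q.

Definition normal_projective_variety X : Prop :=
  [/\ projective X, irreducible_set [set: X] & forall p : X, normal_at p].

End Varieties.

(** Line bundles are given by transition functions.  The trivialising cover is
    indexed by the points of [X], [lb_dom x] being a neighbourhood of [x]; every
    line bundle admits such a presentation.  A section is a family of functions
    [s x] on [lb_dom x] with [s x = lb_tr x y * s y]. *)
Record line_bundle (K : fieldType) (X : fspace K) := LineBundle {
  lb_dom : X -> set X ;
  lb_tr : X -> X -> X -> K ;
  lb_open : forall x, open (lb_dom x) ;
  lb_mem : forall x, lb_dom x x ;
  lb_regular : forall x y z, lb_dom x z -> lb_dom y z ->
    regular_at z (lb_tr x y) ;
  lb_id : forall x z, lb_dom x z -> lb_tr x x z = 1 ;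
  lb_cocycle : forall x y w z, lb_dom x z -> lb_dom y z -> lb_dom w z ->
    lb_tr x y z * lb_tr y w z = lb_tr x w z }.

Section LineBundles.
Variable K : fieldType.
Implicit Types X Y : fspace K.

Definition lb_iso X (L M : line_bundle X) : Prop :=
  exists u : X -> X -> K,
    (forall x z, lb_dom L x z -> lb_dom M x z ->
       regular_at z (u x) /\ u x z != 0) /\
    (forall x y z, lb_dom L x z -> lb_dom M x z ->
       lb_dom L y z -> lb_dom M y z ->
       lb_tr M x y z * u y z = u x z * lb_tr L x y z).

Definition lb_trivial X : line_bundle X.
Proof.
apply: (@LineBundle K X (fun=> setT) (fun _ _ _ => 1)) => //.
- by move=> _; apply: openT.
- by move=> *; apply: regular_cst.
- by move=> *; rewrite mulr1.
Defined.

Definition lb_tensor X (L M : line_bundle X) : line_bundle X.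
Proof.
apply: (@LineBundle K X (fun x => lb_dom L x `&` lb_dom M x)
          (fun x y z => lb_tr L x y z * lb_tr M x y z)).
- by move=> x; apply: openI; apply: lb_open.
- by move=> x; split; apply: lb_mem.
- by move=> x y z [? ?] [? ?]; apply: regularM; apply: lb_regular.
- by move=> x z [? ?]; rewrite !lb_id // mulr1.
- by move=> x y w z [? ?] [? ?] [? ?]; rewrite mulrACA !lb_cocycle.
Defined.

Lemma lb_tr_neq0 X (L : line_bundle X) x y z :
  lb_dom L x z -> lb_dom L y z -> lb_tr L x y z != 0.
Proof.
move=> hx hy; apply/eqP => e.
have := lb_cocycle hx hy hx; rewrite e mul0r lb_id // => /esym/eqP.
by rewrite oner_eq0.
Qed.

Lemma regularX X (p : X) (f : X -> K) n :
  regular_at p f -> regular_at p (fun q => f q ^+ n).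
Proof.
move=> hf; elim: n => [|n IHn].
  have -> : (fun q : X => f q ^+ 0) = (fun=> 1).
    by apply/funext => q; rewrite expr0.
  exact: regular_cst.
have -> : (fun q => f q ^+ n.+1) = (fun q => f q * f q ^+ n).
  by apply/funext => q; rewrite exprS.
exact: regularM.
Qed.

Lemma regularXz X (p : X) (f : X -> K) (k : int) :
  regular_at p f -> f p != 0 -> regular_at p (fun q => f q ^ k).
Proof.
case: k => n hf fp; first exact: regularX.
have -> : (fun q => f q ^ Negz n) = (fun q => (f q ^+ n.+1)^-1) by [].
by apply: regularV; [apply: regularX|rewrite expf_neq0].
Qed.

Definition lb_pow X (L : line_bundle X) (k : int) : line_bundle X.
Proof.
apply: (@LineBundle K X (lb_dom L) (fun x y z => lb_tr L x y z ^ k)).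
- exact: lb_open.
- exact: lb_mem.
- by move=> x y z hx hy; apply: regularXz; [apply: lb_regular|apply: lb_tr_neq0].
- by move=> x z hx; rewrite lb_id // exp1rz.
- by move=> x y w z hx hy hw; rewrite -expfzMl lb_cocycle.
Defined.

Definition lb_pullback X Y (f : morphism X Y) (L : line_bundle Y) :
  line_bundle X.
Proof.
apply: (@LineBundle K X (fun x => f @^-1` lb_dom L (f x))
          (fun x y z => lb_tr L (f x) (f y) (f z))).
- move=> x; apply: open_comp; last exact: lb_open.
  by move=> z _; apply: mor_continuous.
- by move=> x; apply: lb_mem.
- by move=> x y z hx hy; apply: mor_regular; apply: lb_regular.
- by move=> x z hx; apply: lb_id.
- by move=> x y w z hx hy hw; apply: lb_cocycle.
Defined.

End LineBundles.

Section Degree.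
Variable K : fieldType.
Implicit Types X : fspace K.

(** The quotient of the local ring at [p] by [a] has [K]-dimension [n]; [b] lifts
    a basis. *)
Definition colength X (p : X) (a : X -> K) (n : nat) : Prop :=
  exists b : 'I_n -> X -> K, (forall i, regular_at p (b i)) /\
    forall f, regular_at p f -> exists! c : {ffun 'I_n -> K},
      exists2 h, regular_at p h &
        \forall q \near p, f q = \sum_(i < n) c i * b i q + h q * a q.

(** A nowhere vanishing section over a nonempty open subset, i.e. (on an
    irreducible space) a nonzero rational section. *)
Definition rational_section X (L : line_bundle X) (V : set X)
    (s : X -> X -> K) : Prop :=
  [/\ open V, V !=set0,
      forall x z, V z -> lb_dom L x z -> regular_at z (s x) /\ s x z != 0 &
      forall x y z, V z -> lb_dom L x z -> lb_dom L y z ->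
        s x z = lb_tr L x y z * s y z].

(** On a curve: the order of vanishing at [p], computed from an expression
    [a / b] of the section in the trivialisation around [p].  A finite
    colength forces the germs of [a] and [b] to be nonzero. *)
Definition section_order X (V : set X) (s : X -> X -> K) (p : X)
    (k : int) : Prop :=
  exists (a b : X -> K) (na nb : nat),
    [/\ regular_at p a, regular_at p b, colength p a na, colength p b nb &
        (\forall q \near p, V q -> b q * s p q = a q) /\
        k = na%:Z - nb%:Z].

(** The order vanishes outside of the finite set of points of the curve that do
    not belong to [V], so the sum has finite support. *)
Definition has_degree X (L : line_bundle X) (d : int) : Prop :=
  exists (V : set X) (s : X -> X -> K) (ord : X -> int),
    [/\ rational_section L V s, forall p, section_order V s p (ord p) &
        d = \sum_(p \in [set: X]) ord p].

Definition integral_curve X (C : set X) : Prop :=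
  [/\ closed C, irreducible_set C, ~ (exists x, C = [set x]) &
      forall D : set X, closed D -> irreducible_set D -> D `<=` C ->
        D = C \/ exists x, D = [set x]].

Definition numerically_trivial X (L : line_bundle X) : Prop :=
  forall C : set X, integral_curve C ->
    has_degree (lb_pullback (sub_incl C) L) 0.

Definition numerically_equivalent X (L M : line_bundle X) : Prop :=
  numerically_trivial (lb_tensor L (lb_pow M (-1))).

(** The classes of [L 0, ..., L (r - 1)] form a basis of the free abelian group
    of line bundles modulo numerically trivial ones. *)
Definition picard_number X (r : nat) : Prop :=
  exists L : 'I_r -> line_bundle X, forall M : line_bundle X,
    exists! k : {ffun 'I_r -> int},
      numerically_equivalent M
        (\big[@lb_tensor K X/lb_trivial X]_(i < r) lb_pow (L i) (k i)).

End Degree.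

Section Picard.
Variable K : fieldType.
Implicit Types X P : fspace K.

(** [P], with the Poincare bundle [PP], represents the relative Picard functor
    sending [T] to the line bundles on [X * T] modulo those coming from [T].
    Only reduced test schemes [T] are considered; in characteristic 0 nothing
    is lost, since the Picard scheme, being a group scheme locally of finite
    type, is reduced (Cartier).  Etale sheafification is not needed as [X] has
    a rational point. *)
Definition is_picard_scheme X P (PP : line_bundle (fs_pair X P)) : Prop :=
  locally_affine P /\
  forall T : fspace K, locally_affine T ->
  forall M : line_bundle (fs_pair X T),
    let classifies (g : morphism T P) :=
      exists N : line_bundle T,
        lb_iso M (lb_tensor (lb_pullback (base_change X g) PP)
                            (lb_pullback (pair_snd X T) N)) in
    exists g : morphism T P, classifies g /\
      forall g' : morphism T P, classifies g' -> g' =1 g.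

(** The identity [e] of the Picard scheme is the point parametrising the trivial
    line bundle; the identity component is the connected component of [e]. *)
Definition pic0_trivial X : Prop :=
  exists (P : fspace K) (PP : line_bundle (fs_pair X P)) (e : P),
    [/\ is_picard_scheme PP,
        lb_iso (lb_pullback (pair_slice X e) PP) (lb_trivial X) &
        connected_component [set: P] e = [set e]].

End Picard.

(* Main.v *)
(** Since [Pic^0 X = 0], the classifying map of a line bundle on [X * T] is
    constant for connected [T], so the bundle is an external product [A (x) B].
    Hence for [psi : X * T -> Z], pulling back a hyperplane bundle of [Z], the
    bundles [psi (a, b) (x) psi (a', b')] and [psi (a, b') (x) psi (a', b)] are
    isomorphic for all maps [a, a', b, b'] into [X] and [T]; quotients of their
    sections are global functions, hence constants. Picard number one gives,
    by degrees on curves, that a map contracting some curve is constant.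
    Together these show that if a component [f_j] of the isomorphism depends on
    the coordinate [x_k], and a component [g_i] of its inverse depends on [y_j],
    then [i = k]. So each [f_j] depends on exactly one coordinate, and these
    dependences form the required permutation. *)
Require Import Defs.
From HB Require Import structures.
From mathcomp Require Import all_boot all_order all_algebra perm.
From mathcomp Require Import all_classical all_reals.
From mathcomp Require Import topology.
From mathcomp Require Import ring zify lra.
From mathcomp Require Import -(notations) mpoly.

Set Implicit Arguments.
Unset Strict Implicit.
Unset Printing Implicit Defensive.

Import Order.TTheory GRing.Theory Num.Theory.
Local Open Scope classical_set_scope.
Local Open Scope ring_scope.

(** * Relative dimension of function spaces *)

(** The two dependences meet in the map [psi (y, w)] on [Y_j * X_k]: put [w] in coordinate [k],
    apply [f], overwrite coordinate [j] by [y], apply [g_i]. On the graph of the slice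
    [h : X_k -> Y_j] of [f_j] it is constant when [i <> k], because [g] inverts [f]. The cross-ratio
    argument moves this to a fixed [w], so a slice of [g_i] contracts the image of the nonconstant
    [h]. The obstacle is foundational: degrees must be well defined on possibly singular curves, and
    a nonconstant map must be nonconstant on some integral curve, without cohomology or dimension
    theory. Both follow by comparing dimensions of spaces of forms, from two facts: multiplication
    by a nonzero form is injective, and a graded ideal without common zero contains all forms of
    large degree. The latter, the projective Nullstellensatz, comes from the uncountability of the
    field by a pigeonhole argument. *)

Section RelativeDimension.
Variables (K : fieldType) (T : Type).
Implicit Types (A B D : set (T -> K)) (f g u : T -> K).

Definition lcomb n (c : 'I_n -> K) (b : 'I_n -> T -> K) : T -> K :=
  fun q => \sum_(i < n) c i * b i q.

Definition vsubspace A :=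
  A (fun=> 0) /\ forall c f g, A f -> A g -> A (fun q => c * f q + g q).

Definition spans A B n (b : 'I_n -> T -> K) :=
  forall f, B f -> exists c : 'I_n -> K, A (fun q => f q - lcomb c b q).

Definition indep A n (b : 'I_n -> T -> K) :=
  forall c : 'I_n -> K, A (lcomb c b) -> forall i, c i = 0.

(** [dim (B / A) = n], without forming the quotient. *)
Definition reldim A B n := exists b : 'I_n -> T -> K,
  [/\ forall i, B (b i), spans A B b & indep A b].

Lemma vsubspace0 A : vsubspace A -> A (fun=> 0).
Proof. by case. Qed.

Lemma vsubspaceD A f g : vsubspace A -> A f -> A g -> A (fun q => f q + g q).
Proof.
move=> [_ h] hf hg; have := h 1 f g hf hg.
by congr A; apply/funext => q; rewrite mul1r.
Qed.

Lemma vsubspaceZ A c f : vsubspace A -> A f -> A (fun q => c * f q).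
Proof.
move=> [h0 h] hf; have := h c f _ hf h0.
by congr A; apply/funext => q; rewrite addr0.
Qed.

Lemma vsubspaceB A f g : vsubspace A -> A f -> A g -> A (fun q => f q - g q).
Proof.
move=> hA hf hg; have := vsubspaceD hA hf (vsubspaceZ (-1) hA hg).
by congr A; apply/funext => q; rewrite mulN1r.
Qed.

Lemma vsubspace_sum A (I : Type) (r : seq I) (F : I -> T -> K) :
  vsubspace A -> (forall i, A (F i)) -> A (fun q => \sum_(i <- r) F i q).
Proof.
move=> hA hF; elim: r => [|i r IHr].
  have := vsubspace0 hA; congr A.
  by apply/funext => q; rewrite big_nil.
have := vsubspaceD hA (hF i) IHr.
by congr A; apply/funext => q; rewrite big_cons.
Qed.

Lemma vsubspace_lcomb A n (c : 'I_n -> K) b :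
  vsubspace A -> (forall i, A (b i)) -> A (lcomb c b).
Proof. by move=> hA hb; apply: vsubspace_sum => // i; apply: vsubspaceZ. Qed.

(** Steinitz bound: expressing [b'] through [b] modulo [A] gives an [m] by [n] matrix, and for
    [n < m] a nonzero row vector in its left kernel is a relation between the [b' i] modulo [A]. *)
Lemma spans_indep_leq A B n m (b : 'I_n -> T -> K) (b' : 'I_m -> T -> K) :
  vsubspace A -> spans A B b -> (forall i, B (b' i)) -> indep A b' ->
  (m <= n)%N.
Proof.
move=> hA hb hb' ind.
have /choice[M hM] : forall i, exists c : 'I_n -> K,
    A (fun q => b' i q - lcomb c b q).
  by move=> i; exact: hb (hb' i).
pose MM := \matrix_(i, j) M i j.
rewrite leqNgt; apply/negP => nm.
have ker0 : kermx MM != 0.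
  rewrite -mxrank_eq0 mxrank_ker subn_eq0 -ltnNge.
  by apply: leq_ltn_trans nm; apply: rank_leq_col.
have /rowV0Pn[v vker v0] := ker0.
have vM : v *m MM = 0 by apply/sub_kermxP.
case/eqP: v0; apply/rowP => i; rewrite mxE.
apply: (ind (fun i => v 0 i)).
have h : A (fun q => \sum_(i <- enum 'I_m) (v 0 i * (b' i q - lcomb (M i) b q))).
  by apply: vsubspace_sum => // j; apply: vsubspaceZ.
move: h; congr A; apply/funext => q; rewrite big_enum /= /lcomb.
under eq_bigr do rewrite mulrBr.
rewrite sumrB [X in _ - X](_ : _ = 0) ?subr0 //.
under eq_bigr do rewrite mulr_sumr.
rewrite exchange_big /= big1 // => j _.
have /rowP/(_ j) := vM; rewrite !mxE => e.
transitivity ((\sum_i v 0 i * MM i j) * b j q); last by rewrite e mul0r.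
by rewrite mulr_suml; apply: eq_bigr => k _; rewrite mxE mulrA.
Qed.

Lemma reldim_uniq A B n m : vsubspace A ->
  reldim A B n -> reldim A B m -> n = m.
Proof.
move=> hA [b [bB bs bi]] [b' [b'B b's b'i]]; apply/eqP; rewrite eqn_leq.
by rewrite (spans_indep_leq hA b's bB bi) (spans_indep_leq hA bs b'B b'i).
Qed.

Definition fcons n (f : T -> K) (b : 'I_n -> T -> K) (i : 'I_n.+1) : T -> K :=
  if unlift ord0 i is Some j then b j else f.

Lemma lcomb_fcons n (c : 'I_n.+1 -> K) f b q :
  lcomb c (fcons f b) q = c ord0 * f q + lcomb (fun i => c (lift ord0 i)) b q.
Proof.
rewrite /lcomb big_ord_recl /fcons unlift_none; congr (_ + _).
by apply: eq_bigr => i _; rewrite liftK.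
Qed.

Lemma indep_fcons A n f (b : 'I_n -> T -> K) : vsubspace A -> indep A b ->
  ~ (exists c, A (fun q => f q - lcomb c b q)) -> indep A (fcons f b).
Proof.
move=> hA bi hf c hc.
have hc' : A (fun q => c ord0 * f q + lcomb (fun i => c (lift ord0 i)) b q).
  by move: hc; congr A; apply/funext => q; rewrite lcomb_fcons.
have c0 : c ord0 = 0.
  apply/eqP/negP => /negP c0; apply: hf.
  exists (fun i => - (c ord0)^-1 * c (lift ord0 i)).
  have := vsubspaceZ (c ord0)^-1 hA hc'; congr A; apply/funext => q.
  rewrite mulrDr mulrA mulVf // mul1r; congr (_ + _).
  rewrite /lcomb mulr_sumr -sumrN; apply: eq_bigr => i _.
  by rewrite mulNr mulNr opprK mulrA.
move=> i; case: (unliftP ord0 i) => [j ->|-> //].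
apply: (bi (fun i => c (lift ord0 i))).
by move: hc'; congr A; apply/funext => q; rewrite c0 mul0r add0r.
Qed.

(** The spanning family need not lie in [B], so no basis can be extracted from it. A longest
    independent family inside [B] is taken instead; maximality makes it span. *)
Lemma spans_reldim A B n (b : 'I_n -> T -> K) : vsubspace A ->
  spans A B b -> exists2 m, (m <= n)%N & reldim A B m.
Proof.
move=> hA hb.
pose P m := `[< exists b' : 'I_m -> T -> K, (forall i, B (b' i)) /\ indep A b' >].
have exP : exists m, P m.
  by exists 0%N; apply/asboolP; exists (fun _ => fun=> 0); split=> [[]|c _ []].
have ubP m : P m -> (m <= n)%N.
  by move=> /asboolP[b' [b'B b'i]]; apply: spans_indep_leq hA hb b'B b'i.
case: (ex_maxnP exP ubP) => m Pm mmax; exists m; first exact: ubP.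
move: Pm => /asboolP[b' [b'B b'i]]; exists b'; split=> // f Bf.
apply: contrapT => hf.
suff : P m.+1 by move/mmax; rewrite ltnn.
apply/asboolP; exists (fcons f b'); split; last exact: indep_fcons.
by move=> i; rewrite /fcons; case: unliftP.
Qed.

Lemma spansS A B B' n (b : 'I_n -> T -> K) : B' `<=` B ->
  spans A B b -> spans A B' b.
Proof. by move=> BB hb f /BB/hb. Qed.

Lemma spansSl A A' B n (b : 'I_n -> T -> K) : A `<=` A' ->
  spans A B b -> spans A' B b.
Proof. by move=> AA hb f /hb[c /AA]; exists c. Qed.

Lemma reldim_trans A B D n m : vsubspace A -> vsubspace B -> A `<=` B ->
  B `<=` D ->
  reldim A B n -> reldim B D m -> reldim A D (n + m).
Proof.
move=> hA hB AB BD [b [bB bs bi]] [b' [b'D b's b'i]].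
pose bb i := match fintype.split i with inl j => b j | inr j => b' j end.
have lE (c : 'I_(n + m) -> K) q : lcomb c bb q =
    lcomb (fun i => c (lshift m i)) b q + lcomb (fun i => c (rshift n i)) b' q.
  rewrite /lcomb big_split_ord /=; congr (_ + _); apply: eq_bigr => i _.
    by rewrite /bb (unsplitK (inl i)).
  by rewrite /bb (unsplitK (inr i)).
exists bb; split.
- by move=> i; rewrite /bb; case: fintype.split => j //; apply/BD.
- move=> f Df; have [c' hc'] := b's f Df; have [c hc] := bs _ hc'.
  exists (fun i => match fintype.split i with inl j => c j | inr j => c' j end).
  move: hc; congr A; apply/funext => q; rewrite lE.
  rewrite -addrA -opprD [lcomb c' _ _ + _]addrC; congr (_ - (_ + _)).
    by apply: eq_bigr => i _; rewrite (unsplitK (inl i)).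
  by apply: eq_bigr => i _; rewrite (unsplitK (inr i)).
- move=> c hc.
  have hc1 : B (lcomb (fun i => c (rshift n i)) b').
    have hb : B (lcomb (fun i => c (lshift m i)) b) by apply: vsubspace_lcomb.
    have := vsubspaceB hB (AB _ hc) hb; congr B; apply/funext => q.
    by rewrite lE addrAC subrr add0r.
  have c1 := b'i _ hc1.
  have c2 : forall i, c (lshift m i) = 0.
    apply: (bi (fun i => c (lshift m i))); move: hc; congr A; apply/funext => q.
    rewrite lE [X in _ + X](_ : _ = 0) ?addr0 // /lcomb big1 // => i _.
    by rewrite c1 mul0r.
  by move=> i; rewrite -(fintype.splitK i); case: fintype.split => j; rewrite /= ?c1 ?c2.
Qed.

Lemma reldim_split A B D k : vsubspace A -> vsubspace B -> A `<=` B ->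
  B `<=` D -> reldim A D k ->
  exists i j, [/\ reldim A B i, reldim B D j & (i + j = k)%N].
Proof.
move=> hA hB AB BD hk; have [b [bD bs bi]] := hk.
have [i _ hi] := spans_reldim hA (spansS BD bs).
have [j _ hj] := spans_reldim hB (spansSl AB bs).
exists i, j; split=> //.
exact: reldim_uniq hA (reldim_trans hA hB AB BD hi hj) hk.
Qed.

Lemma reldim0_sub A B : vsubspace A -> reldim A B 0 -> B `<=` A.
Proof.
move=> hA [b [_ bs _]] f /bs[c]; congr A; apply/funext => q.
by rewrite /lcomb big_ord0 subr0.
Qed.

Lemma sub_reldim0 A B : vsubspace A -> B `<=` A -> reldim A B 0.
Proof.
move=> hA BA; exists (fun _ => fun=> 0); split=> [[]//|f /BA Af|c _ []//].
exists (fun _ => 0); move: Af; congr A; apply/funext => q.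
by rewrite /lcomb big_ord0 subr0.
Qed.

(** Finite dimension turns injectivity into surjectivity: this is how an injective multiplication on
    a space of forms or germs is shown to be onto. *)
Lemma reldim_inj_sub A B D k : vsubspace A -> vsubspace B -> A `<=` B ->
  B `<=` D -> reldim A B k -> reldim A D k -> D `<=` B.
Proof.
move=> hA hB AB BD hk hk'; have [i [j [hi hj ij]]] := reldim_split hA hB AB BD hk'.
apply: reldim0_sub => //; suff -> : 0%N = j by [].
have := reldim_uniq hA hi hk; lia.
Qed.

Section Transfer.
Variables (u : T -> K) (A B A' B' : set (T -> K)).
Hypotheses (hA : vsubspace A) (hA' : vsubspace A').
Hypothesis uB : forall f, B f -> B' (fun q => u q * f q).
Hypothesis uA : forall f, A f -> A' (fun q => u q * f q).
Hypothesis usurj : forall g, B' g ->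
  exists2 f, B f & A' (fun q => g q - u q * f q).

Lemma mul_lcomb n (c : 'I_n -> K) b q :
  u q * lcomb c b q = lcomb c (fun i q => u q * b i q) q.
Proof. by rewrite /lcomb mulr_sumr; apply: eq_bigr => i _; rewrite mulrCA. Qed.

Lemma spans_transfer n (b : 'I_n -> T -> K) : spans A B b ->
  spans A' B' (fun i q => u q * b i q).
Proof.
move=> hb g /usurj[f Bf hf]; have [c hc] := hb f Bf.
exists c; have := vsubspaceD hA' hf (uA hc); congr A'; apply/funext => q.
by rewrite -mul_lcomb mulrBr addrA subrK.
Qed.

Lemma reldim_transfer_leq n : reldim A B n ->
  exists2 m, (m <= n)%N & reldim A' B' m.
Proof.
move=> [b [bB bs bi]]; apply: spans_reldim => //; exact: spans_transfer bs.
Qed.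

Hypothesis uinj : forall f, B f -> A' (fun q => u q * f q) -> A f.

(** Multiplication by [u] induces a linear map from [B / A] to [B' / A']; [usurj] makes it onto and
    [uinj] injective. *)
Lemma reldim_transfer n : vsubspace B -> reldim A B n -> reldim A' B' n.
Proof.
move=> hB [b [bB bs bi]]; exists (fun i q => u q * b i q); split.
- by move=> i; apply: uB.
- exact: spans_transfer bs.
- move=> c hc; apply: bi; apply: uinj; first exact: vsubspace_lcomb.
  by move: hc; congr A'; apply/funext => q; rewrite mul_lcomb.
Qed.

End Transfer.

Lemma vsubspaceP A : vsubspace A <-> [/\ A (fun=> 0),
  forall f g, A f -> A g -> A (fun q => f q + g q) &
  forall c f, A f -> A (fun q => c * f q)].
Proof.
split=> [hA|[h0 hD hZ]].
  split=> [|f g|c f]; [exact: vsubspace0|exact: vsubspaceD|exact: vsubspaceZ].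
by split=> // c f g hf hg; apply: (hD (fun q => c * f q)) => //; apply: hZ.
Qed.

Lemma spans_refl A B n (b : 'I_n -> T -> K) :
  vsubspace A -> spans [set f | f = fun=> 0] B b -> spans A B b.
Proof. by move=> hA; apply: spansSl => f ->; apply: vsubspace0. Qed.

Lemma vsubspace_zero : vsubspace [set f : T -> K | f = fun=> 0].
Proof.
by split=> // c f g -> ->; apply/funext => q; rewrite mulr0 addr0.
Qed.

(** Every strict inclusion lowers the finite dimension over [A]. This supplies the Artinian property
    of a local ring modulo an element of finite colength. *)
Lemma reldim_chain A D k (M : nat -> set (T -> K)) : vsubspace A ->
  reldim A D k -> M 0%N `<=` D ->
  (forall i, vsubspace (M i)) -> (forall i, A `<=` M i) ->
  (forall i, M i.+1 `<=` M i) -> exists i, M i `<=` M i.+1.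
Proof.
move=> hA [b [_ bs _]] MD hM AM MM.
have MS i : M i `<=` D by elim: i => // i IHi; apply: subset_trans IHi.
have /choice[d hd] : forall i, exists m, reldim A (M i) m.
  by move=> i; have [m _ ?] := spans_reldim hA (spansS (MS i) bs); exists m.
apply: contrapT => hno.
have dlt i : (d i.+1 < d i)%N.
  have [x [y [hx hy xy]]] :=
    reldim_split hA (hM i.+1) (AM i.+1) (MM i) (hd i).
  have dx := reldim_uniq hA (hd i.+1) hx.
  case: y hy xy => [/reldim0_sub h|y _ <-]; last by rewrite -dx; lia.
  by exfalso; apply: hno; exists i; apply: h.
have : forall i, (d i + i <= d 0)%N by elim=> [|i]; [lia|have := dlt i; lia].
by move=> /(_ (d 0%N).+1); lia.
Qed.

End RelativeDimension.

(** * Homogeneous forms and the projective Nullstellensatz *)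

Section Forms.
Variables (K : fieldType) (n : nat).
Implicit Types (f g : ('I_n -> K) -> K) (v : 'I_n -> K).

Definition form (d : nat) : set (('I_n -> K) -> K) :=
  [set f | exists2 P : mpoly.mpoly n K,
     homogeneous d P & f = (fun v => mpoly.meval v P)].

Lemma form_zero d : form d (fun=> 0).
Proof.
exists 0; last by apply/funext => v; rewrite mpoly.meval0.
by rewrite /homogeneous mpoly.msupp0.
Qed.

Lemma formD d f g : form d f -> form d g -> form d (fun v => f v + g v).
Proof.
move=> [P hP ->] [Q hQ ->]; exists (P + Q).
  exact: (@mpoly.dhomogD n K _ d P Q hP hQ).
by apply/funext => v; rewrite mpoly.mevalD.
Qed.

Lemma formZ d c f : form d f -> form d (fun v => c * f v).
Proof.
move=> [P hP ->]; exists (c *: P).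
  exact: (@mpoly.dhomogZ n K _ d c P hP).
by apply/funext => v; rewrite mpoly.mevalZ.
Qed.

Lemma form_vsubspace d : vsubspace (form d).
Proof.
by apply/vsubspaceP; split=> [|f g|c f]; [exact: form_zero|exact: formD|exact: formZ].
Qed.

Lemma formM d e f g : form d f -> form e g -> form (d + e) (fun v => f v * g v).
Proof.
move=> [P hP ->] [Q hQ ->]; exists (P * Q).
  exact: (@mpoly.dhomogM n K _ d P e Q hP hQ).
by apply/funext => v; rewrite mpoly.mevalM.
Qed.

Lemma form_cst c : form 0 (fun=> c).
Proof.
exists (mpoly.mpolyC n c); last by apply/funext => v; rewrite mpoly.mevalC.
rewrite /homogeneous mpoly.msuppC; case: eqP => //= _.
by rewrite mpoly.mdeg0 eqxx.
Qed.

Lemma form_coord i : form 1 (fun v => v i).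
Proof.
exists (mpoly.mpolyX K (mpoly.mnm1 i)).
  by rewrite /homogeneous mpoly.msuppX /= mpoly.mdeg1 eqxx.
by apply/funext => v; rewrite mpoly.mevalXU.
Qed.

Lemma formX d f k : form d f -> form (k * d) (fun v => f v ^+ k).
Proof.
move=> hf; elim: k => [|k IHk]; first exact: (form_cst 1).
rewrite mulSn; have := formM hf IHk; congr form.
by apply/funext => v; rewrite exprS.
Qed.

Lemma form_prod (I : Type) (r : seq I) (F : I -> ('I_n -> K) -> K) :
  (forall i, form 1 (F i)) -> form (size r) (fun v => \prod_(i <- r) F i v).
Proof.
move=> hF; elim: r => [|i r IHr].
  by have := form_cst 1; congr form; apply/funext => v; rewrite big_nil.
rewrite -[size _]/(size r).+1 -add1n; have := formM (hF i) IHr; congr form.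
by apply/funext => v; rewrite big_cons.
Qed.

Definition monomial (m : mpoly.multinom n) v := \prod_i v i ^+ m i.

Lemma form_monomial m : form (mpoly.mdeg m) (monomial m).
Proof.
exists (mpoly.mpolyX K m); first by rewrite /homogeneous mpoly.msuppX /= eqxx.
by apply/funext => v; rewrite mpoly.mevalX.
Qed.

Lemma monomialD m m' v :
  monomial (mpoly.mnm_add m m') v = monomial m v * monomial m' v.
Proof.
rewrite /monomial -big_split /=; apply: eq_bigr => i _.
by rewrite mpoly.mnmDE exprD.
Qed.

Lemma monomial1 i v : monomial (mpoly.mnm1 i) v = v i.
Proof.
rewrite /monomial (bigD1 i) //= mpoly.mnm1E eqxx expr1 big1 ?mulr1 // => j ji.
by rewrite mpoly.mnm1E eq_sym (negPf ji) expr0.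
Qed.

Lemma form_ind d (A : set (('I_n -> K) -> K)) : vsubspace A ->
  (forall m, mpoly.mdeg m = d -> A (monomial m)) -> form d `<=` A.
Proof.
move=> hA hm f [P /allP hP ->].
have -> : (fun v => mpoly.meval v P) = (fun v =>
    \sum_(m <- mpoly.msupp P) (mpoly.mcoeff m P * monomial m v)).
  by apply/funext => v; rewrite mpoly.mevalE.
elim: (mpoly.msupp P) hP => [_|m s IHs hs].
  have := vsubspace0 hA; congr A; apply/funext => v; by rewrite big_nil.
have h1 : A (monomial m) by apply: hm; apply/eqP/hs; rewrite mem_head.
have h2 : A (fun v => \sum_(m <- s) mpoly.mcoeff m P * monomial m v).
  by apply: IHs => x xs; apply: hs; rewrite inE xs orbT.
have := vsubspaceD hA (vsubspaceZ (mpoly.mcoeff m P) hA h1) h2; congr A.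
by apply/funext => v; rewrite big_cons.
Qed.

Lemma monomial0 m : mpoly.mdeg m = 0%N -> monomial m = fun=> 1.
Proof.
move=> /eqP; rewrite mpoly.mdeg_eq0 => /eqP ->; apply/funext => v.
by rewrite /monomial big1 // => i _; rewrite mpoly.mnm0E expr0.
Qed.

Lemma form0P f : form 0 f -> exists c, f = fun=> c.
Proof.
apply: (form_ind (A := [set f | exists c, f = fun=> c])).
  split=> [|c _ _ [a ->] [b ->]]; first by exists 0.
  by exists (c * a + b).
by move=> m m0; exists 1; rewrite monomial0.
Qed.

Lemma formS d f : form d.+1 f -> exists2 g : 'I_n -> ('I_n -> K) -> K,
  forall i, form d (g i) & f = fun v => \sum_i v i * g i v.
Proof.
apply: (form_ind (A := [set f | exists2 g : 'I_n -> ('I_n -> K) -> K,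
  forall i, form d (g i) & f = fun v => \sum_i v i * g i v])).
  split.
    exists (fun _ => fun=> 0); first by move=> i; apply: form_zero.
    by apply/funext => v; rewrite big1 // => i _; rewrite mulr0.
  move=> c _ _ [g hg ->] [h hh ->].
  exists (fun i v => c * g i v + h i v).
    by move=> i; apply: formD => //; apply: formZ.
  apply/funext => v; rewrite mulr_sumr -big_split /=; apply: eq_bigr => i _.
  by ring.
move=> m md; have [i mi] : exists i, (0 < m i)%N.
  apply: contrapT => h; move: md; rewrite mpoly.mdegE big1 // => i _.
  by apply/eqP; rewrite -leqn0 leqNgt; apply/negP => hi; apply: h; exists i.
have mE : m = mpoly.mnm_add (mpoly.mnm_sub m (mpoly.mnm1 i)) (mpoly.mnm1 i).
  apply/mpoly.mnmP => j; rewrite mpoly.mnmDE mpoly.mnmBE mpoly.mnm1E.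
  by case: eqP => [<-|_]; lia.
set m' := mpoly.mnm_sub _ _ in mE.
have m'd : mpoly.mdeg m' = d.
  by move: md; rewrite mE mpoly.mdegD mpoly.mdeg1; lia.
exists (fun j v => if j == i then monomial m' v else 0).
  move=> j; case: eqP => _; last exact: form_zero.
  by rewrite -m'd; apply: form_monomial.
apply/funext => v; rewrite (bigD1 i) //= eqxx big1 ?addr0.
  by rewrite mE monomialD monomial1 mulrC.
by move=> j /negPf ->; rewrite mulr0.
Qed.

Lemma form_hom d f c v : form d f -> f (fun i => c * v i) = c ^+ d * f v.
Proof.
apply: (form_ind (A := [set f | f (fun i => c * v i) = c ^+ d * f v])).
  split=> /=; first by rewrite mulr0.
  by move=> a g h /= -> ->; rewrite mulrDr mulrCA.
move=> m <- /=; rewrite /monomial mpoly.mdegE -prodrXr -big_split /=.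
by apply: eq_bigr => i _; rewrite exprMn.
Qed.

Lemma spans_finType (T : Type) (A B : set (T -> K)) (I : finType)
    (b : I -> T -> K) :
  (forall F, B F -> exists c : I -> K, A (fun q => F q - \sum_i c i * b i q)) ->
  spans A B (fun k : 'I_#|I| => b (enum_val k)).
Proof.
move=> h F /h[c hc]; exists (fun k => c (enum_val k)); move: hc; congr A.
apply/funext => q; congr (_ - _); rewrite /lcomb.
by rewrite -(big_enum_val (fun i => c i * b i q)).
Qed.

Lemma form_finite d : exists (k : nat) (b : 'I_k -> ('I_n -> K) -> K),
  (forall i, form d (b i)) /\ spans [set f | f = fun=> 0] (form d) b.
Proof.
elim: d => [|d [k [b [bd bs]]]].
  exists 1%N, (fun _ => fun=> 1); split; first by move=> i; apply: form_cst.
  move=> f /form0P[c ->]; exists (fun=> c); apply/funext => v.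
  by rewrite /lcomb big_ord1 /= mulr1 subrr.
pose bb (p : 'I_n * 'I_k) v := v p.1 * b p.2 v.
exists #|{: 'I_n * 'I_k}|, (fun l => bb (enum_val l)); split.
  move=> i; rewrite /bb -add1n; apply: formM => //; exact: form_coord.
apply: spans_finType => f /formS[g hg ->].
have /choice[c hc] : forall i, exists c : 'I_k -> K,
    (fun q => g i q - lcomb c b q) = fun=> 0 by move=> i; exact: bs _ (hg i).
exists (fun p => c p.1 p.2); apply/funext => v.
rewrite -(pair_bigA _ (fun i j => c i j * bb (i, j) v)) /= -sumrB.
rewrite big1 // => i _.
have /(congr1 (@^~ v)) /eqP := hc i; rewrite subr_eq0 => /eqP ->.
rewrite /lcomb mulr_sumr -sumrB big1 // => j _; rewrite /bb /=; ring.
Qed.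

Definition graded_ideal (J : nat -> set (('I_n -> K) -> K)) :=
  [/\ forall d, J d `<=` form d, forall d, vsubspace (J d) &
      forall d e f g, J d f -> form e g -> J (d + e)%N (fun v => f v * g v)].

End Forms.

Lemma infinite_set_uniq (T : eqType) (A : set T) m : infinite_set A ->
  exists s : seq T, [/\ uniq s, size s = m & forall x, x \in s -> A x].
Proof.
move=> hA; elim: m => [|m [s [us ss sA]]]; first by exists [::].
have [x Ax xs] : exists2 x, A x & x \notin s.
  apply: contrapT => h; apply: hA; apply: (sub_finite_set _ (finite_seq s)).
  move=> x Ax /=; apply: contrapT => /negP xs; apply: h; by exists x.
exists (x :: s); split=> /=; [by rewrite xs|by rewrite ss|].
by move=> y; rewrite inE => /predU1P[->|/sA].
Qed.

Lemma uncountable_fiber (T : Type) (k : T -> nat) : ~ countable [set: T] ->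
  exists m, infinite_set [set x | k x = m].
Proof.
move=> hT; apply: contrapT => h; apply: hT.
have -> : [set: T] = \bigcup_(m in [set: nat]) [set x | k x = m].
  by apply/seteqP; split=> // x _; exists (k x).
apply: bigcup_countable => // m _; apply: finite_set_countable.
by apply: contrapT => hm; apply: h; exists m.
Qed.

(** * The projective Nullstellensatz over an uncountable field *)

Section Nullstellensatz.
Variables (K : closedFieldType) (n : nat).
Hypothesis Kunc : ~ countable [set: K].
Implicit Types (f g : ('I_n -> K) -> K) (v : 'I_n -> K).
Implicit Types (J : nat -> set (('I_n -> K) -> K)).

Lemma graded_ideal_full J : graded_ideal J ->
  (forall i, exists k, J k (fun v => v i ^+ k)) ->
  exists d0, forall d, (d0 <= d)%N -> form d `<=` J d.
Proof.
move=> [Jf Js JM] /choice[k hk].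
exists (\sum_i k i).+1 => d hd.
apply: form_ind => // m md.
have [i mi] : exists i, (k i <= m i)%N.
  apply: contrapT => h; move: hd; rewrite -md mpoly.mdegE ltnNge => /negP; apply.
  apply: leq_sum => i _; rewrite leqNgt; apply/negP => hi.
  by apply: h; exists i; apply: ltnW.
pose ki := mpoly.mnm_muln (mpoly.mnm1 i) (k i).
have mE : m = mpoly.mnm_add ki (mpoly.mnm_sub m ki).
  apply/mpoly.mnmP => j.
  rewrite mpoly.mnmDE mpoly.mnmBE mpoly.mulmnE mpoly.mnm1E.
  by case: eqP => [<-|_]; lia.
have kiE : @monomial K n ki = fun v => v i ^+ k i.
  apply/funext => v; rewrite /monomial (bigD1 i) //= big1 ?mulr1.
    by rewrite mpoly.mulmnE mpoly.mnm1E eqxx mul1n.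
  by move=> j /negPf ji; rewrite mpoly.mulmnE mpoly.mnm1E eq_sym ji.
have := JM _ _ _ _ (hk i) (form_monomial K (mpoly.mnm_sub m ki)).
have -> : (k i + mpoly.mdeg (mpoly.mnm_sub m ki))%N = d.
  rewrite -md {2}mE mpoly.mdegD mpoly.mdegMn mpoly.mdeg1; lia.
by congr J; apply/funext => v; rewrite [in RHS]mE monomialD kiE.
Qed.

Section Extend.
Variables (J : nat -> set (('I_n -> K) -> K)) (i0 : 'I_n).
Hypothesis hJ : graded_ideal J.
Let x v := v i0.
Hypothesis Jbad : forall k, ~ J k (fun v => x v ^+ k).

(** The graded ideal generated by [J] and the linear form [v j - a * x v]. In degree 0 there is no
    multiple of a linear form, hence the separate clause. *)
Definition extend_ideal (j : 'I_n) (a : K) (d : nat) :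
    set (('I_n -> K) -> K) :=
  [set f | exists g h, [/\ J d g,
     (if d is e.+1 then form e h else h = fun=> 0) &
     f = fun v => g v + (v j - a * x v) * h v]].

Lemma form_linear j a : form 1 (fun v => v j - a * x v).
Proof.
have := formD (form_coord K j) (formZ (- a) (form_coord K i0)).
by congr form; apply/funext => v; rewrite mulNr.
Qed.

Lemma extend_ideal_graded j a : graded_ideal (extend_ideal j a).
Proof.
have [Jf Js JM] := hJ; split.
- move=> d f [g [h [hg hh ->]]]; apply: formD; first exact: Jf.
  case: d hh hg => [->|d hh] _; first by under eq_fun do rewrite mulr0; apply: form_zero.
  by rewrite -add1n; apply: formM => //; apply: form_linear.
- move=> d; split.
    exists (fun=> 0), (fun=> 0); split; first exact: vsubspace0.
      by case: d => // d; apply: form_zero.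
    by apply/funext => v; rewrite mulr0 addr0.
  move=> c _ _ [g [h [hg hh ->]]] [g' [h' [hg' hh' ->]]].
  exists (fun v => c * g v + g' v), (fun v => c * h v + h' v); split.
  + by apply: (Js d).2.
  + case: d hh hh' hg hg' => [-> -> _ _|d hh hh' _ _].
      by apply/funext => v; ring.
    by apply: (form_vsubspace K n d).2.
  + by apply/funext => v; ring.
- move=> d e _ g' [g [h [hg hh ->]]] hg'.
  exists (fun v => g v * g' v), (fun v => h v * g' v); split.
  + exact: JM.
  + case: d hh hg => [-> _|d hh _]; last by rewrite addSn; apply: formM.
    case: e hg' => [|e] hg'; first by apply/funext => v; rewrite mul0r.
    by under eq_fun do rewrite mul0r; apply: form_zero.
  + by apply/funext => v; ring.
Qed.

Lemma extend_ideal_sub j a d : J d `<=` extend_ideal j a d.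
Proof.
move=> f Jf; exists f, (fun=> 0); split=> //; first by case: d {Jf} => // d; apply: form_zero.
by apply/funext => v; rewrite mulr0 addr0.
Qed.

Lemma extend_ideal_linear j a : extend_ideal j a 1 (fun v => v j - a * x v).
Proof.
have [Jf Js JM] := hJ.
exists (fun=> 0), (fun=> 1); split; [exact: vsubspace0|exact: form_cst|].
by apply/funext => v; rewrite add0r mulr1.
Qed.

(** With [ell = v j - a * x v] and [x ^ k = g + ell * h] for some [g] in [J], the form
    [x ^ (m + k) * f] is [g * x ^ m * f + h * (x ^ m * ell * f)], which lies in [J]: the factor
    [ell] is cancelled at the cost of a power of [x]. *)
Lemma extend_ideal_cancel j a k e f :
  extend_ideal j a k (fun v => x v ^+ k) -> form e f ->
  (exists m, J (m + e.+1) (fun v => x v ^+ m * ((v j - a * x v) * f v))) ->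
  exists m, J (m + e) (fun v => x v ^+ m * f v).
Proof.
have [Jf Js JM] := hJ.
case: k => [[g [h [hg -> E]]]|k [g [h [hg hh E]]]] hf [m hm].
  exfalso; apply: (Jbad (k := 0)); rewrite E.
  by move: hg; congr J; apply/funext => v; rewrite mulr0 addr0.
exists (m + k.+1)%N.
have h1 := JM _ _ _ _ hg (formM (formX m (form_coord K i0)) hf).
have h2 := JM _ _ _ _ hm hh.
have e1 : (k.+1 + (m * 1 + e) = m + k.+1 + e)%N by lia.
have e2 : (m + e.+1 + k = m + k.+1 + e)%N by lia.
rewrite e1 in h1; rewrite e2 in h2.
have := vsubspaceD (Js _) h1 h2; congr J; apply/funext => v /=.
have /(congr1 (@^~ v)) /= Ev := E.
rewrite exprD Ev /x; ring.
Qed.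

(** A homogeneous version of the fact that the functions [1 / (t - a)], for [a] in an uncountable
    field, cannot be independent in a space of countable dimension. If each [a] put a power of [x]
    into the extended ideal, a relation between finitely many cofactors would place in [J] a power
    of [x] times a product of forms [v j - z * x v]; cancelling these leaves a power of [x] in
    [J]. *)
Lemma extend_ideal_bad j : exists a,
  forall k, ~ extend_ideal j a k (fun v => x v ^+ k).
Proof.
have [Jf Js JM] := hJ.
apply: contrapT => hno.
have /choice[kk hkk] : forall a, exists k,
    extend_ideal j a k (fun v => x v ^+ k).
  by move=> a; apply: contrapT => h; apply: hno; exists a => k hk; apply: h; exists k.
(* Uncountability enters here: one exponent serves infinitely many [a], so their cofactors lie in a
   single finite-dimensional space of forms. *)
have [k kinf] := uncountable_fiber kk Kunc.
have hk a : kk a = k -> extend_ideal j a k (fun v => x v ^+ k).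
  by move=> <-; exact: hkk.
case: k kinf hk => [|k] kinf hk.
  have [s [_ ss sA]] := infinite_set_uniq 1 kinf.
  case: s ss sA => [|a s] //= _ sA.
  have a0 := sA a (mem_head _ _).
  have [g [h [hg h0 E]]] := hk _ a0; apply: (Jbad (k := 0)).
  by rewrite E h0; move: hg; congr J; apply/funext => v; rewrite mulr0 addr0.
have [M [b [_ bs]]] := form_finite K n k.
have [s [us ss sA]] := infinite_set_uniq M.+1 kinf.
pose la (i : 'I_M.+1) := nth 0 s i.
have laP i : kk (la i) = k.+1 by apply: sA; rewrite mem_nth // ss.
have la_inj i i' : i != i' -> la i - la i' != 0.
  by move=> ii; rewrite subr_eq0 /la nth_uniq ?ss.
have /choice[gh hgh] : forall i, exists gh : (('I_n -> K) -> K) * (('I_n -> K) -> K),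
    [/\ J k.+1 gh.1, form k gh.2 &
     forall v, x v ^+ k.+1 = gh.1 v + (v j - la i * x v) * gh.2 v].
  move=> i; have [g [h [hg hh E]]] := hk _ (laP i).
  by exists (g, h); split=> // v; rewrite (congr1 (@^~ v) E).
have [c hc [i1 ci1]] : exists2 c : 'I_M.+1 -> K,
    (forall v, \sum_i c i * (gh i).2 v = 0) & exists i, c i != 0.
  apply: contrapT => hc.
  suff : (M.+1 <= M)%N by rewrite ltnn.
  apply: (spans_indep_leq (vsubspace_zero K _) bs (b' := fun i => (gh i).2)).
    by move=> i; have [] := hgh i.
  move=> c c0 i; apply: contrapT => /eqP ci; apply: hc; exists c; last by exists i.
  by move=> v; exact: (congr1 (@^~ v) c0).
(* [q] is a binary form in [v j] and [x v], and [p] is its dehomogenisation. At the node [la i1]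
   only the term [i = i1] survives, so [p] is nonzero. *)
pose ell a v := v j - a * x v.
pose q v := \sum_i c i * \prod_(l | l != i) ell (la l) v.
pose p : {poly K} := \sum_i c i *: \prod_(l | l != i) ('X - (la l)%:P).
have p_neq0 : p != 0.
  apply/eqP => p0; have := congr1 (horner^~ (la i1)) p0.
  rewrite horner0 /p horner_sum (bigD1 i1) //= [X in _ + X = _]big1 ?addr0 => [|i ii].
    rewrite hornerZ horner_prod => /eqP; rewrite mulf_eq0 (negPf ci1) /=.
    apply/negP/prodf_neq0 => l li; rewrite hornerXsubC; apply: la_inj.
    by rewrite eq_sym.
  rewrite hornerZ horner_prod (bigD1 i1) ?(eq_sym i1) //= hornerXsubC subrr.
  by rewrite mul0r mulr0.
have [rs /(congr1 (fun r : {poly K} => r)) rsE] := closed_field_poly_normal p.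
have lc0 : lead_coef p != 0 by rewrite lead_coef_eq0.
(* The degree of [p] may be smaller than [M], so [q] matches the product of its linear factors only
   up to powers of [x]; one more factor [x] on each side covers the points with [x v = 0]. *)
have qE v : x v ^+ (size rs).+1 * q v =
    x v ^+ M.+1 * (lead_coef p * \prod_(z <- rs) ell z v).
  have [x0|x0] := eqVneq (x v) 0; first by rewrite x0 !expr0n !mul0r.
  have pE : p.[v j / x v] * x v ^+ M = q v.
    rewrite /p horner_sum mulr_suml; apply: eq_bigr => i _.
    rewrite hornerZ horner_prod -mulrA; congr (_ * _).
    have -> : x v ^+ M = \prod_(l | l != i) x v.
      by rewrite prodr_const; congr (_ ^+ _); have := cardC1 i; rewrite card_ord.
    rewrite -big_split /=; apply: eq_bigr => l _.
    by rewrite hornerXsubC /ell mulrBl divfK.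
  rewrite -pE [p in LHS]rsE hornerZ horner_prod.
  have <- : \prod_(z <- rs) ('X - z%:P).[v j / x v] * x v ^+ size rs =
      \prod_(z <- rs) ell z v.
    elim: (rs) => [|z t IHt]; first by rewrite !big_nil mulr1.
    rewrite !big_cons -IHt hornerXsubC /= exprS /ell.
    have -> : v j - z * x v = (v j / x v - z) * x v by rewrite mulrBl divfK.
    by ring.
  by rewrite !exprS; ring.
(* Substituting the expression of [x ^ k.+1] term by term, the parts with cofactors sum to the
   product of all [ell (la l)] times the relation [hc], hence to zero; what remains are multiples of
   the [(gh i).1]. *)
have qJ : J (k.+1 + M)%N (fun v => x v ^+ k.+1 * q v).
  have -> : (fun v => x v ^+ k.+1 * q v) = (fun v => \sum_(i <- enum 'I_M.+1)
      ((gh i).1 v * (c i * \prod_(l <- enum [pred l | l != i]) ell (la l) v))).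
    apply/funext => v; rewrite big_enum /= mulr_sumr.
    apply/eqP; rewrite -subr_eq0 -sumrB; apply/eqP.
    transitivity (\prod_l ell (la l) v * \sum_i c i * (gh i).2 v); last first.
      by rewrite hc mulr0.
    rewrite mulr_sumr; apply: eq_bigr => i _; rewrite big_enum [in RHS](bigD1 i) //=.
    have [_ _ ->] := hgh i; rewrite -/(ell (la i) v); ring.
  apply: vsubspace_sum => // i; apply: JM; first by have [] := hgh i.
  have sM : size (enum [pred l : 'I_M.+1 | l != i]) = M.
    by rewrite -cardE; have := cardC1 i; rewrite card_ord.
  have := form_prod (enum [pred l : 'I_M.+1 | l != i])
    (fun l => form_linear j (la l)).
  by rewrite sM; apply: formZ.
have [m hm] : exists m, J (m + size rs)%N
    (fun v => x v ^+ m * \prod_(z <- rs) ell z v).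
  exists (k.+1 + M.+1)%N.
  have := vsubspaceZ (lead_coef p)^-1 (Js _)
    (JM _ _ _ _ qJ (formX (size rs).+1 (form_coord K i0))).
  rewrite muln1 -addnA !addnS addSn addnA; congr J; apply/funext => v.
  transitivity ((lead_coef p)^-1 * (x v ^+ k.+1 * (x v ^+ (size rs).+1 * q v))).
    by rewrite /x -[in LHS]mulrA [q v * _]mulrC.
  rewrite qE -addnS exprD mulrCA [_^-1 * _]mulrCA mulKf // mulrA.
  by [].
elim: rs m hm {rsE qE} => [|z t IHt] m.
  rewrite /= addn0 => hm; apply: (@Jbad m); move: hm; congr J.
  by apply/funext => v; rewrite big_nil mulr1.
move=> hm; have [|m'] := extend_ideal_cancel (hkk z) (form_prod t (form_linear j)).
  by exists m; move: hm; congr J; apply/funext => v; rewrite big_cons.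
exact: IHt.
Qed.

End Extend.

(** If no power of [v i0] lies in [J], one linear form [v j - a j * v i0] per coordinate can be
    adjoined while keeping all powers of [v i0] out. Modulo the enlarged ideal a form of degree [d]
    is its value at [a] times [v i0 ^ d], so a member of [J] nonzero at [a] would bring a power of
    [v i0] in. *)
Lemma projective_nullstellensatz J : graded_ideal J ->
  (forall v, (exists i, v i != 0) -> exists d f, J d f /\ f v != 0) ->
  exists d0, forall d, (d0 <= d)%N -> form d `<=` J d.
Proof.
move=> hJ Jz; apply: graded_ideal_full => // i0.
apply: contrapT => /forallNP Jbad.
have [J' [hJ' JJ' J'bad [a ha]]] : exists J', [/\ graded_ideal J',
    forall d, J d `<=` J' d, forall k, ~ J' k (fun v => v i0 ^+ k) &
    exists a : 'I_n -> K, forall j, J' 1%N (fun v => v j - a j * v i0)].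
  suff [J' [hJ' JJ' J'bad [a ha]]] : exists J', [/\ graded_ideal J',
      forall d, J d `<=` J' d, forall k, ~ J' k (fun v => v i0 ^+ k) &
      exists a : 'I_n -> K, forall j, j \in enum 'I_n ->
        J' 1%N (fun v => v j - a j * v i0)].
    by exists J'; split=> //; exists a => j; apply: ha; rewrite mem_enum.
  elim: (enum 'I_n) => [|j s [J' [hJ' JJ' J'bad [a ha]]]].
    exists J; split; [exact: hJ|by move=> d f|exact: Jbad|by exists (fun=> 0)].
  have [b hb] := extend_ideal_bad hJ' J'bad j.
  exists (extend_ideal J' i0 j b); split=> //.
  - exact: extend_ideal_graded.
  - by move=> d; apply: subset_trans (JJ' d) _; apply: extend_ideal_sub.
  - exists (fun l => if l == j then b else a l) => l; rewrite inE.
    case: eqP => [-> _|_ /= ls]; first exact: extend_ideal_linear.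
    by apply: extend_ideal_sub; apply: ha.
have [Jf Js JM] := hJ'.
(* Otherwise the adjoined form for [j = i0], which is [(1 - a i0) * v i0], would put [v i0] itself
   into the ideal. *)
have a0 : a i0 = 1.
  apply: contrapT => /eqP ai; apply: (J'bad 1%N).
  have ai1 : 1 - a i0 != 0 by rewrite subr_eq0 eq_sym.
  have := vsubspaceZ (1 - a i0)^-1 (Js 1%N) (ha i0); congr J'.
  by apply/funext => v; rewrite -{1}(mul1r (v i0)) -mulrBl mulKf // expr1.
have red d f : form d f -> J' d (fun v => f v - f a * v i0 ^+ d).
  elim: d f => [|d IHd] f.
    move=> /form0P[c ->]; have := vsubspace0 (Js 0%N); congr J'.
    by apply/funext => v; rewrite mulr1 subrr.
  move=> /formS[g hg ->].
  have : J' d.+1 (fun v => \sum_i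
      ((v i - a i * v i0) * g i v + a i * (v i0 * (g i v - g i a * v i0 ^+ d)))).
    apply: vsubspace_sum => // i; apply: vsubspaceD => //.
      exact: (JM 1%N d _ _ (ha i) (hg i)).
    apply: vsubspaceZ => //.
    have := JM d 1%N _ _ (IHd _ (hg i)) (form_coord K i0).
    by rewrite addn1; congr J'; apply/funext => v; rewrite mulrC.
  congr J'; apply/funext => v; rewrite mulr_suml -sumrB.
  by apply: eq_bigr => i _; rewrite exprS; ring.
have [|d [f [Jdf]]] := Jz a; first by exists i0; rewrite a0 oner_neq0.
apply/negP; rewrite negbK; apply/eqP; apply: contrapT => /eqP fa.
apply: (J'bad d).
have J'f := JJ' _ _ Jdf.
have := vsubspaceZ (f a)^-1 (Js d) (vsubspaceB (Js d) J'f (red _ _ (Jf _ _ J'f))).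
by congr J'; apply/funext => v; rewrite opprB addrC subrK mulKf.
Qed.

End Nullstellensatz.

(** * Dickson's lemma and the descending chain condition for closed sets *)

Lemma nat_monotone_subsequence (u : nat -> nat) : exists phi : nat -> nat,
  (forall i, (phi i < phi i.+1)%N) /\ (forall i, (u (phi i) <= u (phi i.+1))%N).
Proof.
have /choice[m hm] : forall N, exists M, (N <= M)%N /\
    forall l, (N <= l)%N -> (u M <= u l)%N.
  move=> N; have exP : exists k, `[< exists2 M, (N <= M)%N & u M = k >].
    by exists (u N); apply/asboolP; exists N.
  case: (ex_minnP exP) => k /asboolP[M NM <-] kmin.
  by exists M; split=> // l Nl; apply: kmin; apply/asboolP; exists l.
pose phi := fix phi i := if i is j.+1 then m (phi j).+1 else m 0%N.
have phiS i : (phi i < phi i.+1)%N by rewrite /=; have [] := hm (phi i).+1.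
exists phi; split=> // i.
case: i => [|i].
  by have [_] := hm 0%N; apply.
have [h1 h2] := hm (phi i).+1.
by apply: h2; have := phiS i; have := phiS i.+1; lia.
Qed.

(** Monotone subsequences, extracted for one coordinate after the other, end in a common subsequence
    along which all coordinates are nondecreasing; its first two indices serve. *)
Lemma dickson n (f : nat -> 'I_n -> nat) :
  exists i j, (i < j)%N /\ forall k, (f i k <= f j k)%N.
Proof.
suff [phi [phiS hphi]] : exists phi : nat -> nat,
    (forall i, (phi i < phi i.+1)%N) /\
    (forall i k, k \in enum 'I_n -> (f (phi i) k <= f (phi i.+1) k)%N).
  exists (phi 0%N), (phi 1%N); split=> // k.
  by apply: hphi; rewrite mem_enum.
elim: (enum 'I_n) => [|k s [phi [phiS hphi]]]; first by exists id.
have [psi [psiS hpsi]] := nat_monotone_subsequence (fun i => f (phi i) k).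
exists (phi \o psi); split=> [i|i l] /=.
  have : (psi i < psi i.+1)%N by [].
  elim: (psi i.+1) => // j IHj; rewrite ltnS leq_eqVlt => /orP[/eqP ->//|/IHj].
  by move=> h; apply: ltn_trans h _.
rewrite inE => /predU1P[->|ls]; first exact: hpsi.
have : (psi i <= psi i.+1)%N by apply: ltnW.
elim: (psi i.+1) => [|j IHj]; first by rewrite leqn0 => /eqP ->.
rewrite leq_eqVlt => /orP[/eqP ->//|]; rewrite ltnS => /IHj h.
exact: leq_trans h (hphi _ _ ls).
Qed.

Section LeadReduction.
Variables (K : fieldType) (n : nat).
Implicit Types (P Q : mpoly.mpoly n K).

Lemma mlead_reduction P Q : P != 0 -> Q != 0 ->
  (forall k, (mpoly.mlead P k <= mpoly.mlead Q k)%N) ->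
  exists R, Q - R * P = 0 \/ (mpoly.mlead (Q - R * P) < mpoly.mlead Q)%O.
Proof.
move=> P0 Q0 hPQ.
pose m := mpoly.mnm_sub (mpoly.mlead Q) (mpoly.mlead P).
have mE : mpoly.mnm_add m (mpoly.mlead P) = mpoly.mlead Q.
  by apply/mpoly.mnmP => k; rewrite mpoly.mnmDE mpoly.mnmBE subnK.
pose lc (S : mpoly.mpoly n K) := mpoly.mcoeff (mpoly.mlead S) S.
have lcP : lc P != 0 by rewrite /lc mpoly.mleadc_eq0.
exists ((lc Q / lc P) *: mpoly.mpolyX K m).
set S := _ * P.
have lS : (mpoly.mlead S <= mpoly.mlead Q)%O.
  apply: (le_trans (mpoly.mleadM_le _ _)).
  rewrite -mE; apply: mpoly.lem_add => //.
  by apply: (le_trans (mpoly.mleadZ_le _ _)); rewrite mpoly.mleadXm.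
have cS : mpoly.mcoeff (mpoly.mlead Q) S = lc Q.
  rewrite /S -scalerAl mpoly.mcoeffZ -mE.
  have := mpoly.mleadcM (mpoly.mpolyX K m) P.
  rewrite mpoly.mleadXm => ->; rewrite mpoly.mcoeffX eqxx mul1r.
  by rewrite -/(lc P) divfK.
have [->|D0] := eqVneq (Q - S) 0; [by left|right].
rewrite lt_neqAle; apply/andP; split.
  apply/eqP => E; move: (D0); rewrite -mpoly.mleadc_eq0 E mpoly.mcoeffB cS.
  by rewrite subrr eqxx.
apply: le_trans (mpoly.mleadB_le _ _) _.
by rewrite leUx lexx.
Qed.

(** The ideals [I i] of polynomials vanishing on the sets [A i] increase; pick
    in each [I i.+1 `\` I i] a polynomial with minimal leading monomial and
    compare two of them with Dickson's lemma. *)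
Lemma zero_locus_dcc (T : Type) (co : T -> 'I_n -> K) (A : nat -> set T) :
  (forall i, A i.+1 `<=` A i) ->
  ~ (forall i, exists P, (forall q, A i.+1 q -> mpoly.meval (co q) P = 0) /\
        exists2 q, A i q & mpoly.meval (co q) P != 0).
Proof.
move=> hA hP.
pose I i P := forall q, A i q -> mpoly.meval (co q) P = 0.
have II i j P : (i <= j)%N -> I i P -> I j P.
  move=> ij IP; suff AA : A j `<=` A i by move=> q /AA/IP.
  elim: j ij => [|j IHj]; first by rewrite leqn0 => /eqP ->.
  rewrite leq_eqVlt => /orP[/eqP -> //|]; rewrite ltnS => /IHj.
  exact: subset_trans.
have /choice[P hPP] : forall i, exists P, [/\ I i.+1 P, ~ I i P &
    forall Q, I i.+1 Q -> ~ I i Q -> ~~ (mpoly.mlead Q < mpoly.mlead P)%O].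
  move=> i; apply: contrapT => hno.
  suff : forall m P, mpoly.mlead P = m -> I i.+1 P -> I i P.
    have [P [P1 [q Aq Pq]]] := hP i => /(_ _ P erefl P1 q Aq) /eqP.
    by rewrite (negPf Pq).
  apply: mpoly.ltmwf => m IH P Pm P1; apply: contrapT => P2; apply: hno.
  exists P; split=> // Q Q1 Q2; apply/negP => lt; apply: Q2.
  by apply: IH Q1; [rewrite -Pm; exact: lt|].
have [i [j [ij hij]]] := dickson (fun i k => mpoly.mlead (P i) k).
have [Pi1 Pi2 _] := hPP i; have [Pj1 Pj2 Pjmin] := hPP j.
have nz k : P k != 0.
  have [_ + _] := hPP k; apply: contra_notN => /eqP ->.
  by move=> q _; rewrite mpoly.meval0.
have [R hR] := mlead_reduction (nz i) (nz j) hij.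
have R2 : ~ I j (P j - R * P i).
  move=> h; apply: Pj2 => q Aq.
  have := h q Aq; rewrite mpoly.mevalB mpoly.mevalM.
  by rewrite (II _ _ _ ij Pi1) // mulr0 subr0.
case: hR => [hR|]; first by apply: R2; rewrite hR => q _; rewrite mpoly.meval0.
apply/negP; apply: Pjmin => // q Aq.
rewrite mpoly.mevalB mpoly.mevalM Pj1 //.
by rewrite (II i.+1 j.+1 _ _ Pi1) ?mulr0 ?subr0 // ltnW.
Qed.

End LeadReduction.

Section Irreducible.
Variable T : topologicalType.

Lemma irreducible_meet (U V : set T) : irreducible_set [set: T] ->
  open U -> open V -> U !=set0 -> V !=set0 -> exists x, U x /\ V x.
Proof.
move=> [_ irr] oU oV [u Uu] [v Vv]; apply: contrapT => h.
have [] := irr (~` U) (~` V) (open_closedC oU) (open_closedC oV).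
- move=> x _; apply: contrapT => hx; apply: h; exists x.
  by split; apply: contrapT => hh; apply: hx; [left|right].
- by move=> /(_ u I).
- by move=> /(_ v I).
Qed.

End Irreducible.

(** * Projective embeddings *)

Section Embedding.
Variable K : fieldType.

(** A projective embedding as data. The defining equations are replaced by all forms vanishing on
    the image, so that a closed subset inherits the coordinates with no equations to choose. *)
Record proj_emb (X : fspace K) := ProjEmb {
  pe_dim : nat;
  pe_co : X -> 'I_pe_dim.+1 -> K;
  pe_neq0 : forall p, exists i, pe_co p i != 0;
  pe_inj : forall p q c, (forall i, pe_co p i = c * pe_co q i) -> p = q;
  pe_cone : forall v, (exists i, v i != 0) ->
    (forall d f, form d f -> (forall p, f (pe_co p) = 0) -> f v = 0) ->
    exists p c, forall i, v i = c * pe_co p i;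
  pe_nbhs : forall p A, nbhs p A <-> exists d f,
    [/\ form d f, f (pe_co p) != 0 & [set q | f (pe_co q) != 0] `<=` A];
  pe_regular : forall p h, regular_at p h <-> exists d f g,
    [/\ form d f, form d g, g (pe_co p) != 0 &
        \forall q \near p, h q = f (pe_co q) / g (pe_co q)] }.

Arguments pe_dim {X} _.
Arguments pe_co {X} _ _ _.
Arguments pe_neq0 {X} _ _.
Arguments pe_inj {X} _ _ _ _ _.
Arguments pe_cone {X} _ _ _ _.
Arguments pe_nbhs {X} _ _ _.
Arguments pe_regular {X} _ _ _.

Lemma projective_emb X : projective X -> exists e : proj_emb X, True.
Proof.
move=> [N [co [S [hom [nz inj cone] hn hr]]]].
suff : [/\ (forall v, (exists i, v i != 0) ->
    (forall d f, form d f -> (forall p, f (co p) = 0) -> f v = 0) ->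
    exists p c, forall i, v i = c * co p i),
  (forall p A, nbhs p A <-> exists d f,
    [/\ form d f, f (co p) != 0 & [set q | f (co q) != 0] `<=` A]) &
  (forall p h, regular_at p h <-> exists d f g,
    [/\ form d f, form d g, g (co p) != 0 &
        \forall q \near p, h q = f (co q) / g (co q)])].
  by move=> [h1 h2 h3]; exists (ProjEmb nz inj h1 h2 h3).
split.
- move=> v v0 hv; apply/(cone v v0) => P SP; have [d Pd] := hom P SP.
  apply: (hv d (fun v => mpoly.meval v P)); first by exists P.
  move=> p; have := (cone (co p) (nz p)).2; apply=> //.
  by exists p, 1 => i; rewrite mul1r.
- move=> p A; rewrite hn; split.
    by move=> [d [P [hP Pp PA]]]; exists d, (fun v => mpoly.meval v P); split=> //; exists P.
  by move=> [d [f [[P hP ->] Pp PA]]]; exists d, P.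
- move=> p h; rewrite hr; split.
    move=> [d [P [Q [hP hQ Qp e]]]].
    exists d, (fun v => mpoly.meval v P), (fun v => mpoly.meval v Q).
    by split=> //; [exists P|exists Q].
  by move=> [d [f [g [[P hP ->] [Q hQ ->] Qp e]]]]; exists d, P, Q.
Qed.

End Embedding.

Arguments pe_dim {K X} _.
Arguments pe_co {K X} _ _ _.
Arguments pe_neq0 {K X} _ _.
Arguments pe_inj {K X} _ _ _ _ _.
Arguments pe_cone {K X} _ _ _ _.
Arguments pe_nbhs {K X} _ _ _.
Arguments pe_regular {K X} _ _ _.

(** * Closed subspaces of embedded spaces *)

Section SubEmbedding.
Variables (K : fieldType) (X : fspace K) (C : set X).

Lemma fs_sub_init_fun (z : fs_sub C) (f : fs_sub C -> K) :
  @init_fun K unit (fun=> X) _ (fun=> @sval X C) z f ->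
  exists2 a, regular_at (sval z) a & f = fun w => a (sval w).
Proof.
elim=> {f} [c|[] a ra|f g _ [a ra ->] _ [b rb ->]|f g _ [a ra ->] _ [b rb ->]|f _ [a ra ->] az].
- by exists (fun=> c) => //; apply: regular_cst.
- by exists a.
- by exists (fun q => a q + b q) => //; apply: regularD.
- by exists (fun q => a q * b q) => //; apply: regularM.
- by exists (fun q => (a q)^-1) => //; apply: regularV.
Qed.

Lemma fs_sub_nbhs (z : fs_sub C) (B : set (fs_sub C)) :
  nbhs z B <-> exists2 B', nbhs (sval z) B' & forall w : fs_sub C, B' (sval w) -> B w.
Proof.
split.
  move=> [Bi [f [hB /fs_sub_init_fun[a ra fE] fz sub]]].
  exists (Bi tt `&` [set q | a q != 0]).
    apply: filterI; first exact: hB.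
    by apply: regular_neq0 => //; move: fz; rewrite fE.
  by move=> w [B1 a1]; apply: sub; split; [case|rewrite fE].
move=> [B' hB' sub]; exists (fun=> B'), (fun=> 1); split=> //.
- exact: init_cst.
- exact: oner_neq0.
- by move=> w [/(_ tt)]; move/sub.
Qed.

Lemma fs_sub_regular (z : fs_sub C) (h : fs_sub C -> K) :
  regular_at z h <-> exists2 a, regular_at (sval z) a &
    \forall w \near z, h w = a (sval w).
Proof.
split.
  by move=> [g /fs_sub_init_fun[a ra ->] e]; exists a.
move=> [a ra e]; exists (fun w => a (sval w)) => //.
exact: (@init_pr K unit (fun=> X) _ (fun=> @sval X C) z tt a).
Qed.

Lemma fs_sub_near (z : fs_sub C) (P : set X) :
  (\forall q \near sval z, P q) -> \forall w \near z, P (sval w).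
Proof. by move=> h; apply/fs_sub_nbhs; exists P. Qed.

Lemma fs_sub_closed (D : set (fs_sub C)) : closed C -> closed D ->
  closed [set x | exists2 w : fs_sub C, D w & sval w = x].
Proof.
move=> cC cD; rewrite closedE => x hx.
have Cx : C x.
  apply: cC => B hB.
  have : ~ \forall q \near x, ~ ([set x | exists2 w : fs_sub C, D w & sval w = x] `&` B) q.
    move=> h; apply: hx.
    by apply: filterS2 h hB => q h1 h2 h3; apply: h1.
  move=> h; apply: contrapT => h'; apply: h; apply: filterE => q [[w _ <-] Bw].
  by apply: h'; exists (sval w); split=> //; exact: (proj2_sig w).
exists (exist _ x Cx) => //; apply: contrapT => nD; apply: hx.
have /fs_sub_nbhs[B hB sub] : nbhs (exist _ x Cx : fs_sub C) (~` D).
  by apply: open_nbhs_nbhs; split=> //; exact: closed_openC.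
apply: filterS hB => q Bq [w Dw wq]; apply: (sub w) => //.
by rewrite wq.
Qed.

Variable e : proj_emb X.
Let co := pe_co e.

Lemma closed_form_sep (A : set X) x : closed A -> ~ A x ->
  exists d f, [/\ form d f, f (co x) != 0 & forall q, A q -> f (co q) = 0].
Proof.
move=> cA Ax.
have : nbhs x (~` A) by apply: open_nbhs_nbhs; split=> //; exact: closed_openC.
move=> /(pe_nbhs e)[d [f [hf fx sub]]]; exists d, f; split=> // q Aq.
by apply: contrapT => /eqP fq; apply: (sub q).
Qed.

Lemma sub_emb : closed C -> exists e' : proj_emb (fs_sub C), True.
Proof.
move=> cC.
pose co' (w : fs_sub C) := co (sval w).
have nz w : exists i, co' w i != 0 by exact: pe_neq0.
have inj p q c : (forall i, co' p i = c * co' q i) -> p = q.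
  move=> /(pe_inj e) h; case: p q h => [p hp] [q hq] /= h.
  by apply: eq_exist.
suff [h1 h2 h3] : [/\ (forall v, (exists i, v i != 0) ->
    (forall d f, form d f -> (forall p, f (co' p) = 0) -> f v = 0) ->
    exists p c, forall i, v i = c * co' p i),
  (forall p A, nbhs p A <-> exists d f,
    [/\ form d f, f (co' p) != 0 & [set q | f (co' q) != 0] `<=` A]) &
  (forall p h, regular_at p h <-> exists d f g,
    [/\ form d f, form d g, g (co' p) != 0 &
        \forall q \near p, h q = f (co' q) / g (co' q)])].
  by exists (ProjEmb nz inj h1 h2 h3).
split.
- move=> v v0 hv.
  have [p [c vE]] : exists p c, forall i, v i = c * co p i.
    apply: (pe_cone e) => // d f hf fX.
    by apply: (hv d) => // w; exact: fX.
  have vE' : v = fun i => c * co p i by apply/funext.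
  suff Cp : C p by exists (exist _ p Cp), c.
  apply: contrapT => /(closed_form_sep cC)[d [f [hf fp fC]]].
  have fv : f v = 0 by apply: (hv d) => // w; apply: fC; exact: (proj2_sig w).
  move: fv; rewrite vE' (form_hom c _ hf) => /eqP; rewrite mulf_eq0 (negPf fp) orbF.
  rewrite expf_eq0 => /andP[_ /eqP c0].
  by case: v0 => i; rewrite vE c0 mul0r eqxx.
- move=> p A; split.
    move=> /fs_sub_nbhs[B /(pe_nbhs e)[d [f [hf fp fB]]] sub].
    by exists d, f; split=> // q fq; apply: sub; apply: fB.
  move=> [d [f [hf fp fA]]]; apply/fs_sub_nbhs.
  exists [set q | f (co q) != 0]; last by move=> w; apply: fA.
  by apply/(pe_nbhs e); exists d, f; split=> // q.
- move=> p h; split.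
    move=> /fs_sub_regular[a /(pe_regular e)[d [f [g [hf hg gp ae]]]] he].
    exists d, f, g; split=> //.
    have ae' := fs_sub_near ae.
    by apply: filterS2 he ae' => w -> ->.
  move=> [d [f [g [hf hg gp he]]]]; apply/fs_sub_regular.
  exists (fun q => f (co q) / g (co q)); last exact: he.
  by apply/(pe_regular e); exists d, f, g; split=> //; apply: filterE.
Qed.

End SubEmbedding.

Lemma near_open (T : topologicalType) (p : T) (P : set T) :
  (\forall q \near p, P q) -> exists U, [/\ open U, U p & U `<=` P].
Proof.
by move=> h; have : nbhs p P := h; rewrite nbhsE => -[U [oU Up] UP]; exists U.
Qed.

(** * The homogeneous coordinate ring *)

Section Sform.
Variables (K : fieldType) (X : fspace K) (e : proj_emb X).
Implicit Types (p q : X) (h g : X -> K).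
Let co := pe_co e.

(** The part of degree [d] of the homogeneous coordinate ring. Values depend on the chosen
    representatives [co p], but zeros and quotients of equal degree do not. *)
Definition sform (d : nat) : set (X -> K) :=
  [set h | exists2 f, form d f & h = fun p => f (co p)].

Lemma sform_vsubspace d : vsubspace (sform d).
Proof.
split; first by exists (fun=> 0) => //; apply: form_zero.
move=> c _ _ [f hf ->] [g hg ->]; exists (fun v => c * f v + g v) => //.
by apply: (form_vsubspace K _ d).2.
Qed.

Lemma sform_zero d : sform d (fun=> 0).
Proof. exact: vsubspace0 (sform_vsubspace d). Qed.

Lemma sformM d1 d2 h g : sform d1 h -> sform d2 g ->
  sform (d1 + d2) (fun p => h p * g p).
Proof.
move=> [f hf ->] [f' hf' ->]; exists (fun v => f v * f' v) => //.
exact: formM.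
Qed.

Lemma sform_cst c : sform 0 (fun=> c).
Proof. by exists (fun=> c) => //; apply: form_cst. Qed.

Lemma sform_coord i : sform 1 (fun p => co p i).
Proof. by exists (fun v => v i) => //; apply: form_coord. Qed.

Lemma sformX d h k : sform d h -> sform (k * d) (fun p => h p ^+ k).
Proof. by move=> [f hf ->]; exists (fun v => f v ^+ k) => //; apply: formX. Qed.

Lemma sformX1 h k : sform 1 h -> sform k (fun p => h p ^+ k).
Proof. by move=> /(@sformX 1 h k); rewrite muln1. Qed.

Lemma sform_prod (I : Type) (r : seq I) (F : I -> X -> K) :
  (forall i, sform 1 (F i)) -> sform (size r) (fun p => \prod_(i <- r) F i p).
Proof.
move=> hF; elim: r => [|i r IHr].
  by have := sform_cst 1; congr sform; apply/funext => v; rewrite big_nil.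
rewrite -[size _]/(size r).+1 -add1n; have := sformM (hF i) IHr; congr sform.
by apply/funext => v; rewrite big_cons.
Qed.

Lemma sform_nonzero d p : exists2 h, sform d h & h p != 0.
Proof.
have [i pi] := pe_neq0 e p; exists (fun q => co q i ^+ d).
  exact: sformX1 (sform_coord i).
by rewrite expf_neq0.
Qed.

Lemma sform_finite d : exists (k : nat) (b : 'I_k -> X -> K),
  (forall i, sform d (b i)) /\ spans [set f | f = fun=> 0] (sform d) b.
Proof.
have [k [b [bd bs]]] := form_finite K (pe_dim e).+1 d.
exists k, (fun i p => b i (co p)); split; first by move=> i; exists (b i).
move=> _ [f hf ->]; have [c hc] := bs f hf; exists c; apply/funext => p.
exact: (congr1 (@^~ (co p)) hc).
Qed.

(** Fix [i] with [co p i] nonzero. If all minors [co p i * co q j - co p j * co q i] vanish, the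
    points are proportional; a nonvanishing minor, as a linear form in the second point, separates
    them. *)
Lemma sform_sep p q : p <> q -> exists h, [/\ sform 1 h, h p = 0 & h q != 0].
Proof.
move=> pq; apply: contrapT => hno.
have [i qi] := pe_neq0 e p.
suff pqE j : co p i * co q j = co p j * co q i.
  apply: pq; apply/esym/(pe_inj e _ _ (co q i / co p i)) => j.
  by apply: (mulIf qi); rewrite mulrAC divfK // mulrC pqE mulrC.
apply: contrapT => /eqP hne; apply: hno.
exists (fun x => co p i * co x j - co p j * co x i); split.
- exact: vsubspaceB (sform_vsubspace 1)
    (vsubspaceZ _ (sform_vsubspace 1) (sform_coord j))
    (vsubspaceZ _ (sform_vsubspace 1) (sform_coord i)).
- by rewrite mulrC subrr.
- by rewrite subr_eq0.
Qed.

Lemma sform_nbhs p A : nbhs p A <-> exists d h,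
  [/\ sform d h, h p != 0 & [set q | h q != 0] `<=` A].
Proof.
rewrite (pe_nbhs e); split.
  move=> [d [f [hf fp sub]]]; exists d, (fun q => f (co q)); split=> //.
  by exists f.
by move=> [d [_ [[f hf ->] fp sub]]]; exists d, f.
Qed.

Lemma sform_regular p h : regular_at p h <-> exists d P Q,
  [/\ sform d P, sform d Q, Q p != 0 & \forall q \near p, h q = P q / Q q].
Proof.
rewrite (pe_regular e); split.
  move=> [d [f [g [hf hg gp he]]]].
  by exists d, (fun q => f (co q)), (fun q => g (co q)); split=> //; [exists f|exists g].
by move=> [d [_ [_ [[f hf ->] [g hg ->] gp he]]]]; exists d, f, g.
Qed.

Lemma regular_frac d P Q p : sform d P -> sform d Q -> Q p != 0 ->
  regular_at p (fun q => P q / Q q).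
Proof.
by move=> hP hQ Qp; apply/sform_regular; exists d, P, Q; split=> //; apply: filterE.
Qed.

Lemma sform_open d h : sform d h -> open [set q | h q != 0].
Proof.
move=> hh; rewrite openE => p hp; apply/sform_nbhs.
by exists d, h; split=> // q.
Qed.

Lemma sform_near d h p : sform d h -> h p != 0 -> \forall q \near p, h q != 0.
Proof. by move=> hh hp; apply/sform_nbhs; exists d, h; split=> // q. Qed.

Lemma sform_closed d h : sform d h -> closed [set q | h q = 0].
Proof.
move=> /sform_open/open_closedC; congr closed; apply/seteqP.
split=> q /=; last by move=> ->; rewrite eqxx.
by move=> /negP; rewrite negbK => /eqP.
Qed.

Lemma emb_closed1 p : closed [set p].
Proof.
rewrite closedE => q hq; apply: contrapT => /= qp; apply: hq.
have [h [hh hp hq]] := sform_sep (fun E => qp (esym E)).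
by apply: filterS (sform_near hh hq) => x /= + xp; rewrite xp hp eqxx.
Qed.

(** If [h] vanishes at the new point [p], it is replaced by [c * g + h] with [g p] nonzero, the
    nonzero [c] avoiding the finitely many ratios that create a zero at an older point. *)
Lemma sform_avoid (s : seq X) : infinite_set [set: K] ->
  exists2 h, sform 1 h & forall p, p \in s -> h p != 0.
Proof.
move=> Kinf; elim: s => [|p s [h hh hs]].
  by exists (fun=> 0) => //; apply: sform_zero.
have [hp|hp] := eqVneq (h p) 0; last first.
  by exists h => // q; rewrite inE => /predU1P[->//|/hs].
have [g hg gp] := sform_nonzero 1 p.
have [c c0 hc] : exists2 c, c != 0 & c \notin [seq - h q / g q | q <- s].
  apply: contrapT => hno; apply: Kinf.
  apply: (sub_finite_set _ (finite_seq (0 :: [seq - h q / g q | q <- s]))) => c _ /=.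
  apply: contrapT => /negP; rewrite inE negb_or => /andP[c0 cs].
  by apply: hno; exists c.
exists (fun q => c * g q + h q); first exact: (sform_vsubspace 1).2.
move=> q; rewrite inE => /predU1P[->|qs]; first by rewrite hp addr0 mulf_neq0.
have [gq|gq] := eqVneq (g q) 0; first by rewrite gq mulr0 add0r; apply: hs.
apply: contra hc => /eqP E; apply/mapP; exists q => //.
apply: (mulIf gq); rewrite divfK //; apply/eqP.
by rewrite -subr_eq0 opprK E.
Qed.

(** Noetherian induction: a counterexample would start an infinite strictly decreasing chain of
    closed sets, and the forms separating consecutive members contradict [zero_locus_dcc]. *)
Lemma closed_induction (P : set X -> Prop) :
  (forall A, closed A ->
     (forall B, closed B -> B `<=` A -> B <> A -> P B) -> P A) ->
  forall A, closed A -> P A.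
Proof.
move=> IH A0 cA0; apply: contrapT => nP.
pose bad := {A : set X | closed A /\ ~ P A}.
have /choice[nxt hnxt] : forall A : bad, exists B : bad,
    sval B `<=` sval A /\ sval B <> sval A.
  move=> [A [cA nA]]; apply: contrapT => hno; apply: (nA).
  apply: IH => // B cB BA neq; apply: contrapT => nB; apply: hno.
  by exists (exist _ B (conj cB nB)).
pose a i := iter i nxt (exist _ A0 (conj cA0 nP) : bad).
apply: (@zero_locus_dcc K _ X co (fun i => sval (a i))).
  by move=> i; have [] := hnxt (a i).
move=> i; have [sub neq] := hnxt (a i); rewrite -/(a i.+1) in sub neq.
have [q Aq nq] : exists2 q, sval (a i) q & ~ sval (a i.+1) q.
  apply: contrapT => h; apply: neq; apply/seteqP; split=> // q Aq.
  by apply: contrapT => nq; apply: h; exists q.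
have [cl _] := proj2_sig (a i.+1).
have [d [_ [[Pl hPl ->] fq fA]]] := closed_form_sep e cl nq.
by exists Pl; split=> //; exists q.
Qed.

Definition sgraded_ideal (J : nat -> set (X -> K)) :=
  [/\ forall d, J d `<=` sform d, forall d, vsubspace (J d) &
      forall d1 d2 f g, J d1 f -> sform d2 g -> J (d1 + d2)%N (fun q => f q * g q)].

End Sform.

Section SformNullstellensatz.
Variables (K : closedFieldType) (X : fspace K) (e : proj_emb X).
Hypothesis Kunc : ~ countable [set: K].

(** The ideal is pulled back to forms on the whole affine space. A vector outside the cone over [X]
    is no common zero, because some form vanishing on [X] is nonzero there and its restriction,
    being zero, lies in [J]. *)
Lemma sform_nullstellensatz (J : nat -> set (X -> K)) : sgraded_ideal e J ->
  (forall p, exists d h, J d h /\ h p != 0) ->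
  exists d0, forall d, (d0 <= d)%N -> sform e d `<=` J d.
Proof.
move=> [Jf Js JM] Jz.
pose J' d := [set f | form d f /\ J d (fun p => f (pe_co e p))].
have [||d0 hd0] := projective_nullstellensatz Kunc (J := J').
- split; first by move=> d f [].
    move=> d; split; first by split; [exact: form_zero|exact: vsubspace0].
    move=> c f g [hf Jf'] [hg Jg]; split; first exact: (form_vsubspace _ _ d).2.
    exact: (Js d).2.
  move=> d1 d2 f g [hf Jf'] hg; split; first exact: formM.
  by apply: JM => //; exists g.
- move=> v v0; apply: contrapT => hno.
  have [p [c vE]] : exists p c, forall i, v i = c * pe_co e p i.
    apply: pe_cone => // d f hf fX; apply: contrapT => /eqP fv; apply: hno.
    exists d, f; split=> //; split=> //.
    by have := vsubspace0 (Js d); congr J; apply/funext.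
  have [d [h [Jh hp]]] := Jz p.
  have [f hf fE] := Jf _ _ Jh; apply: hno; exists d, f; split.
    by split=> //; rewrite -fE.
  have -> : v = fun i => c * pe_co e p i by apply/funext.
  rewrite (form_hom _ _ hf) mulf_neq0 //; last by rewrite fE in hp.
  rewrite expf_neq0 //; apply: contraTneq isT => c0.
  by case: v0 => i; rewrite vE c0 mul0r eqxx.
exists d0 => d hd _ [f hf ->].
by have [] := hd0 d hd f hf.
Qed.

End SformNullstellensatz.

(** * Identity principles on an irreducible space *)

Section IrreducibleEmbedding.
Variables (K : fieldType) (X : fspace K) (e : proj_emb X).
Hypothesis irr : irreducible_set [set: X].
Implicit Types (p q : X) (f g h : X -> K).

Lemma sform_identity d h (U : set X) : sform e d h -> open U -> U !=set0 ->
  (forall q, U q -> h q = 0) -> forall q, h q = 0.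
Proof.
move=> hh oU U0 hU q; apply: contrapT => /eqP hq.
have [|x [Ux]] := irreducible_meet irr oU (sform_open hh) U0.
  by exists q.
by rewrite /= hU // eqxx.
Qed.

Lemma sform_near_identity d h p : sform e d h ->
  (\forall q \near p, h q = 0) -> forall q, h q = 0.
Proof.
move=> hh /near_open[U [oU Up sub]]; apply: (sform_identity hh oU).
  by exists p.
by move=> q /sub.
Qed.

Lemma sform_integral d1 d2 h g : sform e d1 h -> sform e d2 g ->
  (exists q, h q != 0) -> (forall q, h q * g q = 0) -> forall q, g q = 0.
Proof.
move=> hh hg [q hq] hhg; apply: (sform_identity hg (sform_open hh)).
  by exists q.
by move=> x /= hx; move/eqP: (hhg x); rewrite mulf_eq0 (negPf hx) => /eqP.
Qed.

(** [U] need not contain [p]: irreducibility makes it meet every neighbourhood of [p], so the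
    numerator of [f] vanishes on a nonempty open set and therefore everywhere. *)
Lemma regular_identity p f (U : set X) : regular_at p f -> open U ->
  U !=set0 -> (\forall q \near p, U q -> f q = 0) -> \forall q \near p, f q = 0.
Proof.
move=> /(sform_regular e)[d [P [Q [hP hQ Qp fE]]]] oU U0 fU.
have Q0 := sform_near hQ Qp.
have : \forall q \near p, U q -> P q = 0.
  apply: filterS3 fU fE Q0 => q hU fq Qq /hU; rewrite fq => /eqP.
  by rewrite mulf_eq0 invr_eq0 (negPf Qq) orbF => /eqP.
move=> /near_open[V [oV Vp VU]].
have P0 : forall q, P q = 0.
  have [|x [Vx Ux]] := irreducible_meet irr oV oU _ U0; first by exists p.
  apply: (sform_identity (U := V `&` U) hP); [exact: openI|by exists x|].
  by move=> q [Vq Uq]; apply: VU.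
by apply: filterS fE => q ->; rewrite P0 mul0r.
Qed.

Lemma regular_integral p f g : regular_at p f -> regular_at p g ->
  ~ (\forall q \near p, f q = 0) -> (\forall q \near p, f q * g q = 0) ->
  \forall q \near p, g q = 0.
Proof.
move=> rf rg f0 fg.
have /(sform_regular e)[d [P [Q [hP hQ Qp fE]]]] := rf.
apply: (regular_identity rg (sform_open hP)).
  apply: contrapT => P0; apply: f0; apply: filterS fE => q ->.
  rewrite [P q](_ : _ = 0) ?mul0r //; apply: contrapT => /eqP Pq.
  by apply: P0; exists q.
have Q0 := sform_near hQ Qp.
apply: filterS3 fE Q0 fg => q -> Qq /eqP; rewrite !mulf_eq0 invr_eq0 (negPf Qq) orbF.
by move=> /orP[/eqP E|/eqP //] /=; rewrite E eqxx.
Qed.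

End IrreducibleEmbedding.

Section Topology.
Variables (S T : topologicalType).

Lemma irreducible_image (f : S -> T) (A : set S) : continuous f ->
  irreducible_set A -> irreducible_set (f @` A).
Proof.
move=> cf [[a Aa] irr]; split; first by exists (f a); exists a.
move=> F G cF cG sub.
have cl H : closed H -> closed (f @^-1` H).
  by move=> cH; apply: closed_comp => // x _; apply: cf.
have [x Ax|h|h] := irr _ _ (cl F cF) (cl G cG).
- by apply: sub; exists x.
- by left => _ [x Ax <-]; apply: h.
- by right => _ [x Ax <-]; apply: h.
Qed.

Lemma irreducible_closure (A : set S) : irreducible_set A ->
  irreducible_set (closure A).
Proof.
move=> [[a Aa] irr]; split; first by exists a; apply: subset_closure.
move=> F G cF cG sub.
have [x Ax|h|h] := irr F G cF cG.
- by apply: sub; apply: subset_closure.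
- by left; rewrite closureE; apply: smallest_sub.
- by right; rewrite closureE; apply: smallest_sub.
Qed.

Lemma irreducible_finite (A : set S) : (forall x : S, closed [set x]) ->
  irreducible_set A -> finite_set A -> exists x, A = [set x].
Proof.
move=> cl1 [[a Aa] irr] /finite_seqP[s sE].
suff : forall t : seq S, (forall x, A x -> x \in t) -> exists x, A `<=` [set x].
  move=> /(_ s)[|x Ax]; first by move=> x; rewrite sE.
  exists x; apply/seteqP; split=> // y ->.
  by have /Ax <- := Aa.
elim=> [/(_ a Aa)//|x t IHt At].
have clt : closed [set` t].
  elim: (t) => [|y u IHu]; first by rewrite set_nil; apply: closed0.
  have -> : [set` y :: u] = [set y] `|` [set` u].
    apply/seteqP; split=> z /=; rewrite inE.
      by move=> /predU1P[->|]; [left|right].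
    by move=> [->|->]; rewrite ?eqxx ?orbT.
  exact: closedU.
have [y Ay|h|h] := irr [set x] [set` t] (cl1 x) clt.
- by have := At y Ay; rewrite inE => /predU1P[->|]; [left|right].
- by exists x.
- exact: IHt.
Qed.

End Topology.

Section SubIrreducible.
Variables (K : fieldType) (X : fspace K) (C : set X).

Lemma fs_sub_incl_continuous : continuous (sval : fs_sub C -> X).
Proof. exact: mor_continuous (sub_incl C). Qed.

Lemma fs_sub_inj (w w' : fs_sub C) : sval w = sval w' -> w = w'.
Proof. by case: w w' => [x Cx] [y Cy] /= xy; apply: eq_exist. Qed.

Lemma fs_sub_irreducible : closed C -> irreducible_set C ->
  irreducible_set [set: fs_sub C].
Proof.
move=> cC [[x Cx] irr]; split; first by exists (exist _ x Cx).
move=> F G cF cG sub.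
have [y Cy|h|h] := irr _ _ (fs_sub_closed cC cF) (fs_sub_closed cC cG).
- by have [Fy|Gy] := sub (exist _ y Cy) I; [left|right]; exists (exist _ y Cy).
- by left => w _; have [w' Fw' /fs_sub_inj <-] := h _ (proj2_sig w).
- by right => w _; have [w' Gw' /fs_sub_inj <-] := h _ (proj2_sig w).
Qed.

Lemma fs_sub_image (D : set (fs_sub C)) :
  [set x | exists2 w : fs_sub C, D w & sval w = x] = (sval : fs_sub C -> X) @` D.
Proof. by apply/seteqP; split=> x [w Dw <-]; exists w. Qed.

End SubIrreducible.

(** * Global regular functions are constant *)

Section GlobalFunctions.
Variables (K : closedFieldType) (X : fspace K) (e : proj_emb X).
Hypothesis Kunc : ~ countable [set: K].
Hypothesis irr : irreducible_set [set: X].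
Implicit Types (p q : X) (f g h : X -> K).

Lemma regular_global_frac r p d P Q : (forall q, regular_at q r) ->
  sform e d P -> sform e d Q -> Q p != 0 ->
  (\forall q \near p, r q = P q / Q q) -> forall q, r q * Q q = P q.
Proof.
move=> rr hP hQ Qp rE q.
have [D hD Dq] := sform_nonzero e d q.
have /near_open[U [oU Up UE]] : \forall x \near p, r x * Q x = P x.
  by apply: filterS2 rE (sform_near hQ Qp) => x -> Qx; rewrite divfK.
have reg : regular_at q (fun x => r x * (Q x / D x) + (-1) * (P x / D x)).
  apply: regularD; apply: regularM; [exact: rr| |exact: regular_cst|].
    exact: regular_frac hQ hD Dq.
  exact: regular_frac hP hD Dq.
have /nbhs_singleton E : \forall x \near q,
    r x * (Q x / D x) + (-1) * (P x / D x) = 0.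
  apply: (regular_identity e irr reg oU); first by exists p.
  by apply: filterE => x /UE <-; ring.
 apply/eqP; rewrite -subr_eq0; apply/eqP.
transitivity ((r q * (Q q / D q) + -1 * (P q / D q)) * D q).
  by field.
by rewrite E mul0r.
Qed.

(** For [n] large, multiplication by a global function [r] maps the space of
    forms of degree [n] into itself, injectively unless [r = 0], hence
    surjectively; so [r] cannot vanish at a single point. *)
Lemma global_regular_eq0 r p : (forall q, regular_at q r) -> r p = 0 ->
  forall q, r q = 0.
Proof.
move=> rr rp q; apply: contrapT => /eqP rq.
(* The forms that [r] multiplies into forms. Local denominators of [r] belong to this ideal, so it
   has no common zero. *)
pose J d := [set A | sform e d A /\ sform e d (fun x => r x * A x)].
have [||n0 hn0] := sform_nullstellensatz Kunc (e := e) (J := J).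
- split; first by move=> d f [].
  + move=> d; split; first split; [exact: sform_zero| |].
      by under eq_fun do rewrite mulr0; exact: sform_zero.
    move=> c f g [hf Jf] [hg Jg]; split; first exact: (sform_vsubspace e d).2.
    have := (sform_vsubspace e d).2 c _ _ Jf Jg; congr sform.
    by apply/funext => x; ring.
  + move=> d1 d2 f g [hf Jf] hg; split; first exact: sformM.
    have := sformM Jf hg; congr sform.
    by apply/funext => x; ring.
- move=> x; have /(sform_regular e)[d [P [Q [hP hQ Qx rE]]]] := rr x.
  exists d, Q; split=> //; split=> //; have := hP; congr sform.
  by apply/funext => y; rewrite (regular_global_frac rr hP hQ Qx rE).
pose S := sform e n0.
pose rS := [set f | exists2 A, S A & f = fun x => r x * A x].
have hS : vsubspace S by exact: sform_vsubspace.
have h0 := vsubspace_zero K X.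
have hrS : vsubspace rS.
  split; first by exists (fun=> 0); [exact: vsubspace0|apply/funext => x; ring].
  move=> c _ _ [A hA ->] [B hB ->]; exists (fun x => c * A x + B x).
    exact: hS.2.
  by apply/funext => x; ring.
have rSS : rS `<=` S.
  by move=> _ [A hA ->]; have [] := hn0 n0 (leqnn _) A hA.
have [k [b [_ bs]]] := sform_finite e n0.
have [m _ hm] := spans_reldim h0 bs.
have hm' : reldim [set f | f = fun=> 0] rS m.
  apply: (reldim_transfer h0 _ _ _ _ hS hm (u := r)) => //.
  - by move=> A hA; exists A.
  - by move=> A ->; apply/funext => x; ring.
  - by move=> _ [A hA ->]; exists A => //; apply/funext => x; ring.
  - move=> A hA rA0; have oU := regular_neq0 (rr q) rq.
    have /near_open[U [oU' Uq Ur]] := oU.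
    apply/funext; apply: (sform_identity irr hA oU'); first by exists q.
    move=> x /Ur rx; have /(congr1 (@^~ x))/eqP := rA0.
    by rewrite mulf_eq0 (negPf rx) => /eqP.
have sub0 : [set f | f = fun=> 0] `<=` rS by move=> f ->; exact: vsubspace0.
have SrS := reldim_inj_sub h0 hrS sub0 rSS hm' hm.
have [h hh hp] := sform_nonzero e n0 p.
have [A _ /(congr1 (@^~ p)) hE] := SrS h hh.
by move: hp; rewrite hE rp mul0r eqxx.
Qed.

Lemma global_regular_const r : (forall q, regular_at q r) ->
  forall p q, r p = r q.
Proof.
move=> rr p q; apply/eqP; rewrite -subr_eq0; apply/eqP.
apply: (@global_regular_eq0 (fun x => r x - r q) q) => [x|]; last by rewrite subrr.
by apply: regularD => //; apply: regular_cst.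
Qed.

End GlobalFunctions.

Section ClosedDecomposition.
Variables (K : fieldType) (X : fspace K) (e : proj_emb X).

(** Decomposition into irreducible components, as an induction principle: a reducible closed set is
    the union of two smaller closed ones. *)
Lemma closed_irreducible_ind (P : set X -> Prop) : P set0 ->
  (forall A B, P A -> P B -> P (A `|` B)) ->
  forall A, closed A ->
  (forall D, closed D -> irreducible_set D -> D `<=` A -> P D) -> P A.
Proof.
move=> P0 PU; apply: (closed_induction e) => A cA IH hA.
have [->//|/set0P A0] := eqVneq A set0.
have [irrA|nirr] := pselect (irreducible_set A); first exact: hA.
have [F [G [cF cG AFG nF nG]]] : exists F G, [/\ closed F, closed G,
    A `<=` F `|` G, ~ A `<=` F & ~ A `<=` G].
  apply: contrapT => hno; apply: nirr; split=> // F G cF cG AFG.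
  apply: contrapT => hFG; apply: hno; exists F, G.
  by split=> // h; apply: hFG; [left|right].
have -> : A = (A `&` F) `|` (A `&` G).
  by rewrite -setIUr; apply/esym/setIidPl.
have sm H : closed H -> ~ A `<=` H -> P (A `&` H).
  move=> cH nH; apply: IH; [exact: closedI|by move=> x []| |].
    by move=> E; apply: nH; rewrite -E => x [].
  by move=> D cD iD DA; apply: hA => // x /DA[].
by apply: PU; apply: sm.
Qed.

(** Lagrange interpolation by a product of linear forms, one for each [q] in [s], nonzero at [p] and
    vanishing at [q] when [q <> p]. The extra factor of degree [m] gives access to all degrees from
    [size s] on. *)
Lemma sform_interpolation (s : seq X) m : uniq s ->
  exists h : X -> X -> K, forall p, p \in s ->
    [/\ sform e (size s + m) (h p), h p p != 0 &
        forall q, q \in s -> q <> p -> h p q = 0].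
Proof.
move=> us.
have /choice[h hh] : forall p, exists h, p \in s ->
    [/\ sform e (size s + m) h, h p != 0 &
        forall q, q \in s -> q <> p -> h q = 0].
  move=> p; have /choice[l hl] : forall q, exists l,
      [/\ sform e 1 l, l p != 0 & q <> p -> l q = 0].
    move=> q; have [->|/eqP qp] := eqVneq q p.
      by have [l ? ?] := sform_nonzero e 1 p; exists l.
    by have [l [? ? ?]] := sform_sep e qp; exists l.
  have [x hx xp] := sform_nonzero e 1 p.
  exists (fun q => \prod_(y <- s) l y q * x q ^+ m) => ps; split.
  - by apply: sformM; [apply: sform_prod => y; have [] := hl y|exact: sformX1].
  - rewrite mulf_neq0 ?expf_neq0 // prodf_seq_neq0.
    by apply/allP => y _ /=; have [] := hl y.
  - move=> q qs qp; rewrite (big_rem q) //=; have [_ _ ->//] := hl q.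
    by rewrite !mul0r.
by exists h => p /hh.
Qed.

End ClosedDecomposition.

Lemma reldim_subr (K : fieldType) (T : Type) (A B D : set (T -> K)) a d :
  vsubspace A -> vsubspace B -> A `<=` B -> B `<=` D ->
  reldim A B a -> reldim A D d -> (a <= d)%N /\ reldim B D (d - a).
Proof.
move=> hA hB AB BD ha hd.
have [i [j [hi hj ij]]] := reldim_split hA hB AB BD hd.
have <- := reldim_uniq hA hi ha; rewrite -ij addKn; split=> //.
exact: leq_addr.
Qed.

(** * Ample sections and contractions *)

Section Contraction.
Variables (K : closedFieldType) (W Z : fspace K).
Variables (e : proj_emb W) (e' : proj_emb Z) (phi : morphism W Z).
Hypothesis Kunc : ~ countable [set: K].
Hypothesis irr : irreducible_set [set: W].
Hypothesis contr : forall D, closed D -> irreducible_set D -> D <> setT ->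
  forall a b, D a -> D b -> phi a = phi b.
Implicit Types (p q : W) (h : W -> K).

Lemma infinite_field : infinite_set [set: K].
Proof. by move=> /finite_set_countable/Kunc. Qed.

Lemma contracted_image_finite A : closed A -> A <> setT ->
  finite_set (phi @` A).
Proof.
move=> cA AT.
apply: (closed_irreducible_ind e (P := fun A => finite_set (phi @` A))) cA _.
- by rewrite image_set0.
- by move=> B C fB fC; rewrite image_setU finite_setU.
move=> D cD iD DA; have [[d Dd] _] := iD.
apply: (sub_finite_set _ (finite_set1 (phi d))) => _ [x Dx <-].
apply: (contr cD iD) => // DT; apply: AT; apply/seteqP; split=> // y _.
by apply: DA; rewrite DT.
Qed.

(** Sections of the pullback of [O(1)] tensored with [O(d)]. *)
Definition twisted d h := forall q y X,
  sform e' 1 y -> y (phi q) != 0 -> sform e d X -> X q != 0 ->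
  regular_at q (fun x => h x / (y (phi x) * X x)).

Lemma twistedD d h g : twisted d h -> twisted d g ->
  twisted d (fun x => h x + g x).
Proof.
move=> hh hg q y X hy yq hX Xq.
have := regularD (hh q y X hy yq hX Xq) (hg q y X hy yq hX Xq).
by congr regular_at; apply/funext => x; rewrite mulrDl.
Qed.

Lemma twistedM d s A : sform e' 1 s -> sform e d A ->
  twisted d (fun x => s (phi x) * A x).
Proof.
move=> hs hA q y X hy yq hX Xq.
have r1 := mor_regular (regular_frac hs hy yq).
have := regularM r1 (regular_frac hA hX Xq).
by congr regular_at; apply/funext => x; rewrite invfM; ring.
Qed.

Lemma twisted_identity d h (U : set W) : twisted d h -> open U -> U !=set0 ->
  (forall q, U q -> h q = 0) -> forall q, h q = 0.
Proof.
move=> hh oU U0 hU q.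
have [y hy yq] := sform_nonzero e' 1 (phi q).
have [X hX Xq] := sform_nonzero e d q.
have /nbhs_singleton/eqP : \forall x \near q, h x / (y (phi x) * X x) = 0.
  apply: (regular_identity e irr (hh q y X hy yq hX Xq) oU U0).
  by apply: filterE => x /hU ->; rewrite mul0r.
by rewrite mulf_eq0 invr_eq0 mulf_eq0 (negPf yq) (negPf Xq) !orbF => /eqP.
Qed.

Lemma pullback_open s : sform e' 1 s -> open [set q | s (phi q) != 0].
Proof.
move=> hs; apply: (open_comp (f := phi) (D := [set y | s y != 0])).
  by move=> x _; apply: mor_continuous.
exact: sform_open hs.
Qed.

Section Sheaf.
Variables (s t : Z -> K) (F : W -> K).
Hypotheses (hs : sform e' 1 s) (ht : sform e' 1 t) (hF : sform e 1 F).
Hypothesis sF : forall q, F q = 0 -> s (phi q) != 0.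
Hypothesis t0 : exists q, t (phi q) != 0.
Hypothesis F0 : exists q, F q != 0.

(** With [r = s / t], this is the degree [d] part of the graded module
    [t (S + r S)], [S] being the coordinate ring. *)
Definition twist_module d : set (W -> K) := [set h | exists A B,
  [/\ sform e d A, sform e d B & h = fun q => t (phi q) * A q + s (phi q) * B q]].

Lemma twist_module_vsubspace d : vsubspace (twist_module d).
Proof.
have hS := sform_vsubspace e d.
split.
  exists (fun=> 0), (fun=> 0); split; [exact: vsubspace0|exact: vsubspace0|].
  by apply/funext => q; ring.
move=> c _ _ [A [B [hA hB ->]]] [A' [B' [hA' hB' ->]]].
exists (fun q => c * A q + A' q), (fun q => c * B q + B' q).
split; [exact: hS.2|exact: hS.2|].
by apply/funext => q; ring.
Qed.

Lemma twist_module_twisted d h : twist_module d h -> twisted d h.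
Proof. by move=> [A [B [hA hB ->]]]; apply: twistedD; apply: twistedM. Qed.

Lemma twist_moduleM d d' h g : twist_module d h -> sform e d' g ->
  twist_module (d + d') (fun q => h q * g q).
Proof.
move=> [A [B [hA hB ->]]] hg.
exists (fun q => A q * g q), (fun q => B q * g q).
split; [exact: sformM|exact: sformM|].
by apply/funext => q; ring.
Qed.

(** Every form [A] of large degree satisfies [t A \in F N + s S]: the quotient
    [t / s] is regular along [F = 0], where [s] does not vanish. *)
Lemma twist_module_generated : exists n0, forall n A, (n0 <= n)%N ->
  sform e n.+1 A -> exists h B, [/\ twist_module n h, sform e n.+1 B &
    forall q, t (phi q) * A q = F q * h q + s (phi q) * B q].
Proof.
(* The quotient by [F] has degree one less than [A], so [pN] shifts the index; in degree 0 only the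
   zero quotient is allowed. *)
pose pN d h := if d is n.+1 then twist_module n h else h = fun=> 0.
pose J d := [set A | sform e d A /\ exists h B, [/\ pN d h, sform e d B &
    forall q, t (phi q) * A q = F q * h q + s (phi q) * B q]].
have [||n0 hn0] := sform_nullstellensatz Kunc (e := e) (J := J).
- split; first by move=> d f [].
  + move=> d; have hS := sform_vsubspace e d; split.
      split; first exact: vsubspace0.
      exists (fun=> 0), (fun=> 0); split; last by move=> q; ring.
        by case: d {hS} => // d; apply: vsubspace0; apply: twist_module_vsubspace.
      exact: vsubspace0.
    move=> c f f' [hf [h [B [hh hB E]]]] [hf' [h' [B' [hh' hB' E']]]].
    split; first exact: hS.2.
    exists (fun q => c * h q + h' q), (fun q => c * B q + B' q); split.
    * case: d hh hh' {hS hf hf' hB hB'} => [-> ->|d]; last exact: (twist_module_vsubspace d).2.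
      by apply/funext => q; ring.
    * exact: hS.2.
    * move=> q; transitivity (c * (t (phi q) * f q) + t (phi q) * f' q); first by ring.
      by rewrite E E'; ring.
  + move=> d d' f g [hf [h [B [hh hB E]]]] hg; split; first exact: sformM.
    exists (fun q => h q * g q), (fun q => B q * g q); split.
    * case: d hh {hf hB} => [->|d]; last by move=> /twist_moduleM; apply.
      case: d' {hg} => [|d']; first by apply/funext => q; rewrite mul0r.
      have := vsubspace0 (twist_module_vsubspace d'); congr twist_module.
      by apply/funext => q; rewrite mul0r.
    * exact: sformM.
    * move=> q; transitivity ((t (phi q) * f q) * g q); first by ring.
      by rewrite E; ring.
- move=> p; have [Fp|Fp] := eqVneq (F p) 0; last first.
    exists 1%N, F; split=> //; split=> //.
    exists (fun q => t (phi q)), (fun=> 0); split; [|exact: sform_zero|by move=> q; ring].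
    exists (fun=> 1), (fun=> 0); split; [exact: sform_cst|exact: sform_zero|].
    by apply/funext => q; ring.
  have sp := sF Fp.
  have /(sform_regular e)[d [P [Q [hP hQ Qp E]]]] := mor_regular (regular_frac ht hs sp).
  have snear : \forall q \near p, s (phi q) != 0.
    by apply: open_nbhs_nbhs; split=> //; exact: pullback_open.
  have /near_open[U [oU Up UE]] : \forall q \near p,
      t (phi q) * Q q + s (phi q) * (- 1 * P q) = 0.
    have Qn := sform_near hQ Qp.
    apply: filterS3 E snear Qn => q Eq sq Qq.
    have -> : t (phi q) = P q / Q q * s (phi q) by rewrite -Eq divfK.
    by field.
  exists d, Q; split=> //; split=> //; exists (fun=> 0), P; split=> //.
    case: d {hP hQ} => // d; exact: vsubspace0 (twist_module_vsubspace d).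
  move=> q; apply/eqP; rewrite -subr_eq0; apply/eqP.
  have := @twisted_identity d _ U _ oU (ex_intro _ p Up) UE q.
  rewrite mulr0 add0r mulN1r mulrN; apply.
  by apply: twistedD; apply: twistedM => //; apply: vsubspaceZ => //; apply: sform_vsubspace.
exists n0 => n A nn hA.
have [] := hn0 n.+1 _ A hA; first exact: leq_trans nn _.
by move=> _ [h [B [hh hB E]]]; exists h, B.
Qed.

(** Let [a n] and [b n] be the dimensions of the forms of degree [n] and of [twist_module n]. By
    [twist_module_generated], multiplication by [s] maps the forms of degree [n.+1] modulo [F] onto
    [twist_module n.+1] modulo [F]; hence [b n.+1 - b n <= a n.+1 - a n] for large [n], and
    [b n - a n] no longer increases. *)
Lemma twist_module_bounded : exists k n0, forall n, (n0 <= n)%N ->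
  exists2 m, (m <= k)%N & reldim
    [set h | exists2 A, sform e n A & h = fun q => t (phi q) * A q]
    (twist_module n) m.
Proof.
have [n0 hn0] := twist_module_generated.
pose z0 := [set f : W -> K | f = fun=> 0].
have hz : vsubspace z0 by exact: vsubspace_zero.
pose tS n := [set h | exists2 A, sform e n A & h = fun q => t (phi q) * A q].
pose FS n := [set h | exists2 A, sform e n A & h = fun q => F q * A q].
pose FN n := [set h | exists2 A, twist_module n A & h = fun q => F q * A q].
have mulV (u : W -> K) (V : set (W -> K)) : vsubspace V ->
    vsubspace [set h | exists2 A, V A & h = fun q => u q * A q].
  move=> hV; split.
    exists (fun=> 0); first exact: vsubspace0.
    by apply/funext => q; rewrite mulr0.
  move=> c _ _ [A hA ->] [B hB ->]; exists (fun q => c * A q + B q).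
    exact: hV.2.
  by apply/funext => q; ring.
have mul_dim (u : W -> K) (V : set (W -> K)) k : vsubspace V ->
    (forall A, V A -> (forall q, u q * A q = 0) -> forall q, A q = 0) ->
    reldim z0 V k -> reldim z0 [set h | exists2 A, V A & h = fun q => u q * A q] k.
  move=> hV inj hk; apply: (reldim_transfer hz _ _ _ _ hV hk (u := u)) => //.
  - by move=> A VA; exists A.
  - by move=> A ->; apply/funext => q; rewrite mulr0.
  - by move=> _ [A VA ->]; exists A => //; apply/funext => q; rewrite subrr.
  - move=> A VA E; apply/funext; apply: inj => // q; exact: (congr1 (@^~ q) E).
have zsub V : vsubspace V -> z0 `<=` V by move=> hV f ->; apply: vsubspace0.
have hS n := sform_vsubspace e n.
have hN n := twist_module_vsubspace n.
have tSN n : tS n `<=` twist_module n.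
  move=> _ [A hA ->]; exists A, (fun=> 0); split=> //; first exact: sform_zero.
  by apply/funext => q; ring.
have FSS n : FS n `<=` sform e n.+1.
  by move=> _ [A hA ->]; rewrite -add1n; apply: sformM.
have FNN n : FN n `<=` twist_module n.+1.
  move=> _ [A hA ->]; rewrite -addn1; have := twist_moduleM hA hF.
  by congr twist_module; apply/funext => q; rewrite mulrC.
have /choice[a ha] : forall n, exists a, reldim z0 (sform e n) a.
  move=> n; have [k [b [_ bs]]] := sform_finite e n.
  by have [m _ ?] := spans_reldim hz bs; exists m.
have tSa n : reldim z0 (tS n) (a n).
  apply: mul_dim => // A hA E; apply: (sform_identity irr hA (pullback_open ht)) => //.
  by move=> q /= tq; move/eqP: (E q); rewrite mulf_eq0 (negPf tq) => /eqP.
have FSa n : reldim z0 (FS n) (a n).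
  apply: mul_dim => // A hA E; apply: (sform_identity irr hA (sform_open hF)) => //.
  by move=> q /= tq; move/eqP: (E q); rewrite mulf_eq0 (negPf tq) => /eqP.
have /choice[b hb] : forall n, exists b, reldim z0 (twist_module n) b.
  move=> n.
  have [k [c [cS cs]]] := sform_finite e n.
  have : spans z0 (twist_module n) (fun i : 'I_#|{: 'I_k + 'I_k}| => fun q =>
      match enum_val i with inl j => t (phi q) * c j q | inr j => s (phi q) * c j q end).
    pose bb (x : 'I_k + 'I_k) q :=
      match x with inl j => t (phi q) * c j q | inr j => s (phi q) * c j q end.
    apply: (spans_finType (b := bb)) => _ [A [B [hA hB ->]]].
    have [x hx] := cs _ hA; have [y hy] := cs _ hB.
    exists (fun i => match i with inl j => x j | inr j => y j end).
    apply/funext => q; rewrite big_sumType /=.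
    have /eqP := congr1 (@^~ q) hx; rewrite subr_eq0 => /eqP ->.
    have /eqP := congr1 (@^~ q) hy; rewrite subr_eq0 => /eqP ->.
    rewrite /lcomb !mulr_sumr; apply/eqP; rewrite subr_eq0; apply/eqP.
    by congr (_ + _); apply: eq_bigr => i _; ring.
  by move=> hsp; have [m _ ?] := spans_reldim hz hsp; exists m.
have FNb n : reldim z0 (FN n) (b n).
  apply: mul_dim => // A hA E.
  apply: (twisted_identity (twist_module_twisted hA) (sform_open hF)) => //.
  by move=> q /= tq; move/eqP: (E q); rewrite mulf_eq0 (negPf tq) => /eqP.
have q_dim n : (a n <= b n)%N /\ reldim (tS n) (twist_module n) (b n - a n).
  exact: (reldim_subr hz (mulV _ _ (hS n)) (zsub _ (mulV _ _ (hS n))) (tSN n)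
    (tSa n) (hb n)).
have step n : (n0 <= n)%N -> (b n.+1 - a n.+1 <= b n - a n)%N.
  move=> nn.
  have [l1 d1] := reldim_subr hz (mulV F _ (hS n)) (zsub _ (mulV F _ (hS n))) (@FSS n) (FSa n) (ha n.+1).
  have [l2 d2] := reldim_subr hz (mulV F _ (hN n)) (zsub _ (mulV F _ (hN n))) (@FNN n) (FNb n) (hb n.+1).
  have [m lem hm] : exists2 m, (m <= a n.+1 - a n)%N &
      reldim (FN n) (twist_module n.+1) m.
    apply: (reldim_transfer_leq (mulV F _ (hN n)) (u := fun q => s (phi q)) _ _ d1).
  - move=> _ [A hA ->]; exists (fun q => s (phi q) * A q); last by apply/funext => q; ring.
    exists (fun=> 0), A; split=> //; first exact: sform_zero.
    by apply/funext => q; ring.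
  - move=> _ [A [B [hA hB ->]]].
    have [h [B' [hh hB' E]]] := hn0 n A nn hA.
    exists (fun q => B' q + B q); first exact: vsubspaceD.
    exists h => //; apply/funext => q; rewrite E; ring.
  have := reldim_uniq (mulV F _ (hN n)) hm d2.
  have [l3 _] := q_dim n; lia.
exists (b n0 - a n0)%N, n0 => n nn; exists (b n - a n)%N; last by have [] := q_dim n.
rewrite -(subnKC nn); elim: (n - n0)%N => [|j IHj]; first by rewrite addn0.
by rewrite addnS; apply: leq_trans (step _ _) IHj; apply: leq_addr.
Qed.

End Sheaf.

(** In an infinite fibre over [z], interpolating forms at [k.+1] points, multiplied by [s], are
    independent modulo the multiples of [t], as [t] vanishes at [z] and [s] does not. This exceeds
    the bound of [twist_module_bounded]. *)
Lemma contraction_fiber_finite w0 w1 z : phi w0 <> phi w1 ->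
  finite_set [set q | phi q = z].
Proof.
move=> ww; apply: contrapT => zinf.
have Kinf := infinite_field.
have [w wz] : exists w, phi w <> z.
  apply: contrapT => h; apply: ww; transitivity z.
    by apply: contrapT => h'; apply: h; exists w0.
  by apply/esym; apply: contrapT => h'; apply: h; exists w1.
have [F hF Fw] := sform_nonzero e 1 w.
have /finite_seqP[sg sgE] : finite_set (phi @` [set q | F q = 0]).
  apply: contracted_image_finite; first exact: sform_closed hF.
  move=> FT; have : [set q | F q = 0] w by rewrite FT.
  by move=> /= /eqP; rewrite (negPf Fw).
(* The hyperplane section [F = 0] has finite image, so a single linear form can be nonzero on that
   image and at [z]. *)
have [s hs sP] := sform_avoid e' (z :: sg) Kinf.
have [t [ht tz tw]] := sform_sep e' (fun E => wz (esym E)).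
have sz : s z != 0 by apply: sP; rewrite mem_head.
have [z' z'z] : exists z', phi z' = z.
  have [[|x xs] [_ //= _ xP]] := infinite_set_uniq 1 zinf.
  by exists x; apply: xP; rewrite mem_head.
have [|||k [n0 hk]] := twist_module_bounded hs ht hF.
- move=> q Fq; apply: sP; rewrite inE; apply/orP; right.
  have : (phi @` [set q | F q = 0]) (phi q) by exists q.
  by rewrite sgE.
- by exists w.
- by exists w.
have [pts [upts spts ptsz]] := infinite_set_uniq k.+1 zinf.
have [h hh] := sform_interpolation e n0 upts.
have [m mk [b [_ bs _]]] := hk (size pts + n0)%N (leq_addl _ _).
suff : (k.+1 <= m)%N by rewrite ltnNge mk.
have ptsi (i : 'I_k.+1) : nth w pts i \in pts by rewrite mem_nth ?spts.
apply: (spans_indep_leq _ bs (b' := fun (i : 'I_k.+1) q => s (phi q) * h (nth w pts i) q)).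
- split.
    exists (fun=> 0); first exact: sform_zero.
    by apply/funext => q; rewrite mulr0.
  move=> c _ _ [A hA ->] [B hB ->]; exists (fun q => c * A q + B q).
    exact: (sform_vsubspace e _).2.
  by apply/funext => q; ring.
- move=> i; exists (fun=> 0), (h (nth w pts i)); split.
  + exact: sform_zero.
  + by have [] := hh _ (ptsi i).
  + by apply/funext => q; ring.
- move=> c [A hA E] i.
  have := congr1 (@^~ (nth w pts i)) E; rewrite /lcomb (bigD1 i) //= big1.
    rewrite ptsz // tz mul0r addr0 => /eqP; rewrite !mulf_eq0 (negPf sz) /=.
    by have [_ /negPf -> _] := hh _ (ptsi i); rewrite orbF => /eqP.
  move=> j ji; have [_ _ hj] := hh _ (ptsi j).
  rewrite hj ?mulr0 ?mulr0 // => /eqP; rewrite nth_uniq ?spts //.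
  by rewrite eq_sym; apply/negP.
Qed.

End Contraction.

(** * Integral curves *)

Section Curves.
Variables (K : closedFieldType) (Y Z : fspace K).
Variables (e : proj_emb Y) (e' : proj_emb Z) (phi : morphism Y Z).
Hypothesis Kunc : ~ countable [set: K].

Lemma integral_curve_sub A : closed A -> irreducible_set A ->
  ~ (exists x, A = [set x]) -> exists2 C : set Y, integral_curve C & C `<=` A.
Proof.
move=> cA; move: A cA.
apply: (closed_induction e) => A cA IH iA nA.
have [[D [cD iD DA DnA nD]]|hno] := pselect (exists D, [/\ closed D,
    irreducible_set D, D `<=` A, D <> A & ~ exists x, D = [set x]]).
  by have [C hC CD] := IH D cD DA DnA iD nD; exists C => //; apply: subset_trans DA.
exists A => //; split=> // D cD iD DA.
have [->|DnA] := pselect (D = A); [by left|right].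
by apply: contrapT => nD; apply: hno; exists D.
Qed.

(** A minimal irreducible closed [A] on which [phi] is nonconstant is a curve. Its proper
    irreducible closed subsets are contracted, so they lie in fibres of [phi] on [A]; these are
    finite by [contraction_fiber_finite], and a finite irreducible set is a point. *)
Lemma nonconstant_integral_curve A a b : closed A -> irreducible_set A ->
  A a -> A b -> phi a <> phi b ->
  exists2 C : set Y, integral_curve C & exists a b, [/\ C a, C b & phi a <> phi b].
Proof.
move=> cA; move: A cA a b.
apply: (closed_induction e) => A cA IH a b iA Aa Ab phiab.
have [[D [cD iD DA DnA [x [y [Dx Dy xy]]]]]|hno] := pselect (exists D,
    [/\ closed D, irreducible_set D, D `<=` A, D <> A &
      exists x y, [/\ D x, D y & phi x <> phi y]]).
  exact: IH cD DA DnA x y iD Dx Dy xy.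
have const D x y : closed D -> irreducible_set D -> D `<=` A -> D <> A ->
    D x -> D y -> phi x = phi y.
  move=> cD iD DA DnA Dx Dy; apply: contrapT => xy; apply: hno.
  by exists D; split=> //; exists x, y.
exists A; last by exists a, b.
have [e1 _] := sub_emb e cA.
have psiE (w : fs_sub A) : mor_comp phi (sub_incl A) w = phi (sval w) by [].
have fin z : finite_set [set w : fs_sub A | phi (sval w) = z].
  apply: (contraction_fiber_finite e1 e' (phi := mor_comp phi (sub_incl A)) Kunc _ _
    (w0 := exist _ a Aa) (w1 := exist _ b Ab)) => //.
    exact: fs_sub_irreducible.
  move=> D cD iD DT x y Dx Dy; rewrite !psiE.
  apply: (const [set x | exists2 w : fs_sub A, D w & sval w = x]).
  - exact: fs_sub_closed.
  - rewrite fs_sub_image; apply: irreducible_image => //.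
    exact: fs_sub_incl_continuous.
  - by move=> _ [w _ <-]; exact: (proj2_sig w).
  - move=> E; apply: DT; apply/seteqP; split=> // w _.
    have /seteqP[_ /(_ (sval w) (proj2_sig w))] := E.
    by move=> [w' Dw' /fs_sub_inj <-].
  - by exists x.
  - by exists y.
split=> //; first by move=> [x Ax]; apply: phiab; move: Aa Ab; rewrite Ax => -> ->.
move=> D cD iD DA; have [->|DnA] := pselect (D = A); [by left|right].
apply: irreducible_finite => //; first exact: emb_closed1 e.
have [[d Dd] _] := iD.
apply: (sub_finite_set _ (finite_image (sval : fs_sub A -> Y) (fin (phi d)))).
move=> x Dx; exists (exist _ x (DA x Dx)) => //=.
exact: const cD iD DA DnA Dx Dd.
Qed.

Lemma integral_curve_proper_finite (C : set Y) : integral_curve C ->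
  forall D : set (fs_sub C), closed D -> D <> setT -> finite_set D.
Proof.
move=> [cC iC nC minC] D cD DT.
have [e1 _] := sub_emb e cC.
apply: (closed_irreducible_ind e1) cD _ => //; first by move=> A B fA fB; rewrite finite_setU.
move=> D' cD' iD' D'D.
have [|||E|[x E]] := minC [set x | exists2 w : fs_sub C, D' w & sval w = x].
- exact: fs_sub_closed.
- rewrite fs_sub_image; apply: irreducible_image => //.
  exact: fs_sub_incl_continuous.
- by move=> _ [w _ <-]; exact: (proj2_sig w).
- exfalso; apply: DT; apply/seteqP; split=> // w _; apply: D'D.
  have /seteqP[_ /(_ (sval w) (proj2_sig w))] := E.
  by move=> [w' Dw' /fs_sub_inj <-].
- have [[w D'w] _] := iD'.
  apply: (sub_finite_set _ (finite_set1 w)) => w' D'w' /=; apply: fs_sub_inj.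
  have h v : D' v -> sval v = x.
    move=> D'v; have : [set x | exists2 w : fs_sub C, D' w & sval w = x] (sval v) by exists v.
    by rewrite E.
  by rewrite !h.
Qed.

End Curves.

(** * Multiplicities and the Hilbert function on a curve *)

Section LocalRing.
Variables (K : fieldType) (X : fspace K).
Implicit Types (p : X) (a b f g h : X -> K).

Definition local_ring p : set (X -> K) := [set f | regular_at p f].

Definition local_ideal p a : set (X -> K) :=
  [set f | exists2 h, regular_at p h & \forall q \near p, f q = h q * a q].

Lemma local_ring_vsubspace p : vsubspace (local_ring p).
Proof.
split=> [|c f g hf hg]; first exact: regular_cst.
by apply: regularD => //; apply: regularM => //; apply: regular_cst.
Qed.

Lemma regularB p f g : regular_at p f -> regular_at p g ->
  regular_at p (fun q => f q - g q).
Proof. exact: vsubspaceB (local_ring_vsubspace p). Qed.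

Lemma local_ideal_vsubspace p a : vsubspace (local_ideal p a).
Proof.
split.
  exists (fun=> 0); first exact: regular_cst.
  by apply: filterE => q; rewrite mul0r.
move=> c f g [h rh fE] [h' rh' gE]; exists (fun q => c * h q + h' q).
  exact: (local_ring_vsubspace p).2.
by apply: filterS2 fE gE => q -> ->; ring.
Qed.

Lemma local_idealM p a f g : local_ideal p a f -> regular_at p g ->
  local_ideal p a (fun q => f q * g q).
Proof.
move=> [h rh fE] rg; exists (fun q => h q * g q); first exact: regularM.
by apply: filterS fE => q ->; ring.
Qed.

Lemma local_ideal_near p a f g : (\forall q \near p, f q = g q) ->
  local_ideal p a f -> local_ideal p a g.
Proof.
move=> fg [h rh fE]; exists h => //.
by apply: filterS2 fg fE => q <-.
Qed.

Lemma local_ideal_near0 p a f : (\forall q \near p, f q = 0) -> local_ideal p a f.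
Proof.
move=> f0; exists (fun=> 0); first exact: regular_cst.
by apply: filterS f0 => q ->; rewrite mul0r.
Qed.

Lemma local_ideal_sub p a : regular_at p a -> local_ideal p a `<=` local_ring p.
Proof.
move=> ra f [h rh fE]; apply: (regular_eq (f := fun q => h q * a q)).
  by apply: filterS fE => q ->.
exact: regularM.
Qed.

Lemma local_ideal_unit p a b v : regular_at p v -> v p != 0 ->
  (\forall q \near p, b q = v q * a q) -> local_ideal p a = local_ideal p b.
Proof.
move=> rv vp bE.
have v0 := regular_neq0 rv vp.
apply/seteqP; split=> f [h rh fE].
  exists (fun q => h q * (v q)^-1); first by apply: regularM => //; apply: regularV.
  by apply: filterS3 fE bE v0 => q -> -> vq; field.
exists (fun q => h q * v q); first exact: regularM.
by apply: filterS2 fE bE => q -> ->; ring.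
Qed.

Lemma colengthP p a n :
  colength p a n <-> reldim (local_ideal p a) (local_ring p) n.
Proof.
have idlE (f : X -> K) (c : 'I_n -> K) (b : 'I_n -> X -> K) :
    local_ideal p a (fun q => f q - lcomb c b q) <->
    exists2 h, regular_at p h &
      \forall q \near p, f q = \sum_(i < n) c i * b i q + h q * a q.
  split=> -[h rh E]; exists h => //; apply: filterS E => q.
    by move=> <-; rewrite addrC subrK.
  by move=> ->; rewrite /lcomb addrC addKr.
split=> -[b].
  move=> [rb hb]; exists b; split=> //.
    move=> f /hb[c [hc _]]; exists c; exact/idlE.
  move=> c hc i.
  have rf : regular_at p (lcomb c b) by apply: vsubspace_lcomb => //; apply: local_ring_vsubspace.
  have [c0 [_ uc]] := hb _ rf.
  have e1 : c0 = [ffun i => c i].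
    apply: uc; apply/idlE; apply: local_ideal_near0; apply: filterE => q.
    rewrite [X in _ - X](_ : _ = lcomb c b q) ?subrr //.
    by apply: eq_bigr => j _; rewrite ffunE.
  have e2 : c0 = [ffun=> 0].
    apply: uc; apply/idlE; move: hc; congr local_ideal; apply/funext => q.
    rewrite [X in _ - X](_ : _ = 0) ?subr0 //.
    by apply: big1 => j _; rewrite ffunE mul0r.
  by have := congr1 (fun c : {ffun _} => c i) e1; rewrite e2 !ffunE.
move=> [rb sb ib]; exists b; split=> // f rf.
have [c hc] := sb f rf; exists [ffun i => c i]; split.
  apply/idlE; move: hc; congr local_ideal; apply/funext => q; congr (_ - _).
  by apply: eq_bigr => j _; rewrite ffunE.
move=> c' /idlE hc'; apply/ffunP => i; rewrite ffunE.
apply/eqP; rewrite -subr_eq0; apply/eqP; apply: (ib (fun i => c i - c' i)).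
have := vsubspaceB (local_ideal_vsubspace p a) hc' hc.
congr local_ideal; apply/funext => q; rewrite /lcomb.
under [in RHS]eq_bigr do rewrite mulrBl.
by rewrite sumrB; ring.
Qed.

Lemma colength_uniq p a n m : colength p a n -> colength p a m -> n = m.
Proof. by move=> /colengthP h /colengthP; apply: reldim_uniq h; apply: local_ideal_vsubspace. Qed.

Lemma colength_unit_mul p a b v n : regular_at p v -> v p != 0 ->
  (\forall q \near p, b q = v q * a q) -> colength p a n -> colength p b n.
Proof.
by move=> rv vp bE /colengthP h; apply/colengthP; rewrite -(local_ideal_unit rv vp bE).
Qed.

Lemma colength_near p a b n : (\forall q \near p, a q = b q) ->
  colength p a n -> colength p b n.
Proof.
move=> ab; apply: (colength_unit_mul (regular_cst p 1) (oner_neq0 _)).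
by apply: filterS ab => q ->; rewrite mul1r.
Qed.

Lemma colength_unit p a : regular_at p a -> a p != 0 -> colength p a 0.
Proof.
move=> ra ap; apply/colengthP; apply: sub_reldim0; first exact: local_ideal_vsubspace.
move=> f rf; exists (fun q => f q * (a q)^-1).
  by apply: regularM => //; apply: regularV.
by apply: filterS (regular_neq0 ra ap) => q aq; rewrite divfK.
Qed.

Lemma colength0_unit p a : colength p a 0 -> a p != 0.
Proof.
move=> /colengthP/(reldim0_sub (local_ideal_vsubspace p a)) h.
have [k _ /nbhs_singleton] := h (fun=> 1) (regular_cst p 1).
by move=> E; apply: contra_eqN (esym E) => /eqP ->; rewrite mulr0 eq_sym oner_neq0.
Qed.

(** The ideals generated by [a] and [h ^ k] become stationary, which gives [h ^ k = h ^ k.+1 * g]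
    modulo [a]; since [h p = 0], the factor [1 - h * g] is a unit. *)
Lemma local_ideal_nilpotent p a n h : colength p a n -> regular_at p a ->
  regular_at p h -> h p = 0 -> exists k, local_ideal p a (fun q => h q ^+ k).
Proof.
move=> /colengthP hn ra rh hp.
pose M k := [set f | exists2 g, regular_at p g &
  local_ideal p a (fun q => f q - h q ^+ k * g q)].
have hI := local_ideal_vsubspace p a.
have hX k : regular_at p (fun q => h q ^+ k) by exact: regularX.
have [k hk] : exists k, M k `<=` M k.+1.
  apply: (reldim_chain hI hn).
  - move=> f [g rg /(local_ideal_sub ra) rf].
    have := regularD rf (regularM (hX 0%N) rg).
    by rewrite /local_ring /=; congr regular_at; apply/funext => q; ring.
  - move=> k; split.
      exists (fun=> 0); first exact: regular_cst.
      by apply: local_ideal_near0; apply: filterE => q; ring.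
    move=> c f f' [g rg If] [g' rg' If']; exists (fun q => c * g q + g' q).
      exact: (local_ring_vsubspace p).2.
    have := hI.2 c _ _ If If'; congr local_ideal; apply/funext => q; ring.
  - move=> k f If; exists (fun=> 0); first exact: regular_cst.
    by move: If; congr local_ideal; apply/funext => q; ring.
  - move=> k f [g rg If]; exists (fun q => h q * g q); first exact: regularM.
    by move: If; congr local_ideal; apply/funext => q; rewrite exprSr mulrA.
have [|g rg [c rc cE]] := hk (fun q => h q ^+ k).
  exists (fun=> 1); first exact: regular_cst.
  by apply: local_ideal_near0; apply: filterE => q; ring.
pose v q := 1 - h q * g q.
have rv : regular_at p v by apply: regularB; [exact: regular_cst|exact: regularM].
have vp : v p != 0 by rewrite /v hp mul0r subr0 oner_neq0.
exists k, (fun q => c q * (v q)^-1); first by apply: regularM => //; apply: regularV.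
apply: filterS2 cE (regular_neq0 rv vp) => q E vq.
apply: (mulIf vq); rewrite mulrAC divfK // -E /v exprS; ring.
Qed.

End LocalRing.

Section LocalRingIrreducible.
Variables (K : fieldType) (X : fspace K) (e : proj_emb X).
Hypothesis irr : irreducible_set [set: X].
Implicit Types (p : X) (a b f g h : X -> K).

(** If [a = 0] then every function vanishing at [p] is nilpotent near [p]. *)
Lemma colength_nonzero p p' a n : p <> p' -> regular_at p a -> colength p a n ->
  ~ (\forall q \near p, a q = 0).
Proof.
move=> pp' ra hn a0.
have [l [hl lp lp']] := sform_sep e pp'.
have [x hx xp] := sform_nonzero e 1 p.
have [|k [c _ cE]] := local_ideal_nilpotent hn ra (regular_frac hl hx xp).
  by rewrite lp mul0r.
move: lp'; rewrite (sform_near_identity irr hl (p := p)) ?eqxx //.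
apply: filterS3 cE a0 (sform_near hx xp) => q E aq xq.
move/eqP: E; rewrite aq mulr0 expf_eq0 mulf_eq0 invr_eq0 (negPf xq) orbF.
by move=> /andP[_ /eqP].
Qed.

(** In the chain from the ideal of [a * b] through that of [a] to the local ring, the lower quotient
    is the local ring modulo [b], via multiplication by [a], which is injective in a domain. *)
Lemma colengthM p a b n m : regular_at p a -> regular_at p b ->
  ~ (\forall q \near p, a q = 0) ->
  colength p a n -> colength p b m -> colength p (fun q => a q * b q) (n + m).
Proof.
move=> ra rb a0 /colengthP hn /colengthP hm; apply/colengthP; rewrite addnC.
have hI := local_ideal_vsubspace p.
apply: (reldim_trans (hI _) (hI a)) => //.
- by move=> f [h rh E]; exists (fun q => h q * b q); [exact: regularM|apply: filterS E => q ->; ring].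
- exact: local_ideal_sub.
apply: (reldim_transfer (hI _) _ _ _ _ (local_ring_vsubspace p) hm (u := a)).
- by move=> f rf; exists f => //; apply: filterE => q; ring.
- by move=> f [h rh E]; exists h => //; apply: filterS E => q ->; ring.
- move=> f [h rh E]; exists h => //; apply: local_ideal_near0.
  by apply: filterS E => q ->; ring.
- move=> f rf [h rh E]; exists h => //.
  have fE : \forall q \near p, a q * (f q - h q * b q) = 0.
    by apply: filterS E => q E; rewrite mulrBr E; ring.
  have := regular_integral e irr ra (regularB rf (regularM rh rb)) a0 fE.
  by apply: filterS => q /eqP; rewrite subr_eq0 => /eqP.
Qed.

End LocalRingIrreducible.

(** * Forms with finitely many zeros: multiplicities and the Hilbert function *)

Section FormZeros.
Variables (K : closedFieldType) (C : fspace K) (e : proj_emb C).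
Hypothesis Kunc : ~ countable [set: K].
Hypothesis irr : irreducible_set [set: C].
Implicit Types (p q : C) (f g h A B G P Q : C -> K).

Let z0 := [set f : C -> K | f = fun=> 0].
Let hz : vsubspace z0 := vsubspace_zero K C.

(** Truncated subtraction alone would give the constants for [n < k]. *)
Definition sform_sub k n : set (C -> K) :=
  if (k <= n)%N then sform e (n - k) else z0.

Lemma sform_sub_vsubspace k n : vsubspace (sform_sub k n).
Proof.
rewrite /sform_sub; case: leqP => _; [exact: sform_vsubspace|exact: vsubspace_zero].
Qed.

Lemma sform_subE k n B : sform_sub k (n + k) B = sform e n B.
Proof. by rewrite /sform_sub leq_addl addnK. Qed.

Lemma sform_subM k n m B g : sform_sub k n B -> sform e m g ->
  sform_sub k (n + m) (fun q => B q * g q).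
Proof.
rewrite /sform_sub; case: leqP => kn hB hg.
  by rewrite (leq_trans kn (leq_addr _ _)) -addnBAC //; apply: sformM.
move: hB => /= ->; case: leqP => _; last by apply/funext => q; rewrite mul0r.
by under eq_fun do rewrite mul0r; apply: sform_zero.
Qed.

Variables (d : nat) (F X : C -> K) (pts : seq C).
Hypotheses (hF : sform e d F) (hX : sform e 1 X).
Hypothesis upts : uniq pts.
Hypothesis ptsP : forall p, (p \in pts) = (F p == 0).
Hypothesis Xpts : forall p, p \in pts -> X p != 0.
Hypothesis F0 : exists q, F q != 0.

Let frac n A := fun q => A q / X q ^+ n.
Let f := frac d F.

Local Lemma frac_regular p n A : p \in pts -> sform e n A -> regular_at p (frac n A).
Proof.
by move=> ps hA; apply: regular_frac hA (sformX1 _ hX) _; rewrite expf_neq0 ?Xpts.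
Qed.

Local Lemma X_near p : p \in pts -> \forall q \near p, X q != 0.
Proof. by move=> ps; apply: sform_near hX (Xpts ps). Qed.

(** [F] and [X] have no common zero, so the Nullstellensatz applies to the ideal they generate. *)
Lemma forms_generated : exists2 n0, (d <= n0)%N & forall n A, (n0 <= n)%N ->
  sform e n.+1 A -> exists B G, [/\ sform_sub d n.+1 B, sform e n G &
    forall q, A q = F q * B q + X q * G q].
Proof.
pose J n := [set A | sform e n A /\ exists B G,
  [/\ sform_sub d n B, sform_sub 1 n G & forall q, A q = F q * B q + X q * G q]].
have [||n0 hn0] := sform_nullstellensatz Kunc (e := e) (J := J).
- split; first by move=> n A [].
  + move=> n; have h1 := sform_sub_vsubspace d n; have h2 := sform_sub_vsubspace 1 n.
    have h3 := sform_vsubspace e n; split.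
      split; first exact: vsubspace0.
      exists (fun=> 0), (fun=> 0); split; [exact: vsubspace0|exact: vsubspace0|].
      by move=> q; ring.
    move=> c A A' [hA [B [G [hB hG E]]]] [hA' [B' [G' [hB' hG' E']]]].
    split; first exact: h3.2.
    exists (fun q => c * B q + B' q), (fun q => c * G q + G' q).
    split; [exact: h1.2|exact: h2.2|].
    by move=> q; rewrite E E'; ring.
  + move=> n m A g [hA [B [G [hB hG E]]]] hg; split; first exact: sformM.
    exists (fun q => B q * g q), (fun q => G q * g q).
    split; [exact: sform_subM|exact: sform_subM|].
    by move=> q; rewrite E; ring.
- move=> p; have [Fp|Fp] := eqVneq (F p) 0.
    exists 1%N, X; split; last by apply: Xpts; rewrite ptsP Fp.
    split=> //; exists (fun=> 0), (fun=> 1); split.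
    + exact: vsubspace0 (sform_sub_vsubspace _ _).
    + by rewrite -[1%N in X in sform_sub _ X]add0n sform_subE; apply: sform_cst.
    + by move=> q; ring.
  exists d, F; split=> //; split=> //; exists (fun=> 1), (fun=> 0); split.
  + by rewrite -[d in X in sform_sub _ X]add0n sform_subE; apply: sform_cst.
  + exact: vsubspace0 (sform_sub_vsubspace _ _).
  + by move=> q; ring.
exists (maxn d n0); first exact: leq_maxl.
move=> n A; rewrite geq_max => /andP[_ nn] hA.
have [_ [B [G [hB hG E]]]] := hn0 n.+1 (leq_trans nn (leqnSn _)) A hA.
by exists B, G; split=> //; have := sform_subE 1 n G; rewrite addn1 => <-.
Qed.

(** Modulo [F], the local functions [A / X ^ n] are already of degree [n0]. *)
Lemma frac_reduce : exists2 n0, (d <= n0)%N & forall n A, sform e n A ->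
  exists2 A0, sform e n0 A0 & forall p, p \in pts ->
    local_ideal p f (fun q => frac n A q - frac n0 A0 q).
Proof.
have [n0 dn0 hn0] := forms_generated; exists n0 => //.
elim=> [|n IHn] A hA.
  exists (fun q => A q * X q ^+ n0).
    by rewrite -[n0 in sform e n0]add0n; apply: sformM => //; apply: sformX1.
  move=> p ps; apply: local_ideal_near0; apply: filterS (X_near ps) => q Xq.
  by rewrite /frac mulfK ?expf_neq0 // expr0 divr1 subrr.
have [nn|nn] := leqP n0 n; last first.
  exists (fun q => A q * X q ^+ (n0 - n.+1)).
    by rewrite -[n0 in sform e n0](subnKC nn); apply: sformM => //; apply: sformX1.
  move=> p ps; apply: local_ideal_near0; apply: filterS (X_near ps) => q Xq.
  rewrite /frac; have -> : X q ^+ n0 = X q ^+ n.+1 * X q ^+ (n0 - n.+1) by rewrite -exprD subnKC.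
  by rewrite -mulf_div divff ?expf_neq0 // mulr1 subrr.
have [B [G [hB hG E]]] := hn0 n A nn hA.
have [A0 hA0 hI] := IHn G hG; exists A0 => // p ps.
have dn : (d <= n.+1)%N by apply: leq_trans dn0 _; apply: leq_trans nn _.
have hB' : sform e (n.+1 - d) B by move: hB; rewrite /sform_sub /= dn.
apply: (local_ideal_near (f := fun q => f q * frac (n.+1 - d) B q +
    (frac n G q - frac n0 A0 q))).
  apply: filterS (X_near ps) => q Xq; rewrite addrA; congr (_ - _).
  rewrite /f /frac mulf_div -exprD subnKC // E mulrDl; congr (_ + _).
  by rewrite exprS -mulf_div divff // mul1r.
apply: vsubspaceD (local_ideal_vsubspace p f) _ (hI p ps).
exists (frac (n.+1 - d) B); first exact: frac_regular.
by apply: filterE => q; rewrite mulrC.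
Qed.

(** The bound [n0] is uniform in [p] and [g]. For a germ [P / Q], multiplication by the unit
    [Q / X ^ m] maps the finite-dimensional space of fractions modulo [f] injectively into itself,
    hence onto, so [P / X ^ m] can be divided by it among the fractions. *)
Lemma local_ring_generated : exists n0, forall p g, p \in pts -> regular_at p g ->
  exists2 A0, sform e n0 A0 & local_ideal p f (fun q => g q - frac n0 A0 q).
Proof.
have [n0 dn0 hn0] := frac_reduce; exists n0 => p g ps rg.
have hI := local_ideal_vsubspace p f.
pose L := [set g | exists2 A0, sform e n0 A0 & local_ideal p f (fun q => g q - frac n0 A0 q)].
suff : L g by [].
have hL : vsubspace L.
  split.
    exists (fun=> 0); first exact: sform_zero.
    by apply: local_ideal_near0; apply: filterE => q; rewrite /frac mul0r subrr.
  move=> c u v [A hA Iu] [B hB Iv]; exists (fun q => c * A q + B q).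
    exact: (sform_vsubspace e n0).2.
  by have := hI.2 c _ _ Iu Iv; congr local_ideal; apply/funext => q; rewrite /frac; ring.
have IL : local_ideal p f `<=` L.
  move=> u Iu; exists (fun=> 0); first exact: sform_zero.
  by move: Iu; congr local_ideal; apply/funext => q; rewrite /frac mul0r subr0.
have fracL n A : sform e n A -> L (frac n A).
  by move=> hA; have [A0 hA0 h] := hn0 n A hA; exists A0 => //; apply: h.
have LM u n A : L u -> sform e n A -> L (fun q => frac n A q * u q).
  move=> [A0 hA0 Iu] hA.
  have h := vsubspaceD hL (fracL _ _ (sformM hA hA0))
    (IL _ (local_idealM Iu (frac_regular ps hA))).
  have [A1 hA1 I1] := h; exists A1 => //; apply: local_ideal_near I1.
  apply: filterS (X_near ps) => q Xq; congr (_ - _).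
  by rewrite /frac exprD -mulf_div; ring.
have [k hk] : exists k, reldim (local_ideal p f) L k.
  have [k [b [bd bs]]] := sform_finite e n0.
  have sp : spans (local_ideal p f) L (fun i => frac n0 (b i)).
    move=> u [A0 hA0 Iu]; have [c hc] := bs _ hA0; exists c.
    move: Iu; congr local_ideal; apply/funext => q; congr (_ - _).
    have /eqP := congr1 (@^~ q) hc; rewrite subr_eq0 => /eqP E.
    rewrite /frac E /lcomb mulr_suml; apply: eq_bigr => i _; ring.
  by have [m _ ?] := spans_reldim hI sp; exists m.
have /(sform_regular e)[m [P [Q [hP hQ Qp gE]]]] := rg.
have ra := frac_regular ps hQ.
have ap : frac m Q p != 0 by rewrite mulf_neq0 // invr_eq0 expf_neq0 ?Xpts.
pose D := [set u | exists2 v, L v & local_ideal p f (fun q => u q - frac m Q q * v q)].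
have hD : vsubspace D.
  split.
    exists (fun=> 0); first exact: vsubspace0.
    by apply: local_ideal_near0; apply: filterE => q; ring.
  move=> c u v [u' Lu Iu] [v' Lv Iv]; exists (fun q => c * u' q + v' q).
    exact: hL.2.
  by have := hI.2 c _ _ Iu Iv; congr local_ideal; apply/funext => q; ring.
have ID : local_ideal p f `<=` D.
  move=> u Iu; exists (fun=> 0); first exact: vsubspace0.
  by move: Iu; congr local_ideal; apply/funext => q; ring.
have DL : D `<=` L.
  move=> u [v Lv Iu].
  have := vsubspaceD hL (IL _ Iu) (LM _ _ _ Lv hQ); congr L.
  by apply/funext => q; ring.
have LD : L `<=` D.
  apply: (reldim_inj_sub hI hD ID DL _ hk).
  apply: (reldim_transfer hI _ _ _ _ hL hk (u := frac m Q)).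
  - move=> u Lu; exists u => //.
    by apply: local_ideal_near0; apply: filterE => q; ring.
  - move=> u Iu; have := local_idealM Iu ra; congr local_ideal.
    by apply/funext => q; ring.
  - by move=> u [v Lv Iu]; exists v.
  - move=> u _ Iu; apply: local_ideal_near (local_idealM Iu (regularV ra ap)).
    by apply: filterS (regular_neq0 ra ap) => q aq; rewrite mulrC mulKf.
have [u Lu Iu] := LD _ (fracL _ _ hP).
have := vsubspaceD hL Lu (IL _ (local_idealM Iu (regularV ra ap))).
move=> [A0 hA0 I0]; exists A0 => //; apply: local_ideal_near I0.
have Xn := X_near ps; have Qn := sform_near hQ Qp.
apply: filterS3 gE Xn Qn => q -> Xq Qq; congr (_ - _).
have Xm : X q ^+ m != 0 by rewrite expf_neq0.
rewrite /frac; move: (X q ^+ m) Xm => x x0; field.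
by rewrite Qq x0.
Qed.

Lemma form_colength p : p \in pts -> exists n, colength p f n.
Proof.
move=> ps; have [n0 hn0] := local_ring_generated.
have [k [b [bd bs]]] := sform_finite e n0.
have sp : spans (local_ideal p f) (local_ring p) (fun i => frac n0 (b i)).
  move=> u /(hn0 p u ps)[A0 hA0 Iu]; have [c hc] := bs _ hA0; exists c.
  move: Iu; congr local_ideal; apply/funext => q; congr (_ - _).
  have /eqP := congr1 (@^~ q) hc; rewrite subr_eq0 => /eqP E.
  rewrite /frac E /lcomb mulr_suml; apply: eq_bigr => i _; ring.
have [m _ hm] := spans_reldim (local_ideal_vsubspace p f) sp.
by exists m; apply/colengthP.
Qed.

(** An interpolating form vanishes at the other zeros, where it is therefore nilpotent modulo [f]; a
    power that serves all of them is taken. *)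
Lemma form_isolate p : p \in pts -> exists m G, [/\ sform e m G, G p != 0 &
  forall q, q \in pts -> q <> p -> local_ideal q f (frac m G)].
Proof.
move=> ps; have [h hh] := sform_interpolation e 0 upts.
have [hs hp hq] := hh p ps; move: hs; rewrite addn0; set s := size pts => hs.
have /choice[k hk] : forall q, exists k, q \in pts -> q <> p ->
    local_ideal q f (fun x => frac s (h p) x ^+ k).
  move=> q; have [qs|] := boolP (q \in pts); last by exists 0%N.
  have [->|/eqP qp] := eqVneq q p; first by exists 0%N.
  have [n hn] := form_colength qs.
  have [|k hk] := local_ideal_nilpotent hn (frac_regular qs hF) (frac_regular qs hs).
    by rewrite /frac hq // mul0r.
  by exists k.
pose M := (\max_(q <- pts) k q)%N.
exists (M * s)%N, (fun q => h p q ^+ M); split.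
- exact: sformX.
- by rewrite expf_neq0.
move=> q qs qp.
have kM : (k q <= M)%N by rewrite /M (big_rem q) //= leq_maxl.
have := local_idealM (hk q qs qp) (regularX (M - k q) (frac_regular qs hs)).
congr local_ideal; apply/funext => x; rewrite -exprD subnKC //.
by rewrite /frac exprMn exprVn -exprM mulnC.
Qed.

Let vanish (s : seq C) n : set (C -> K) := [set A | sform e n A /\
  forall q, q \in s -> local_ideal q f (frac n A)].

Local Lemma frac_add p n A B c : local_ideal p f (frac n A) ->
  local_ideal p f (frac n B) ->
  local_ideal p f (frac n (fun q => c * A q + B q)).
Proof.
move=> hA hB; have := (local_ideal_vsubspace p f).2 c _ _ hA hB.
by congr local_ideal; apply/funext => q; rewrite /frac; ring.
Qed.

Local Lemma vanish_vsubspace s n : vsubspace (vanish s n).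
Proof.
split.
  split=> [|q _]; first exact: sform_zero.
  by apply: local_ideal_near0; apply: filterE => x; rewrite /frac mul0r.
move=> c A B [hA IA] [hB IB]; split; first exact: (sform_vsubspace e n).2.
by move=> q qs; apply: frac_add; [exact: IA|exact: IB].
Qed.

(** Chinese remaindering, one zero at a time: passing from [vanish s] to [vanish (p :: s)] costs the
    colength at [p]. The isolating form of [p] makes every germ at [p] modulo [f] come from a form
    that lies in the local ideals along [s]. *)
Lemma vanish_codim (c : C -> nat) :
  (forall p, p \in pts -> colength p f (c p)) ->
  exists n0, forall n, (n0 <= n)%N ->
    reldim (vanish pts n) (sform e n) (\sum_(p <- pts) c p)%N.
Proof.
move=> hc.
have [n0 hn0] := local_ring_generated.
have /choice[mG hmG] : forall p, exists mG : nat * (C -> K), p \in pts ->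
    [/\ sform e mG.1 mG.2, mG.2 p != 0 &
     forall q, q \in pts -> q <> p -> local_ideal q f (frac mG.1 mG.2)].
  move=> p; have [/form_isolate[m [G h]]|] := boolP (p \in pts); first by exists (m, G).
  by exists (0%N, fun=> 0).
exists (n0 + \max_(p <- pts) (mG p).1)%N => n nn.
have sub : forall s, uniq s -> {subset s <= pts} ->
    reldim (vanish s n) (sform e n) (\sum_(p <- s) c p)%N; last exact: sub.
elim=> [_ _|p s IHs /= /andP[ps us] sp].
  rewrite big_nil; apply: sub_reldim0; first exact: vanish_vsubspace.
  by move=> A hA; split.
have pp : p \in pts by apply: sp; rewrite mem_head.
have sp' : {subset s <= pts} by move=> q qs; apply: sp; rewrite inE qs orbT.
rewrite big_cons; have hs := IHs us sp'.
have V1 := vanish_vsubspace (p :: s) n; have V2 := vanish_vsubspace s n.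
have V12 : vanish (p :: s) n `<=` vanish s n.
  by move=> A [hA IA]; split=> // q qs; apply: IA; rewrite inE qs orbT.
have V2S : vanish s n `<=` sform e n by move=> A [].
apply: (reldim_trans V1 V2 V12 V2S) => //.
have [k hk] : exists k, reldim (vanish (p :: s) n) (vanish s n) k.
  have [k [b [_ bs]]] := sform_finite e n.
  have [k' _ ?] := spans_reldim V1 (spans_refl V1 (spansS V2S bs)).
  by exists k'.
suff -> : c p = k by [].
apply: colength_uniq (hc p pp) _; apply/colengthP.
apply: (reldim_transfer (local_ideal_vsubspace p f) _ _ _ _ V2 hk
  (u := fun q => (X q ^+ n)^-1)).
- move=> A [hA _]; have := frac_regular pp hA.
  by rewrite /local_ring /=; congr regular_at; apply/funext => q; rewrite /frac mulrC.
- move=> A [_ /(_ p (mem_head _ _))]; congr local_ideal.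
  by apply/funext => q; rewrite /frac mulrC.
- move=> g rg; have [hG Gp GI] := hmG p pp.
  set m := (mG p).1 in hG GI; set G := (mG p).2 in hG Gp GI.
  have nm : (n0 + m <= n)%N.
    apply: leq_trans nn; rewrite leq_add2l /m (big_rem p) //=; exact: leq_maxl.
  have rG := frac_regular pp hG.
  have Gp' : frac m G p != 0 by rewrite mulf_neq0 // invr_eq0 expf_neq0 ?Xpts.
  have [A0 hA0 I0] := hn0 p _ pp (regularM rg (regularV rG Gp')).
  have fracE q : X q != 0 ->
      frac n (fun q => A0 q * (G q * X q ^+ (n - (n0 + m)))) q =
      frac m G q * frac n0 A0 q.
    move=> Xq; rewrite /frac; have -> : X q ^+ n = X q ^+ n0 * (X q ^+ m * X q ^+ (n - (n0 + m))).
      by rewrite -!exprD addnA subnKC.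
    rewrite -mulf_div -[X in _ * X]mulf_div divff ?expf_neq0 // mulr1.
    by rewrite mulrC.
  exists (fun q => A0 q * (G q * X q ^+ (n - (n0 + m)))); first split.
  + rewrite -[n in sform e n](subnKC nm) -addnA; apply: sformM => //.
    by apply: sformM => //; apply: sformX1.
  + move=> q qs; have qp : q <> p by move=> E; move: ps; rewrite -E qs.
    have qq := sp' q qs.
    apply: local_ideal_near (local_idealM (GI q qq qp) (frac_regular qq hA0)).
    by apply: filterS (X_near qq) => x Xx; rewrite fracE.
  + apply: local_ideal_near (local_idealM I0 rG).
    have Xn := X_near pp; have Gn := regular_neq0 rG Gp'.
    apply: filterS2 Xn Gn => q Xq Gq.
    rewrite mulrBl divfK //; congr (_ - _); rewrite mulrC -fracE //.
    by rewrite /frac mulrC.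
- move=> A [hA IA] Ip; split=> // q; rewrite inE => /predU1P[->|]; last exact: IA.
  by move: Ip; congr local_ideal; apply/funext => x; rewrite /frac mulrC.
Qed.

(** Repeated division by [X] modulo [F]. The threshold [n0] does not depend on [k], so for a fixed
    [n] the remainders [G] stay in one finite-dimensional space. *)
Lemma forms_divide : exists n0, forall k n A, (n0 <= n)%N -> sform e (n + k) A ->
  exists B G, [/\ sform_sub d (n + k) B, sform e n G &
    forall q, A q = F q * B q + X q ^+ k * G q].
Proof.
have [n0 _ hn0] := forms_generated; exists n0; elim=> [|k IHk] n A nn hA.
  exists (fun=> 0), A; split.
  - exact: vsubspace0 (sform_sub_vsubspace _ _).
  - by rewrite addn0 in hA.
  - by move=> q; rewrite mulr0 add0r mul1r.
rewrite addnS in hA *.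
have [B [G' [hB hG' E]]] := hn0 _ A (leq_trans nn (leq_addr k n)) hA.
have [B' [G [hB' hG E']]] := IHk n G' nn hG'.
exists (fun q => B q + B' q * X q), G; split=> //.
  apply: (vsubspaceD (sform_sub_vsubspace _ _)) => //.
  by rewrite -addn1; apply: sform_subM.
by move=> q; rewrite E E' exprS; ring.
Qed.

(** The forms [G] with [G * A] divisible by [F] make up an ideal. It contains [F], and at a zero of
    [F] the local quotient of [A] by [F] supplies a member nonzero there, so it contains all large
    powers of [X]. *)
Lemma vanish_kill n A : vanish pts n A -> exists k0, forall k, (k0 <= k)%N ->
  exists2 B, sform_sub d (n + k) B & forall q, X q ^+ k * A q = F q * B q.
Proof.
move=> [hA IA].
pose J m := [set G | sform e m G /\ exists2 B, sform_sub d (n + m) B &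
  forall q, G q * A q = F q * B q].
have [||k0 hk0] := sform_nullstellensatz Kunc (e := e) (J := J).
- split; first by move=> m G [].
  + move=> m; have h1 := sform_sub_vsubspace d (n + m); split.
      split; first exact: sform_zero.
      by exists (fun=> 0); [exact: vsubspace0|move=> q; ring].
    move=> c G G' [hG [B hB E]] [hG' [B' hB' E']].
    split; first exact: (sform_vsubspace e m).2.
    exists (fun q => c * B q + B' q); first exact: h1.2.
    by move=> q; rewrite mulrDl -mulrA E E'; ring.
  + move=> m m' G g [hG [B hB E]] hg; split; first exact: sformM.
    exists (fun q => B q * g q); first by rewrite addnA; apply: sform_subM.
    by move=> q; rewrite mulrAC E mulrA.
- move=> p; have [Fp|Fp] := eqVneq (F p) 0; last first.
    by exists d, F; split=> //; split=> //; exists A => //; rewrite sform_subE.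
  have ps : p \in pts by rewrite ptsP Fp.
  have [h /(sform_regular e)[m [P [Q [hP hQ Qp hE]]]] fE] := IA p ps.
  exists (m + d)%N, (fun q => Q q * X q ^+ d).
  split; last by rewrite mulf_neq0 // expf_neq0 // Xpts.
  split; first by apply: sformM => //; apply: sformX1.
  exists (fun q => X q ^+ n * P q).
    by rewrite addnA sform_subE; apply: sformM => //; apply: sformX1.
  have D : sform e (n + m + d) (fun q => Q q * X q ^+ d * A q - F q * (X q ^+ n * P q)).
    apply: (vsubspaceB (sform_vsubspace e _)).
      by rewrite -addnA addnC; do ?apply: sformM => //; apply: sformX1.
    by rewrite addnC; do ?apply: sformM => //; apply: sformX1.
  have near0 : \forall q \near p, Q q * X q ^+ d * A q - F q * (X q ^+ n * P q) = 0.
    have Qn := sform_near hQ Qp; have Xn := X_near ps.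
    apply: filterS2 (filterI fE hE) (filterI Qn Xn) => q [E1 E2] [Qq Xq].
    have Xd : X q ^+ d != 0 by rewrite expf_neq0.
    have Xn' : X q ^+ n != 0 by rewrite expf_neq0.
    have -> : A q = P q / Q q * (F q / X q ^+ d) * X q ^+ n.
      by rewrite -E2 -/(frac d F q) -/(f q) -E1 /frac divfK.
    move: (X q ^+ d) (X q ^+ n) Xd Xn' => x y x0 y0; field.
    by rewrite Qq x0.
  by move=> q; apply/eqP; rewrite -subr_eq0 (sform_near_identity irr D near0).
exists k0 => k kk.
by have [_ [B hB E]] := hk0 k kk _ (sformX1 k hX); exists B.
Qed.

(** Modulo [F], [A] is [X ^ j] times some [G] in [vanish pts n0], a space of fixed degree with a
    finite basis. By [vanish_kill], one exponent carries the whole basis into the multiples of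
    [F]. *)
Lemma vanish_principal : exists n0, forall n A, (n0 <= n)%N -> vanish pts n A ->
  exists2 B, sform_sub d n B & forall q, A q = F q * B q.
Proof.
have [n0 hn0] := forms_divide.
have [m [b [_ bs]]] := sform_finite e n0.
have VS : vanish pts n0 `<=` sform e n0 by move=> A [].
have [r _ [b' [b'V b's _]]] := spans_reldim hz (spansS VS bs).
have /choice[k hk] : forall i, exists k0, forall k, (k0 <= k)%N ->
    exists2 B, sform_sub d (n0 + k) B & forall q, X q ^+ k * b' i q = F q * B q.
  by move=> i; exact: vanish_kill (b'V i).
exists (n0 + \max_(i < r) k i)%N => n A nn [hA IA].
pose j := (n - n0)%N.
have nE : n = (n0 + j)%N by rewrite subnKC //; apply: leq_trans nn; apply: leq_addr.
have kj i : (k i <= j)%N.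
  have ki : (k i <= \max_(i < r) k i)%N by apply: (leq_bigmax (F := k)).
  by apply: leq_trans ki _; rewrite -(leq_add2l n0) -nE.
rewrite nE in hA IA *.
have [B [G [hB hG E]]] := hn0 j n0 A (leqnn _) hA.
have VG : vanish pts n0 G.
  split=> // p ps.
  have dn : B = (fun=> 0) \/ sform e (n0 + j - d) B /\ (d <= n0 + j)%N.
    by move: hB; rewrite /sform_sub; case: leqP => dn hB; [right|left].
  have IFB : local_ideal p f (frac (n0 + j) (fun q => F q * B q)).
    case: dn => [->|[hB' dn]].
      by apply: local_ideal_near0; apply: filterE => q; rewrite /frac mulr0 mul0r.
    exists (frac (n0 + j - d) B); first exact: frac_regular.
    by apply: filterE => q; rewrite /f /frac mulf_div -exprD subnK // [B q * _]mulrC.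
  have := vsubspaceB (local_ideal_vsubspace p f) (IA p ps) IFB.
  apply: local_ideal_near; apply: filterS (X_near ps) => q Xq.
  rewrite /frac E -mulrBl addrAC subrr add0r exprD -[in LHS](mulr1 (G q)).
  by rewrite [X q ^+ j * _]mulrC -mulf_div divff ?expf_neq0 // mulr1 mulr1.
have [c hc] := b's G VG.
have /choice[D hD] : forall i, exists D, sform_sub d (n0 + j) D /\
    forall q, X q ^+ j * b' i q = F q * D q.
  by move=> i; have [D ? ?] := hk i j (kj i); exists D.
exists (fun q => B q + lcomb c D q).
  apply: (vsubspaceD (sform_sub_vsubspace _ _)) => //.
  by apply: vsubspace_lcomb => [|i]; [exact: sform_sub_vsubspace|have [] := hD i].
move=> q; rewrite E mulrDr; congr (_ + _).
have /eqP := congr1 (@^~ q) hc; rewrite subr_eq0 => /eqP ->.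
rewrite /lcomb !mulr_sumr; apply: eq_bigr => i _.
rewrite mulrCA [in RHS]mulrCA; congr (_ * _).
by have [_ ->] := hD i.
Qed.

(** The zeros of [F], counted with multiplicity, are the jump of the Hilbert
    function; in particular their number only depends on the degree of [F]. *)
Lemma hilbert_count (c : C -> nat) :
  (forall p, p \in pts -> colength p f (c p)) ->
  exists n0, forall n a b, (n0 <= n)%N -> reldim z0 (sform e n) a ->
    reldim z0 (sform e (n + d)) b -> b = (a + \sum_(p <- pts) c p)%N.
Proof.
move=> hc; have [n1 hn1] := vanish_codim hc; have [n2 hn2] := vanish_principal.
exists (maxn n1 n2) => n a b; rewrite geq_max => /andP[nn1 nn2] ha hb.
have hS := sform_vsubspace e.
pose FS := [set h | exists2 B, sform e n B & h = fun q => F q * B q].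
have VF : vanish pts (n + d) = FS.
  apply/seteqP; split=> A.
    move=> /hn2[|B hB E]; first by apply: leq_trans nn2 _; apply: leq_addr.
    by exists B; [move: hB; rewrite sform_subE|apply/funext].
  move=> [B hB ->]; split; first by rewrite addnC; apply: sformM.
  move=> p ps; exists (frac n B); first exact: frac_regular.
  by apply: filterE => q; rewrite /f /frac mulf_div -exprD [B q * _]mulrC.
have hFS : vsubspace FS by rewrite -VF; apply: vanish_vsubspace.
have FSa : reldim z0 FS a.
  apply: (reldim_transfer hz _ _ _ _ (hS n) ha (u := F)).
  - by move=> A hA; exists A.
  - by move=> A ->; apply/funext => q; rewrite mulr0.
  - by move=> _ [A hA ->]; exists A => //; apply/funext => q; rewrite subrr.
  - move=> A hA E; apply/funext; apply: (sform_integral irr hF hA) => // q.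
    exact: (congr1 (@^~ q) E).
have hcod := hn1 (n + d)%N (leq_trans nn1 (leq_addr _ _)).
rewrite VF in hcod.
apply: reldim_uniq hz hb _; apply: reldim_trans FSa hcod => //.
- by move=> A ->; exact: vsubspace0.
- by rewrite -VF => A [].
Qed.

End FormZeros.

(** * Degrees of line bundles on curves *)

Section SectionOrder.
Variables (K : fieldType) (X : fspace K).
Implicit Types (p q : X) (V : set X) (s : X -> X -> K).

Lemma section_order_near V V' s s' p k :
  (\forall q \near p, V' q -> V q /\ s p q = s' p q) ->
  section_order V s p k -> section_order V' s' p k.
Proof.
move=> h [a [b [na [nb [ra rb ha hb [E ->]]]]]]; exists a, b, na, nb; split=> //.
split=> //; apply: filterS2 h E => q h E V'q.
by have [Vq <-] := h V'q; apply: E.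
Qed.

Lemma section_orderV V s p k : (\forall q \near p, V q -> s p q != 0) ->
  section_order V s p k -> section_order V (fun x q => (s x q)^-1) p (- k).
Proof.
move=> s0 [a [b [na [nb [ra rb ha hb [E ->]]]]]]; exists b, a, nb, na; split=> //.
split; last by rewrite opprB.
by apply: filterS2 s0 E => q s0 E Vq; rewrite -E // mulfK // s0.
Qed.

Lemma section_order_unit V s p : regular_at p (s p) -> s p p != 0 ->
  section_order V s p 0.
Proof.
move=> rs sp; exists (s p), (fun=> 1), 0%N, 0%N; split.
- exact: rs.
- exact: regular_cst.
- exact: colength_unit.
- by apply: colength_unit; [exact: regular_cst|exact: oner_neq0].
- by split=> //; apply: filterE => q _; rewrite mul1r.
Qed.

Lemma section_order_regular V s p n : regular_at p (s p) -> colength p (s p) n ->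
  section_order V s p n%:Z.
Proof.
move=> rs hn; exists (s p), (fun=> 1), n, 0%N; split=> //.
- exact: regular_cst.
- by apply: colength_unit; [exact: regular_cst|exact: oner_neq0].
- by split; [apply: filterE => q _; rewrite mul1r|rewrite subr0].
Qed.

Lemma fsum_support (o : X -> int) (s : seq X) : uniq s ->
  (forall p, p \notin s -> o p = 0) ->
  \sum_(p \in [set: X]) o p = \sum_(p <- s) o p.
Proof.
move=> us hs; rewrite [RHS]fsbig_seq // (fsbig_widen [set` s] setT o) // => p [_ /= ps].
by apply: hs; apply/negP.
Qed.

Definition supported (o : X -> int) := exists2 s : seq X, uniq s &
  forall p, p \notin s -> o p = 0.

Lemma fsum_lin (o o' : X -> int) (k : int) : supported o -> supported o' ->
  \sum_(p \in [set: X]) (o p + k * o' p) =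
  \sum_(p \in [set: X]) o p + k * \sum_(p \in [set: X]) o' p.
Proof.
move=> [s us hs] [s' us' hs']; pose w := undup (s ++ s').
have uw : uniq w by apply: undup_uniq.
have ws p : p \notin w -> o p = 0 /\ o' p = 0.
  by rewrite mem_undup mem_cat negb_or => /andP[/hs -> /hs' ->].
rewrite (fsum_support (o := o) uw); last by move=> p /ws[].
rewrite (fsum_support (o := o') uw); last by move=> p /ws[].
rewrite (fsum_support uw); last by move=> p /ws[-> ->]; rewrite mulr0 addr0.
by rewrite big_split mulr_sumr.
Qed.

Lemma lb_dom_near (L : line_bundle X) x z : lb_dom L x z ->
  \forall w \near z, lb_dom L x w.
Proof. by move=> hx; apply: open_nbhs_nbhs; split=> //; exact: lb_open. Qed.

Lemma lb_iso_tr (L M : line_bundle X) :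
  (forall x y z, lb_dom L x z -> lb_dom L y z -> lb_dom M x z -> lb_dom M y z ->
     lb_tr L x y z = lb_tr M x y z) -> lb_iso L M.
Proof.
move=> h; exists (fun _ _ => 1); split.
  by move=> x z _ _; split; [exact: regular_cst|exact: oner_neq0].
by move=> x y z Lx Mx Ly My; rewrite mulr1 mul1r h.
Qed.

End SectionOrder.

(** * Orders of sections and invariance of the degree *)

Section Curve.
Variables (K : closedFieldType) (C : fspace K) (e : proj_emb C).
Hypothesis Kunc : ~ countable [set: K].
Hypothesis irr : irreducible_set [set: C].
Hypothesis proper_finite : forall D : set C, closed D -> D <> setT -> finite_set D.
Hypothesis nonpoint : forall p : C, exists p', p <> p'.
Implicit Types (p q : C) (V : set C) (s : C -> C -> K).

Lemma colength_germ_neq0 p (a : C -> K) n : regular_at p a -> colength p a n ->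
  ~ (\forall q \near p, a q = 0).
Proof. by have [p' pp'] := nonpoint p; exact: (colength_nonzero e irr pp'). Qed.

Lemma colength_mul p (a b : C -> K) n m : regular_at p a -> regular_at p b ->
  colength p a n -> colength p b m -> colength p (fun q => a q * b q) (n + m).
Proof.
by move=> ra rb hn; apply: (colengthM e irr) (hn) => //; apply: colength_germ_neq0 hn.
Qed.

(** Two expressions [a / b] and [a' / b'] satisfy [b' * a = b * a'] at the points of [V] near [p],
    hence at all points near [p] by the identity principle; colengths add under products. *)
Lemma section_order_uniq V s p k k' : open V -> V !=set0 ->
  section_order V s p k -> section_order V s p k' -> k = k'.
Proof.
move=> oV V0 [a [b [na [nb [ra rb ha hb [E ->]]]]]].
move=> [a' [b' [na' [nb' [ra' rb' ha' hb' [E' ->]]]]]].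
have h1 := colength_mul rb' ra hb' ha; have h2 := colength_mul rb ra' hb ha'.
have E0 : \forall q \near p, b' q * a q - b q * a' q = 0.
  apply: (regular_identity e irr _ oV V0).
    by apply: regularB; apply: regularM.
  by apply: filterS2 E E' => q E E' Vq; rewrite -E // -E' //; ring.
have : (nb' + na = nb + na')%N.
  apply: colength_uniq h1 (colength_near _ h2).
  by apply: filterS E0 => q /eqP; rewrite subr_eq0 => /eqP.
by move=> Enat; apply/eqP; rewrite subr_eq addrAC eq_sym subr_eq -!PoszD; apply/eqP; congr Posz; lia.
Qed.

Lemma section_orderM V V' s s' p k k' :
  section_order V s p k -> section_order V' s' p k' ->
  section_order (V `&` V') (fun x q => s x q * s' x q) p (k + k').
Proof.
move=> [a [b [na [nb [ra rb ha hb [E ->]]]]]].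
move=> [a' [b' [na' [nb' [ra' rb' ha' hb' [E' ->]]]]]].
exists (fun q => a q * a' q), (fun q => b q * b' q), (na + na')%N, (nb + nb')%N.
split; [exact: regularM|exact: regularM|exact: colength_mul|exact: colength_mul|].
split; last by rewrite !PoszD; ring.
by apply: filterS2 E E' => q E E' [Vq V'q]; rewrite -E // -E' //; ring.
Qed.

Lemma section_orderXz V s p k z : (\forall q \near p, V q -> s p q != 0) ->
  section_order V s p k -> section_order V (fun x q => s x q ^ z) p (k * z).
Proof.
move=> s0 hk.
have pos n : section_order V (fun x q => s x q ^ n%:Z) p (k * n%:Z).
  elim: n => [|n IHn].
    rewrite mulr0; apply: section_order_unit; last by rewrite expr0z oner_neq0.
    by under eq_fun do rewrite expr0z; apply: regular_cst.
  rewrite -addn1 PoszD mulrDr mulr1.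
  apply: section_order_near (section_orderM IHn hk).
  by apply: filterE => q Vq; split=> //; rewrite -!exprnP exprD.
case: z => n //; rewrite NegzE mulrN.
have sn0 : \forall q \near p, V q -> s p q ^ n.+1%:Z != 0.
  by apply: filterS s0 => q h /h; apply: expfz_neq0.
apply: section_order_near (section_orderV sn0 (pos n.+1)).
by apply: filterE => q Vq; split=> //; rewrite invr_expz.
Qed.

Lemma form_order d F : sform e d F -> (exists q, F q != 0) ->
  exists (c : C -> nat) (u : seq C), [/\ uniq u,
    forall p, p \notin u -> c p = 0%N,
    forall p D, sform e d D -> D p != 0 -> colength p (fun q => F q / D q) (c p) &
    exists n0, forall n a b, (n0 <= n)%N ->
      reldim [set f : C -> K | f = fun=> 0] (sform e n) a ->
      reldim [set f | f = fun=> 0] (sform e (n + d)) b ->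
      b = (a + \sum_(p <- u) c p)%N].
Proof.
move=> hF [q0 Fq0].
have /finite_seqP[u0 u0E] : finite_set [set q | F q = 0].
  apply: proper_finite; first exact: sform_closed hF.
  by move=> E; have : [set q | F q = 0] q0; [rewrite E|move=> /= /eqP; rewrite (negPf Fq0)].
pose u := undup u0.
have uu : uniq u by apply: undup_uniq.
have uP p : (p \in u) = (F p == 0).
  have /seteqP[h1 h2] := u0E; apply/idP/eqP; rewrite mem_undup; first exact: h2.
  exact: h1.
have [X hX Xu] := sform_avoid e u (infinite_field Kunc).
have col p : p \in u -> exists n, colength p (fun q => F q / X q ^+ d) n.
  by apply: (form_colength Kunc hF hX uP Xu).
have /choice[c hc] : forall p, exists n,
    (p \in u -> colength p (fun q => F q / X q ^+ d) n) /\ (p \notin u -> n = 0%N).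
  move=> p; have [/col[n hn]|pu] := boolP (p \in u); first by exists n.
  by exists 0%N.
have uc p : p \notin u -> c p = 0%N by have [_] := hc p.
exists c, u; split=> //;
last first.
  apply: (hilbert_count Kunc irr hF hX uu uP Xu); first by exists q0.
  by move=> p; have [h _] := hc p; exact: h.
move=> p D hD Dp; have [/[dup] pu|pu] := boolP (p \in u); last first.
  have [_ -> //] := hc p; apply: colength_unit; first exact: regular_frac hF hD Dp.
  by rewrite mulf_neq0 ?invr_eq0 // -uP.
have [h _ /h hn] := hc p.
have Xp : X p ^+ d != 0 by rewrite expf_neq0 ?Xu.
apply: (colength_unit_mul (regular_frac (sformX1 d hX) hD Dp) _ _ hn).
  by rewrite mulf_neq0 ?invr_eq0.
apply: filterS (sform_near (sformX1 d hX) Xp) => q Xq.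
by rewrite [RHS]mulrC [RHS]mulrA divfK.
Qed.

Lemma germ_colength p (g : C -> K) : regular_at p g ->
  ~ (\forall q \near p, g q = 0) -> exists n, colength p g n.
Proof.
move=> rg g0; have /(sform_regular e)[d [P [Q [hP hQ Qp gE]]]] := rg.
have [|c [u [_ _ hc _]]] := form_order hP.
  apply: contrapT => P0; apply: g0; apply: filterS gE => q ->.
  suff -> : P q = 0 by rewrite mul0r.
  by apply: contrapT => /eqP Pq; apply: P0; exists q.
exists (c p); apply: colength_near (hc p Q hQ Qp).
by apply: filterS gE => q ->.
Qed.

(** Write [r = F / G] with forms of the same degree: they have equally many zeros. *)
Lemma principal_degree0 V (r : C -> K) (o : C -> int) : open V -> V !=set0 ->
  (forall q, V q -> regular_at q r /\ r q != 0) ->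
  (forall p, section_order V (fun=> r) p (o p)) ->
  \sum_(p \in [set: C]) o p = 0.
Proof.
move=> oV [p1 Vp1] rV ho.
have [/(sform_regular e)[d [F [G [hF hG Gp rE]]]] rp1] := rV p1 Vp1.
have Fp : F p1 != 0.
  by move: rp1; rewrite (nbhs_singleton rE); apply: contra_neq => ->; rewrite mul0r.
have [cF [u [uu uF colF [n1 hn1]]]] := form_order hF (ex_intro _ p1 Fp).
have [cG [v [uv vG colG [n2 hn2]]]] := form_order hG (ex_intro _ p1 Gp).
have V0 : V !=set0 by exists p1.
have /near_open[U [oU Up UE]] : \forall q \near p1, r q * G q = F q.
  by apply: filterS2 rE (sform_near hG Gp) => q -> Gq; rewrite divfK.
have GrF q : V q -> r q * G q = F q.
  move=> Vq; have [D hD Dq] := sform_nonzero e d q.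
  have rg := regularB (regularM (rV q Vq).1 (regular_frac hG hD Dq)) (regular_frac hF hD Dq).
  have /nbhs_singleton : \forall x \near q, r x * (G x / D x) - F x / D x = 0.
    apply: (regular_identity e irr rg oU); first by exists p1.
    by apply: filterE => x /UE <-; ring.
  by move=> /eqP; rewrite mulrA -mulrBl mulf_eq0 invr_eq0 (negPf Dq) orbF subr_eq0 => /eqP.
have oE p : o p = (cF p)%:Z - (cG p)%:Z.
  apply: section_order_uniq oV V0 (ho p) _.
  have [D hD Dp] := sform_nonzero e d p.
  exists (fun q => F q / D q), (fun q => G q / D q), (cF p), (cG p); split.
  - exact: regular_frac hF hD Dp.
  - exact: regular_frac hG hD Dp.
  - exact: colF.
  - exact: colG.
  - by split=> //; apply: filterE => q /GrF <-; ring.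
pose w := undup (u ++ v).
have uw : uniq w by apply: undup_uniq.
have wu p : p \notin w -> p \notin u by rewrite mem_undup mem_cat negb_or => /andP[].
have wv p : p \notin w -> p \notin v by rewrite mem_undup mem_cat negb_or => /andP[].
rewrite (fsum_support uw); last first.
  by move=> p pw; rewrite oE uF ?vG ?wu ?wv.
under eq_bigr do rewrite oE.
rewrite sumrB -(fsum_support (o := fun p => (cF p)%:Z) uw); last first.
  by move=> p pw; rewrite uF ?wu.
rewrite -(fsum_support (o := fun p => (cG p)%:Z) uw); last first.
  by move=> p pw; rewrite vG ?wv.
rewrite (fsum_support uu); last by move=> p pu; rewrite uF.
rewrite (fsum_support uv); last by move=> p pv; rewrite vG.
have dim n : exists a, reldim [set f : C -> K | f = fun=> 0] (sform e n) a.
  have [k [b [_ bs]]] := sform_finite e n.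
  by have [m _ ?] := spans_reldim (vsubspace_zero K C) bs; exists m.
pose N := maxn n1 n2.
have [a ha] := dim N; have [b hb] := dim (N + d)%N.
have h1 := hn1 N a b (leq_maxl _ _) ha hb; have h2 := hn2 N a b (leq_maxr _ _) ha hb.
have : (\sum_(p <- u) cF p = \sum_(p <- v) cG p)%N by lia.
rewrite -!(big_morph Posz PoszD (erefl 0%:Z)) => ->.
by rewrite subrr.
Qed.

Section Degrees.
Implicit Types (L M : line_bundle C).

Lemma rational_section_order_supported L V s o : rational_section L V s ->
  (forall p, section_order V s p (o p)) -> supported o.
Proof.
move=> [oV V0 rs _] ho.
have /finite_seqP[u uE] : finite_set (~` V).
  apply: proper_finite; first exact: open_closedC.
  by move=> E; have [p Vp] := V0; have : (~` V) p by rewrite E.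
exists (undup u); first exact: undup_uniq.
move=> p; rewrite mem_undup => pu.
have Vp : V p.
  apply: contrapT => nVp; have : (~` V) p by [].
  by rewrite uE /= (negPf pu).
have [rp sp] := rs p p Vp (lb_mem L p).
exact: section_order_uniq oV V0 (ho p) (section_order_unit _ rp sp).
Qed.

Lemma rational_section_neq0 L V s p : rational_section L V s ->
  \forall q \near p, V q -> s p q != 0.
Proof.
move=> [_ _ rs _]; apply: filterS (lb_dom_near (lb_mem L p)) => q hq Vq.
by have [] := rs p q Vq hq.
Qed.

(** The quotient of two rational sections does not depend on the trivialisation; its diagonal values
    [s q q / s' q q] form a rational function, whose orders sum to 0. *)
Lemma has_degree_uniq L d d' : has_degree L d -> has_degree L d' -> d = d'.
Proof.
move=> [V [s [o [hs ho ->]]]] [V' [s' [o' [hs' ho' ->]]]].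
have so := rational_section_order_supported hs ho.
have so' := rational_section_order_supported hs' ho'.
have [oV V0 rs cs] := hs; have [oV' V0' rs' cs'] := hs'.
pose r q := s q q * (s' q q)^-1.
have rE p : \forall q \near p, (V `&` V') q -> s p q * (s' p q)^-1 = r q.
  apply: filterS (lb_dom_near (lb_mem L p)) => q hq [Vq Vq'].
  have hqq := lb_mem L q.
  rewrite (cs p q q) // (cs' p q q) // invfM mulrACA mulfV ?mul1r //.
  exact: lb_tr_neq0.
have /eqP : \sum_(p \in [set: C]) (o p + (-1) * o' p) = 0.
  apply: (@principal_degree0 (V `&` V') r).
  - exact: openI.
  - exact: irreducible_meet.
  - move=> q [Vq Vq']; have [r1 n1] := rs q q Vq (lb_mem L q).
    have [r2 n2] := rs' q q Vq' (lb_mem L q).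
    split; last by rewrite mulf_neq0 ?invr_neq0.
    apply: (regular_eq (f := fun x => s q x * (s' q x)^-1)); last first.
      by apply: regularM => //; apply: regularV.
    have VV : \forall x \near q, (V `&` V') x.
      by apply: open_nbhs_nbhs; split=> //; exact: openI.
    by apply: filterS2 VV (rE q) => x h /(_ h).
  - move=> p; rewrite mulN1r.
    apply: section_order_near (section_orderM (ho p)
      (section_orderV (rational_section_neq0 p hs') (ho' p))).
    by apply: filterS (rE p) => q h Vq; split=> //; exact: h.
by rewrite fsum_lin // mulN1r subr_eq0 => /eqP.
Qed.

Lemma has_degree_tensor L M d d' : has_degree L d -> has_degree M d' ->
  has_degree (lb_tensor L M) (d + d').
Proof.
move=> [V [s [o [hs ho ->]]]] [V' [s' [o' [hs' ho' ->]]]].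
have so := rational_section_order_supported hs ho.
have so' := rational_section_order_supported hs' ho'.
have [oV V0 rs cs] := hs; have [oV' V0' rs' cs'] := hs'.
exists (V `&` V'), (fun x q => s x q * s' x q), (fun p => o p + 1 * o' p); split.
- split; first exact: openI.
  + exact: irreducible_meet.
  + move=> x z [Vz Vz'] [Lz Mz]; have [r1 n1] := rs x z Vz Lz.
    have [r2 n2] := rs' x z Vz' Mz.
    by split; [exact: regularM|rewrite mulf_neq0].
  + move=> x y z [Vz Vz'] [Lx Mx] [Ly My] /=.
    by rewrite (cs x y z) // (cs' x y z) // mulrACA.
- by move=> p; rewrite mul1r; exact: section_orderM.
- by rewrite fsum_lin // mul1r.
Qed.

Lemma has_degree_pow L d k : has_degree L d -> has_degree (lb_pow L k) (d * k).
Proof.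
move=> [V [s [o [hs ho ->]]]].
have so := rational_section_order_supported hs ho.
have [oV V0 rs cs] := hs.
have s0 : supported (fun _ : C => 0) by exists [::].
exists V, (fun x q => s x q ^ k), (fun p => 0 + k * o p); split.
- split=> //.
  + move=> x z Vz Lz; have [r1 n1] := rs x z Vz Lz.
    by split; [exact: regularXz|exact: expfz_neq0].
  + by move=> x y z Vz Lx Ly /=; rewrite (cs x y z) // expfzMl.
- move=> p; rewrite add0r mulrC; apply: section_orderXz => //.
  exact: rational_section_neq0 hs.
- rewrite fsum_lin // mulrC [X in _ = X + _](_ : _ = 0) ?add0r //.
  by rewrite (fsum_support (s := [::])) ?big_nil.
Qed.

Lemma has_degree_iso L M d : lb_iso L M -> has_degree L d -> has_degree M d.
Proof.
move=> [u [ru cu]] [V [s [o [hs ho dE]]]].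
have [oV V0 rs cs] := hs.
(* The section is read in the trivialisation at [z] itself, where both bundles are defined; the
   domain of [M] at [x] need not be contained in that of [L]. *)
pose s' x z := lb_tr M x z z * (u z z * s z z).
have loc y z x : V z -> lb_dom M x z -> lb_dom L y z -> lb_dom M y z ->
    s' x z = lb_tr M x y z * (u y z * s y z).
  move=> Vz Mx Ly My; rewrite /s' (cs y z z) //; last exact: lb_mem.
  rewrite [u y z * _]mulrA -cu ?lb_mem //; try exact: lb_mem.
  rewrite !mulrA lb_cocycle //; exact: lb_mem.
exists V, s', o; split=> //.
- split=> //.
  + move=> x z Vz Mx.
    have Lz := lb_mem L z; have Mz := lb_mem M z.
    have [rz nz] := rs z z Vz Lz; have [ruz nuz] := ru z z Lz Mz.
    split; last by rewrite /s' !mulf_neq0 ?lb_tr_neq0.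
    apply: (regular_eq (f := fun w => lb_tr M x z w * (u z w * s z w))).
      have Vn : \forall w \near z, V w by apply: open_nbhs_nbhs.
  have D1 : \forall w \near z, lb_dom M x w /\ lb_dom M z w.
        by apply: filterI; apply: lb_dom_near.
      apply: filterS3 Vn (lb_dom_near Lz) D1 => w Vw Lw [Mxw Mzw].
      exact/esym/loc.
    by apply: regularM; [exact: lb_regular|exact: regularM].
  + move=> x y z Vz Mx My; rewrite /s' [RHS]mulrA lb_cocycle //; exact: lb_mem.
- move=> p; have Lp := lb_mem L p; have Mp := lb_mem M p.
  have [rup nup] := ru p p Lp Mp.
  have [a [b [na [nb [ra rb ha hb [E ok]]]]]] := ho p.
  exists (fun q => u p q * a q), b, na, nb; split=> //.
  + exact: regularM.
  + by apply: (colength_unit_mul rup nup _ ha); apply: filterE.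
  split=> //.
  apply: filterS3 E (lb_dom_near Lp) (lb_dom_near Mp) => q E Lq Mq Vq.
  rewrite (loc p) // lb_id // mul1r -E //; ring.
Qed.

(** The orders of a regular section are colengths, hence nonnegative, and colength 0 would make the
    germ a unit, so a zero contributes a positive term. *)
Lemma has_degree_section L (s : C -> C -> K) p0 q0 :
  (forall x z, lb_dom L x z -> regular_at z (s x)) ->
  (forall x y z, lb_dom L x z -> lb_dom L y z -> s x z = lb_tr L x y z * s y z) ->
  s q0 q0 != 0 ->
  exists2 d : int, has_degree L d & 0 <= d /\ (s p0 p0 = 0 -> 0 < d).
Proof.
move=> rs cs sq0.
pose V := [set q | s q q != 0].
have VE x z : lb_dom L x z -> (s x z != 0) = (s z z != 0).
  move=> Lz; rewrite (cs x z z) ?lb_mem //; last exact: lb_mem.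
  by rewrite mulf_eq0 negb_or lb_tr_neq0 ?lb_mem //; exact: lb_mem.
have oV : open V.
  rewrite openE => q Vq.
  have h1 := regular_neq0 (rs q q (lb_mem L q)) Vq.
  apply: filterS2 (lb_dom_near (lb_mem L q)) h1 => z Lz.
  by rewrite VE.
have V0 : V !=set0 by exists q0.
have hs : rational_section L V s.
  split=> //; last by move=> x y z _; exact: cs.
  by move=> x z Vz Lz; split; [exact: rs|rewrite VE].
have /choice[o ho] : forall p, exists n, colength p (s p) n.
  move=> p; apply: germ_colength; first exact: rs (lb_mem L p).
  move=> s0; have /near_open[U [oU Up UE]] :
      \forall q \near p, s p q = 0 /\ lb_dom L p q.
    by apply: filterI => //; apply: lb_dom_near; apply: lb_mem.
  have [|z [Uz Vz]] := irreducible_meet irr oU oV _ V0; first by exists p.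
  have [sz Lz] := UE z Uz; have := VE p z Lz.
  by rewrite sz eqxx => E; move: Vz; rewrite /V /= -E.
have so p : section_order V s p (o p)%:Z.
  by apply: section_order_regular => //; exact: rs (lb_mem L p).
have [u uu uo] := rational_section_order_supported hs so.
exists (\sum_(p \in [set: C]) (o p)%:Z); first by exists V, s, (fun p => (o p)%:Z).
rewrite (fsum_support uu) //; split; first exact: sumr_ge0.
move=> sp0; have op0 : o p0 != 0%N.
  by apply/eqP => op0; have := ho p0; rewrite op0 => /colength0_unit; rewrite sp0 eqxx.
have p0u : p0 \in u by apply: contraNT op0 => /uo [->].
rewrite (big_rem p0) //= ltr_pwDl //; last exact: sumr_ge0.
by rewrite ltz_nat lt0n.
Qed.

End Degrees.

End Curve.

Arguments sform_coord {K X} e i.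

(** * Line bundles on products *)

Section LineBundleIso.
Variables (K : fieldType).
Implicit Types (X Y : fspace K).

Lemma lb_iso_sym X (L M : line_bundle X) : lb_iso L M -> lb_iso M L.
Proof.
move=> [u [ru cu]]; exists (fun x z => (u x z)^-1); split.
  move=> x z Mz Lz; have [r n] := ru x z Lz Mz.
  by split; [exact: regularV|rewrite invr_neq0].
move=> x y z Mx Lx My Ly; have [_ n] := ru x z Lx Mx; have [_ n'] := ru y z Ly My.
have := cu x y z Lx Mx Ly My => E.
apply: (mulIf n'); rewrite divfK //; apply: (mulfI n).
by rewrite -E mulrA mulrA mulfV // mul1r.
Qed.

(** [u] and [v] are composed at the index of the point itself, as the domains
    of the middle bundle need not contain the common domains of the others. *)
Lemma lb_iso_trans X (L M N : line_bundle X) : lb_iso L M -> lb_iso M N -> lb_iso L N.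
Proof.
move=> [u [ru cu]] [v [rv cv]].
pose w i x z := lb_tr N x i z * (v i z * u i z) * lb_tr L i x z.
have wE i j x z : lb_dom L x z -> lb_dom N x z ->
    lb_dom L i z -> lb_dom M i z -> lb_dom N i z ->
    lb_dom L j z -> lb_dom M j z -> lb_dom N j z -> w i x z = w j x z.
  move=> Lx Nx Li Mi Ni Lj Mj Nj; rewrite /w.
  rewrite -(lb_cocycle Nx Nj Ni) -(lb_cocycle Lj Li Lx).
  have e1 := cv j i z Mj Nj Mi Ni; have e2 := cu j i z Lj Mj Li Mi.
  transitivity (lb_tr N x j z * (lb_tr N j i z * v i z * u i z) * lb_tr L i x z).
    by ring.
  rewrite e1; transitivity (lb_tr N x j z * (v j z * (lb_tr M j i z * u i z)) * lb_tr L i x z).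
    by ring.
  by rewrite e2; ring.
exists (fun x z => w z x z); split.
  move=> x z Lx Nx.
  have Lz := lb_mem L z; have Mz := lb_mem M z; have Nz := lb_mem N z.
  have [ru1 nu1] := ru z z Lz Mz; have [rv1 nv1] := rv z z Mz Nz.
  split; last by rewrite !mulf_neq0 ?lb_tr_neq0.
  apply: (regular_eq (f := w z x)).
    have D1 : \forall q \near z, lb_dom L x q /\ lb_dom N x q.
      by apply: filterI; apply: lb_dom_near.
    have D2 : \forall q \near z, lb_dom L z q /\ lb_dom N z q.
      by apply: filterI; apply: lb_dom_near.
    apply: filterS3 D1 D2 (lb_dom_near Mz) => q [Lxq Nxq] [Lzq Nzq] Mzq.
    by apply: wE => //; apply: lb_mem.
  apply: regularM; last exact: lb_regular.
  by apply: regularM; [exact: lb_regular|exact: regularM].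
move=> x y z Lx Nx Ly Ny /=; rewrite /w.
have Lz := lb_mem L z; have Nz := lb_mem N z.
rewrite -(lb_cocycle Nx Ny Nz) -(lb_cocycle Lz Lx Ly).
ring.
Qed.

Lemma lb_iso_tensor X (L L' M M' : line_bundle X) : lb_iso L L' -> lb_iso M M' ->
  lb_iso (lb_tensor L M) (lb_tensor L' M').
Proof.
move=> [u [ru cu]] [v [rv cv]]; exists (fun x z => u x z * v x z); split.
  move=> x z [Lz Mz] [Lz' Mz']; have [r n] := ru x z Lz Lz'.
  have [r' n'] := rv x z Mz Mz'.
  by split; [exact: regularM|rewrite mulf_neq0].
move=> x y z [Lx Mx] [Lx' Mx'] [Ly My] [Ly' My'] /=.
by rewrite mulrACA cu // cv // mulrACA.
Qed.

Lemma lb_iso_pullback X Y (f : morphism X Y) (L M : line_bundle Y) :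
  lb_iso L M -> lb_iso (lb_pullback f L) (lb_pullback f M).
Proof.
move=> [u [ru cu]]; exists (fun x z => u (f x) (f z)); split.
  move=> x z Lz Mz; have [r n] := ru (f x) (f z) Lz Mz.
  by split=> //; exact: (mor_regular r).
by move=> x y z Lx Mx Ly My; exact: cu.
Qed.

End LineBundleIso.

(** * The hyperplane bundle of an embedding *)

Section Hyperplane.
Variables (K : fieldType) (Z : fspace K) (e : proj_emb Z).
Implicit Types (l : Z -> K) (p q : Z).

Definition chart p := xchoose (pe_neq0 e p).

Lemma chart_neq0 p : pe_co e p (chart p) != 0.
Proof. exact: (xchooseP (pe_neq0 e p)). Qed.

(** The bundle O(1), trivialised around [p] by the coordinate of index [chart p]. *)
Definition hyperplane_bundle : line_bundle Z.
Proof.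
apply: (@LineBundle K Z (fun p => [set q | pe_co e q (chart p) != 0])
  (fun x y q => pe_co e q (chart y) / pe_co e q (chart x))).
- by move=> p; exact: (sform_open (sform_coord e (chart p))).
- exact: chart_neq0.
- move=> x y z /= hx hy.
  exact: (regular_frac (sform_coord e (chart y)) (sform_coord e (chart x)) hx).
- by move=> x z /= hx; rewrite divff.
- by move=> x y w z /= hx hy hw; rewrite mulrC mulrA divfK.
Defined.

Definition hyperplane_section l p q := l q / pe_co e q (chart p).

Lemma hyperplane_section_regular l p q : sform e 1 l ->
  lb_dom hyperplane_bundle p q -> regular_at q (hyperplane_section l p).
Proof. by move=> hl hq; exact: (regular_frac hl (sform_coord e (chart p)) hq). Qed.

Lemma hyperplane_section_tr l x y z : lb_dom hyperplane_bundle x z ->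
  lb_dom hyperplane_bundle y z ->
  hyperplane_section l x z = lb_tr hyperplane_bundle x y z * hyperplane_section l y z.
Proof. by move=> /= hx hy; rewrite /hyperplane_section /= [RHS]mulrC [RHS]mulrA divfK. Qed.

Lemma hyperplane_section_eq0 l p q : lb_dom hyperplane_bundle p q ->
  (hyperplane_section l p q == 0) = (l q == 0).
Proof. by move=> /= hp; rewrite mulf_eq0 invr_eq0 (negPf hp) orbF. Qed.

End Hyperplane.

(** * Embedded spaces are locally affine *)

Section LocallyAffine.
Variables (K : fieldType) (X : fspace K) (e : proj_emb X).

Lemma regular_meval (Y : fspace K) n (y : Y) (phi : Y -> 'I_n -> K) P :
  (forall j, regular_at y (fun q => phi q j)) ->
  regular_at y (fun q => mpoly.meval (phi q) P).
Proof.
move=> hphi.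
have mono (m : mpoly.multinom n) : regular_at y (fun q => \prod_i phi q i ^+ m i).
  have : forall s : seq 'I_n, regular_at y (fun q => \prod_(i <- s) phi q i ^+ m i).
    elim=> [|i s IHs].
      by under eq_fun do rewrite big_nil; apply: regular_cst.
    under eq_fun do rewrite big_cons; apply: regularM => //; exact: regularX.
  by move=> /(_ (enum 'I_n)); under eq_fun do rewrite big_enum.
have -> : (fun q => mpoly.meval (phi q) P) = (fun q => \sum_(m <- mpoly.msupp P)
    (mpoly.mcoeff m P * \prod_i phi q i ^+ m i)).
  by apply/funext => q; rewrite mpoly.mevalE.
elim: (mpoly.msupp P) => [|m s IHs].
  by under eq_fun do rewrite big_nil; apply: regular_cst.
under eq_fun do rewrite big_cons; apply: regularD => //.
by apply: regularM => //; apply: regular_cst.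
Qed.

Lemma emb_locally_affine : locally_affine X.
Proof.
move=> p; have [i pi] := pe_neq0 e p.
pose U := [set q | pe_co e q i != 0].
exists U; split=> //; first exact: sform_open (sform_coord e i).
(* The coordinate [i] is kept, with value 1, so that forms can be evaluated at [phi w] without
   dehomogenising them. *)
pose phi (w : fs_sub U) j := pe_co e (sval w) j / pe_co e (sval w) i.
have wU (w : fs_sub U) : pe_co e (sval w) i != 0 := proj2_sig w.
have formE d f w : form d f -> f (phi w) = (pe_co e (sval w) i)^-1 ^+ d * f (pe_co e (sval w)).
  move=> hf; rewrite -(form_hom _ _ hf); congr f; apply/funext => j.
  by rewrite mulrC.
have phi_reg (w : fs_sub U) j : regular_at w (fun q => phi q j).
  apply/fs_sub_regular; exists (fun x => pe_co e x j / pe_co e x i); last exact: filterE.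
  exact: regular_frac (sform_coord e j) (sform_coord e i) (wU w).
pose S : set (mpoly.mpoly (pe_dim e).+1 K) := [set P | forall w, mpoly.meval (phi w) P = 0].
exists (pe_dim e).+1, phi, S; split.
- move=> w w' E; apply: fs_sub_inj.
  apply: (pe_inj e _ _ (pe_co e (sval w) i / pe_co e (sval w') i)) => j.
  have := congr1 (@^~ j) E; rewrite /phi => E'.
  by rewrite mulrAC -mulrA -E' mulrC divfK.
- apply/seteqP; split=> [_ [w _ <-] P|v hv]; first exact.
  have vi : v i = 1.
    have := hv (mpoly.mpolyX K (mpoly.mnm1 i) - mpoly.mpolyC _ 1).
    rewrite mpoly.mevalB mpoly.mevalXU mpoly.mevalC => E; apply/eqP.
    rewrite -subr_eq0 E // => w.
    by rewrite mpoly.mevalB mpoly.mevalXU mpoly.mevalC /phi divff ?subrr.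
  have [q [c vE]] : exists q c, forall j, v j = c * pe_co e q j.
    apply: pe_cone; first by exists i; rewrite vi oner_neq0.
    move=> d f hf fX; have [P hP fE] := hf; rewrite fE; apply: hv => w.
    by have := formE d f w hf; rewrite fX mulr0 fE.
  have ci : c * pe_co e q i = 1 by rewrite -vE.
  have qi : pe_co e q i != 0.
    by apply/eqP => q0; move/eqP: ci; rewrite q0 mulr0 eq_sym oner_eq0.
  exists (exist _ q qi) => //; apply/funext => j.
  by rewrite vE /phi /= -[c](mulfK qi) ci mul1r mulrC.
- move=> w A; split.
    move=> /fs_sub_nbhs[B /(pe_nbhs e)[d [f [hf fw fB]]] BA].
    have [P hP fE] := hf; exists P.
      have := formE d f w hf; rewrite {1}fE => ->.
      by rewrite mulf_neq0 ?expf_neq0 ?invr_neq0.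
    move=> w' /= Pw'; apply: BA; apply: fB => /=.
    have := formE d f w' hf; rewrite {1}fE => E; move: Pw'; rewrite E.
    by rewrite mulf_eq0 negb_or => /andP[].
  move=> [P Pw PA]; apply: filterS PA _.
  exact: regular_neq0 (regular_meval P (phi_reg w)) Pw.
- move=> w h; split.
    move=> /fs_sub_regular[a /(pe_regular e)[d [f [g [hf hg gw aE]]]] hE].
    have [P hP fE] := hf; have [Q hQ gE] := hg.
    have QE w' : mpoly.meval (phi w') Q = (pe_co e (sval w') i)^-1 ^+ d * g (pe_co e (sval w')).
      by rewrite -(formE d g w' hg) gE.
    have PE w' : mpoly.meval (phi w') P = (pe_co e (sval w') i)^-1 ^+ d * f (pe_co e (sval w')).
      by rewrite -(formE d f w' hf) fE.
    exists P, Q; split; first by rewrite QE mulf_neq0 ?expf_neq0 ?invr_neq0.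
    apply: filterS2 hE (fs_sub_near aE) => w' -> ->.
    by rewrite PE QE -mulf_div divff ?mul1r // expf_neq0 ?invr_neq0.
  move=> [P [Q [Qw E]]].
  apply: (regular_eq (f := fun q => mpoly.meval (phi q) P * (mpoly.meval (phi q) Q)^-1)).
    by apply: filterS E => q ->.
  apply: regularM; first exact: regular_meval.
  by apply: regularV => //; apply: regular_meval.
Qed.

End LocallyAffine.

Section Connected.
Variable T : topologicalType.

Lemma irreducible_connected : irreducible_set [set: T] -> connected [set: T].
Proof.
move=> [_ irr] B [b Bb] [U oU BU] [F cF BF].
rewrite setTI in BU; rewrite setTI in BF.
have [|||h|h] := irr B (~` B).
- by rewrite BF.
- by apply: open_closedC; rewrite BU.
- by move=> x _; have [Bx|nBx] := pselect (B x); [left|right].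
- by apply/seteqP; split.
- by have := h b I.
Qed.

End Connected.

Section PicardProduct.
Variables (K : fieldType) (X T : fspace K).

(** Normalise [M] to be trivial on [X * {t0}]; its classifying map sends [t0] to
    the identity, hence the connected [T] to the identity component. *)
Lemma pic0_trivial_product (t0 : T) (M : line_bundle (fs_pair X T)) :
  pic0_trivial X -> locally_affine T -> connected [set: T] ->
  exists (A : line_bundle X) (B : line_bundle T),
    lb_iso M (lb_tensor (lb_pullback (pair_fst X T) A) (lb_pullback (pair_snd X T) B)).
Proof.
move=> [P [PP [e [[_ hP] he hcc]]]] hT cT.
pose A := lb_pullback (pair_slice X t0) M.
pose fA := lb_pullback (pair_fst X T) A.
pose M' := lb_tensor M (lb_pow fA (-1)).
have [g [[N hN] _]] := hP T hT M'.
pose c : morphism T T := mor_cst T t0.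
pose M'' := lb_pullback (base_change X c) M'.
have M''triv : lb_iso M'' (lb_trivial (fs_pair X T)).
  apply: lb_iso_tr => x y z Mx My _ _ /=.
  by rewrite exprN1 mulfV //; apply: (@lb_tr_neq0 K _ M); [have [] := Mx|have [] := My].
have [g0 [_ uniq]] := hP T hT M''.
pose fib := lb_pullback (pair_slice X e) PP.
have fibE (k : morphism T P) : (forall t, k t = e) ->
    lb_iso (lb_pullback (base_change X k) PP) (lb_pullback (pair_fst X T) fib).
  by move=> kE; apply: lb_iso_tr => x y z /= _ _ _ _; rewrite !kE.
have trivE (k : morphism T P) : (forall t, k t = e) ->
    lb_iso (lb_pullback (base_change X k) PP) (lb_trivial (fs_pair X T)).
  move=> kE; apply: (lb_iso_trans (fibE k kE)).
  apply: (lb_iso_trans (lb_iso_pullback (pair_fst X T) he)).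
  exact: lb_iso_tr.
(* Both [g] composed with the constant map at [t0] and the constant map at [e] classify the trivial
   bundle [M''], so they agree. *)
have ge : g t0 = e.
  have h1 : (mor_comp g c) =1 g0.
    apply: uniq; exists (lb_pullback c N).
    apply: (lb_iso_trans (lb_iso_pullback (base_change X c) hN)).
    exact: lb_iso_tr.
  have h2 : (mor_cst T e) =1 g0.
    apply: uniq; exists (lb_trivial T).
    apply: (lb_iso_trans M''triv); apply: (lb_iso_trans (lb_iso_sym (trivE (mor_cst T e) _))) => //.
    by apply: lb_iso_tr => x y z _ _ _ _ /=; rewrite mulr1.
  by have := h1 t0; rewrite -(h2 t0).
have gE t : g t = e.
  have cg : connected (range g).
    by apply: connected_continuous_connected => //; apply: continuous_subspaceT; exact: mor_continuous.
  have sub : range g `<=` [set e].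
    by rewrite -hcc; apply: connected_component_max => //; exists t0.
  by apply: sub; exists t.
exists A, N.
have h : lb_iso M' (lb_pullback (pair_snd X T) N).
  apply: (lb_iso_trans hN).
  apply: (lb_iso_trans (lb_iso_tensor (trivE g gE) (lb_iso_tr (fun _ _ _ _ _ _ _ => erefl)))).
  by apply: lb_iso_tr => x y z _ _ _ _ /=; rewrite mul1r.
apply: (lb_iso_trans (M := lb_tensor fA M')).
  apply: lb_iso_tr => x y z Lx Ly [Ax _] [Ay _] /=.
  rewrite mulrCA exprN1 mulfV ?mulr1 //.
  exact: (lb_tr_neq0 (L := fA) Ax Ay).
by apply: lb_iso_tensor h; exact: lb_iso_tr.
Qed.

End PicardProduct.

(** * Rigidity of maps from a product *)

Section CrossRatio.
Variables (K : closedFieldType) (X T Z W : fspace K).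
Variables (eW : proj_emb W) (eZ : proj_emb Z).
Hypothesis Kunc : ~ countable [set: K].
Hypothesis irrW : irreducible_set [set: W].
Variables (psi : morphism (fs_pair X T) Z) (A : line_bundle X) (B : line_bundle T).
Hypothesis psiAB : lb_iso (lb_pullback psi (hyperplane_bundle eZ))
  (lb_tensor (lb_pullback (pair_fst X T) A) (lb_pullback (pair_snd X T) B)).

(** The line bundles [psi (a, b) (x) psi (a', b')] and [psi (a, b') (x) psi (a', b)]
    on [W] are isomorphic, so a quotient of sections of them is a global
    function, which is constant. *)
Lemma constant_cross_ratio (a a' : morphism W X) (b b' : morphism W T) z1 z2 :
  (forall w, psi (a w, b' w) = z1) -> (forall w, psi (a' w, b w) = z2) ->
  forall w1 w2, psi (a w1, b w1) = psi (a w2, b w2).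
Proof.
move=> h1 h2 w1 w2; apply: contrapT => ne.
have [u [ru cu]] := psiAB.
pose O := hyperplane_bundle eZ.
(* The pulled-back section given by [l], carried by [u] to the external product of [A] and [B] and
   read in the trivialisation at [p]. *)
pose sg l (p q : fs_pair X T) := u p q * hyperplane_section eZ l (psi p) (psi q).
pose dm (p q : fs_pair X T) := [/\ lb_dom O (psi p) (psi q),
  lb_dom A p.1 q.1 & lb_dom B p.2 q.2].
have dmm q : dm q q by split; apply: lb_mem.
have sg_reg l p q : sform eZ 1 l -> dm p q -> regular_at q (sg l p).
  move=> hl [d1 d2 d3]; apply: regularM; first by have [] := ru p q d1 (conj d2 d3).
  apply: (mor_regular (m := psi)); exact: hyperplane_section_regular.
have sg0 l p q : dm p q -> (sg l p q == 0) = (l (psi q) == 0).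
  move=> [d1 d2 d3]; have [_ /negPf nu] := ru p q d1 (conj d2 d3).
  by rewrite mulf_eq0 nu hyperplane_section_eq0.
have sg_tr l p q : dm p q ->
    sg l q q = lb_tr A q.1 p.1 q.1 * lb_tr B q.2 p.2 q.2 * sg l p q.
  move=> [d1 d2 d3]; have [e1 e2 e3] := dmm q.
  rewrite /sg (hyperplane_section_tr _ e1 d1) mulrA [RHS]mulrA.
  by have /= <- := cu q p q e1 (conj e2 e3) d1 (conj d2 d3).
have dm_near (k : morphism W X) (m : morphism W T) w0 :
    \forall w \near w0, dm (k w0, m w0) (k w, m w).
  pose km := mor_pair k m.
  have n1 : \forall w \near w0, lb_dom O (psi (km w0)) (psi (km w)).
    exact: (lb_dom_near (lb_mem (lb_pullback (mor_comp psi km) O) w0)).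
  have n2 : \forall w \near w0, lb_dom A (k w0) (k w).
    exact: (lb_dom_near (lb_mem (lb_pullback k A) w0)).
  have n3 : \forall w \near w0, lb_dom B (m w0) (m w).
    exact: (lb_dom_near (lb_mem (lb_pullback m B) w0)).
  by apply: filterS3 n1 n2 n3 => w; split.
(* [l] makes the quotient [G] below vanish at [w1], while all four factors are nonzero at [w2]. The
   denominator has no zero on [W], as [psi (a, b')] and [psi (a', b)] stay at [z1] and [z2]. *)
have [l [hl l1 l2]] := sform_sep eZ ne.
have [l' hl' l'2] := sform_nonzero eZ 1 (psi (a' w2, b' w2)).
have [m1 hm1 m1z] := sform_nonzero eZ 1 z1.
have [m2 hm2 m2z] := sform_nonzero eZ 1 z2.
pose v l q := sg l q q.
(* Each of [a], [a'], [b], [b'] occurs once above and once below, so changes of trivialisation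
   cancel: [G] is regular although the diagonal values [v] need not be. *)
pose G w := v l (a w, b w) * v l' (a' w, b' w) * (v m1 (a w, b' w) * v m2 (a' w, b w))^-1.
have rG w0 : regular_at w0 G.
  pose p1 : fs_pair X T := (a w0, b w0); pose p2 : fs_pair X T := (a' w0, b' w0).
  pose p3 : fs_pair X T := (a w0, b' w0); pose p4 : fs_pair X T := (a' w0, b w0).
  apply: (regular_eq (f := fun w => sg l p1 (a w, b w) * sg l' p2 (a' w, b' w) *
      (sg m1 p3 (a w, b' w) * sg m2 p4 (a' w, b w))^-1)).
    have D12 : \forall w \near w0, dm p1 (a w, b w) /\ dm p2 (a' w, b' w).
      by apply: filterI; apply: dm_near.
    have D34 : \forall w \near w0, dm p3 (a w, b' w) /\ dm p4 (a' w, b w).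
      by apply: filterI; apply: dm_near.
    apply: filterS2 D12 D34 => w [d1 d2] [d3 d4].
    have [_ A1 B1] := d1; have [_ A2 B2] := d2.
    rewrite /G /v (sg_tr _ _ _ d1) (sg_tr _ _ _ d2) (sg_tr _ _ _ d3) (sg_tr _ _ _ d4) /=.
    have n1 := lb_tr_neq0 (lb_mem A (a w)) A1; have n2 := lb_tr_neq0 (lb_mem B (b w)) B1.
    have n3 := lb_tr_neq0 (lb_mem A (a' w)) A2; have n4 := lb_tr_neq0 (lb_mem B (b' w)) B2.
    have n5 : sg m1 p3 (a w, b' w) != 0 by rewrite sg0 // h1.
    have n6 : sg m2 p4 (a' w, b w) != 0 by rewrite sg0 // h2.
    rewrite /= in n1 n2 n3 n4; field.
    by rewrite n1 n2 n3 n4 n5 n6.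
  have rsg k (c : morphism W X) (d : morphism W T) : sform eZ 1 k ->
      regular_at w0 (fun w => sg k (c w0, d w0) (c w, d w)).
    move=> hk; apply: (mor_regular (m := mor_pair c d)); exact: sg_reg.
  apply: regularM; first by apply: regularM; apply: rsg.
  apply: regularV; first by apply: regularM; apply: rsg.
  by rewrite mulf_neq0 // sg0 ?h1 ?h2.
have := global_regular_const eW Kunc irrW rG w1 w2.
have -> : G w1 = 0.
  have /eqP v0 : v l (a w1, b w1) == 0 by rewrite /v sg0 // l1.
  by rewrite /G v0 !mul0r.
have nz k q : k (psi q) != 0 -> v k q != 0 by rewrite /v sg0.
suff : G w2 != 0 by move=> + E; rewrite -E eqxx.
apply: mulf_neq0; [apply: mulf_neq0|apply: invr_neq0; apply: mulf_neq0].
all: by apply: nz; rewrite ?h1 ?h2.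
Qed.

End CrossRatio.

(** * Picard number one *)

Section ContractedCurves.
Variables (K : closedFieldType) (Y : fspace K) (e : proj_emb Y).
Hypothesis Kunc : ~ countable [set: K].

Section OnCurve.
Variables (C : set Y) (Z : fspace K) (eZ : proj_emb Z).
Hypothesis hC : integral_curve C.

Let irrC : irreducible_set [set: fs_sub C].
Proof. by have [cC iC _ _] := hC; apply: fs_sub_irreducible. Qed.

Let finC := integral_curve_proper_finite e hC.

Let nptC (p : fs_sub C) : exists p', p <> p'.
Proof.
have [_ _ nC _] := hC; apply: contrapT => h; apply: nC; exists (sval p).
have hp (w : fs_sub C) : sval w = sval p.
  by have [->//|pw] := pselect (p = w); exfalso; apply: h; exists w.
apply/seteqP; split=> [x Cx|_ ->]; last exact: (proj2_sig p).
exact: (hp (exist _ x Cx)).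
Qed.

Lemma curve_degree_uniq (L : line_bundle (fs_sub C)) d d' :
  has_degree L d -> has_degree L d' -> d = d'.
Proof.
have [cC _ _ _] := hC; have [e1 _] := sub_emb e cC.
exact: (has_degree_uniq e1 Kunc irrC finC nptC).
Qed.

Lemma curve_degree_tensor (L M : line_bundle (fs_sub C)) d d' :
  has_degree L d -> has_degree M d' -> has_degree (lb_tensor L M) (d + d').
Proof.
have [cC _ _ _] := hC; have [e1 _] := sub_emb e cC.
exact: (has_degree_tensor e1 Kunc irrC finC nptC).
Qed.

Lemma curve_degree_pow (L : line_bundle (fs_sub C)) d k :
  has_degree L d -> has_degree (lb_pow L k) (d * k).
Proof.
have [cC _ _ _] := hC; have [e1 _] := sub_emb e cC.
exact: (has_degree_pow e1 Kunc irrC finC nptC).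
Qed.

Lemma curve_degree_pos (chi : morphism (fs_sub C) Z) a b : chi a <> chi b ->
  exists2 d : int, 0 < d & has_degree (lb_pullback chi (hyperplane_bundle eZ)) d.
Proof.
move=> ab; have [cC _ _ _] := hC; have [e1 _] := sub_emb e cC.
have [l [hl la lb]] := sform_sep eZ ab.
pose s x z := hyperplane_section eZ l (chi x) (chi z).
have dm x : lb_dom (hyperplane_bundle eZ) (chi x) (chi x) by exact: lb_mem.
have [|||d hd [_ dpos]] := has_degree_section e1 Kunc irrC finC nptC
  (L := lb_pullback chi (hyperplane_bundle eZ)) (s := s) a (q0 := b).
- move=> x z hx; apply: (mor_regular (m := chi)); exact: hyperplane_section_regular.
- by move=> x y z hx hy; exact: hyperplane_section_tr.
- by rewrite /s hyperplane_section_eq0.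
exists d => //; apply: dpos; apply/eqP.
by rewrite /s hyperplane_section_eq0 // la.
Qed.

Lemma curve_degree_const (chi : morphism (fs_sub C) Z) z :
  (forall w, chi w = z) -> has_degree (lb_pullback chi (hyperplane_bundle eZ)) 0.
Proof.
move=> hz; have [[w0 _] _] := irrC.
have [l hl lz] := sform_nonzero eZ 1 z.
pose s x w := hyperplane_section eZ l (chi x) (chi w).
have sr x w : lb_dom (hyperplane_bundle eZ) (chi x) (chi w) -> regular_at w (s x).
  by move=> hx; apply: (mor_regular (m := chi)); exact: hyperplane_section_regular.
have s0 x w : lb_dom (hyperplane_bundle eZ) (chi x) (chi w) -> s x w != 0.
  by move=> hx; rewrite /s hyperplane_section_eq0 // hz.
exists setT, s, (fun=> 0); split.
- split; [exact: openT|by exists w0| |].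
    by move=> x w _ hx; split; [exact: sr|exact: s0].
  by move=> x y w _ hx hy; exact: hyperplane_section_tr.
- move=> p; apply: section_order_unit; first by apply: sr; exact: lb_mem.
  by apply: s0; exact: lb_mem.
- by rewrite (fsum_support (s := [::])) ?big_nil.
Qed.

End OnCurve.

Lemma numerically_equivalent_curve (L0 M : line_bundle Y) k C :
  numerically_equivalent M
    (\big[@lb_tensor K Y/lb_trivial Y]_(i < 1) lb_pow L0 k) ->
  integral_curve C ->
  has_degree (lb_tensor (lb_pullback (sub_incl C) M)
    (lb_pow (lb_pullback (sub_incl C) L0) (- k))) 0.
Proof.
move=> h hC; apply: has_degree_iso (h C hC).
apply: lb_iso_tr => x y z /= _ _ _ _; congr (_ * _).
rewrite big_ord_recl big_ord0 /= mulr1.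
by rewrite exprz_exp mulrN1.
Qed.

(** A single point carries no curve, so all bundles on it would be numerically trivial and the
    coefficient of the generator would not be unique. *)
Lemma picard_number1_nonpoint : picard_number Y 1 -> exists a b : Y, a <> b.
Proof.
move=> [L hL]; apply: contrapT => h.
have triv (M : line_bundle Y) : numerically_trivial M.
  move=> C [_ [[x Cx] _] nC _]; exfalso; apply: nC; exists x.
  apply/seteqP; split=> [y Cy|_ ->//] /=.
  by apply: contrapT => yx; apply: h; exists y, x.
have [k [_ hk]] := hL (lb_trivial Y).
have e0 : k = [ffun=> 0] by apply: hk; exact: triv.
have e1 : k = [ffun=> 1] by apply: hk; exact: triv.
by have := congr1 (fun c : {ffun _} => c ord0) e0; rewrite e1 !ffunE.
Qed.

(** If [phi] contracts some curve then [phi^* O(1)] is numerically a zero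
    multiple of [O(1)], so [phi] contracts all curves. *)
Lemma contracted_curve_const (Z : fspace K) (eZ : proj_emb Z)
    (phi : morphism Y Z) (C : set Y) z :
  irreducible_set [set: Y] -> picard_number Y 1 -> integral_curve C ->
  (forall x, C x -> phi x = z) -> forall a b, phi a = phi b.
Proof.
move=> irrY [L hL] hC phiC a b; apply: contrapT => ab.
pose M := lb_pullback phi (hyperplane_bundle eZ).
pose E := hyperplane_bundle e.
pose L0 := L ord0.
have num N : exists k, numerically_equivalent N
    (\big[@lb_tensor K Y/lb_trivial Y]_(i < 1) lb_pow L0 k).
  have [k [hk _]] := hL N; exists (k ord0); move: hk.
  by rewrite !big_ord_recl !big_ord0.
have [k hk] := num M; have [l hl] := num E.
pose inc := sub_incl C.
pose LC := lb_pullback inc L0; pose MC := lb_pullback inc M; pose EC := lb_pullback inc E.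
have dM : has_degree MC 0.
  apply: (curve_degree_const eZ hC (chi := mor_comp phi inc) (z := z)) => w.
  exact: phiC (proj2_sig w).
have [d dpos dE] : exists2 d : int, 0 < d & has_degree EC d.
  have [_ [[x Cx] _] nC _] := hC.
  have [y Cy xy] : exists2 y, C y & x <> y.
    apply: contrapT => h; apply: nC; exists x; apply/seteqP.
    split=> [y Cy|_ ->//] /=; apply/esym; apply: contrapT => xy; apply: h.
    by exists y.
  exact: (curve_degree_pos e hC (chi := inc) (a := exist _ x Cx) (b := exist _ y Cy)).
(* No degree of [L0] on [C] is known beforehand, so only its powers are used: [L0 ^ (- k)] has
   degree 0 and [L0 ^ (- l)] has degree [- d]. Comparing the power [k] of the latter with the power
   [l] of the former gives [d * k = 0]. *)
have cancel N n c : has_degree N n ->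
    has_degree (lb_tensor N (lb_pow LC (- c))) 0 -> has_degree (lb_pow LC (- c)) (- n).
  move=> hN hNL.
  have := curve_degree_tensor hC (curve_degree_pow hC (-1) hN) hNL.
  rewrite addr0 mulrN1; apply: has_degree_iso => //.
  apply: lb_iso_tr => x y w [Nx _] [Ny _] _ _ /=.
  by rewrite mulrA exprN1 mulVf ?mul1r //; exact: lb_tr_neq0.
have h1 := curve_degree_pow hC l (cancel _ _ _ dM (numerically_equivalent_curve hk hC)).
have h2 := curve_degree_pow hC k (cancel _ _ _ dE (numerically_equivalent_curve hl hC)).
have h3 : has_degree (lb_pow (lb_pow LC (- l)) k) (- 0 * l).
  apply: has_degree_iso h1; apply: lb_iso_tr => x y w _ _ _ _ /=.
  by rewrite !exprz_exp; congr (_ ^ _); ring.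
have k0 : k = 0.
  have /eqP := curve_degree_uniq hC h2 h3.
  by rewrite oppr0 mul0r mulf_eq0 oppr_eq0 (gt_eqF dpos) => /eqP.
have [C' hC' [x [y [C'x C'y xy]]]] := nonconstant_integral_curve e eZ Kunc
  closedT irrY (I : [set: Y] a) (I : [set: Y] b) ab.
have [d' d'pos hd'] := curve_degree_pos eZ hC' (chi := mor_comp phi (sub_incl C'))
  (a := exist _ x C'x) (b := exist _ y C'y) xy.
have hd0 : has_degree (lb_pullback (mor_comp phi (sub_incl C')) (hyperplane_bundle eZ)) 0.
  apply: has_degree_iso (numerically_equivalent_curve hk hC').
  apply: lb_iso_tr => p q w _ _ _ _ /=.
  by rewrite k0 oppr0 expr0z mulr1.
by move: d'pos; rewrite (curve_degree_uniq hC' hd' hd0) ltxx.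
Qed.

(** The closure of the image of [h] is irreducible and not a point, so it contains an integral
    curve, and [phi] contracts that curve. *)
Lemma composite_nonconst (Z W : fspace K) (eZ : proj_emb Z)
    (phi : morphism Y Z) (h : morphism W Y) w1 w2 :
  irreducible_set [set: Y] -> irreducible_set [set: W] -> picard_number Y 1 ->
  h w1 <> h w2 -> (forall w w', phi (h w) = phi (h w')) ->
  forall a b, phi a = phi b.
Proof.
move=> irrY irrW rho hw phih.
pose A := closure (h @` setT).
have iA : irreducible_set A.
  apply: irreducible_closure; apply: irreducible_image => //.
  exact: mor_continuous.
have Ah w : A (h w) by apply: subset_closure; exists w.
have [C hC CA] : exists2 C : set Y, integral_curve C & C `<=` A.
  apply: (integral_curve_sub e) => //; first exact: closed_closure.
  move=> [x Ax]; apply: hw.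
  by have := Ah w1; have := Ah w2; rewrite Ax => -> ->.
apply: (contracted_curve_const eZ irrY rho hC (z := phi (h w1))) => x /CA Ax.
have cl : closed [set y | phi y = phi (h w1)].
  apply: (closed_comp (f := phi) (D := [set phi (h w1)])).
    by move=> y _; apply: mor_continuous.
  exact: emb_closed1 eZ _.
have : A `<=` [set y | phi y = phi (h w1)].
  by rewrite /A closureE; apply: smallest_sub => // _ [w _ <-]; exact: phih.
exact.
Qed.

End ContractedCurves.

(** * Isomorphisms of products *)

Section ProductMaps.
Variables (K : fieldType) (J : finType) (Y : J -> fspace K).

Definition mor_proj j : morphism (fs_prod Y) (Y j) :=
  @init_proj K J Y (forall i, Y i) (fun i x => x i) j.

Variables (V : fspace K) (u : morphism V (fs_prod Y)) (j : J) (s : morphism V (Y j)).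

Definition update_comp i : morphism V (Y i) :=
  if j =P i is ReflectT ji then ecast k (morphism V (Y k)) ji s
  else mor_comp (mor_proj i) u.

Lemma update_compE i v : dfwith (u v : forall i, Y i) j (s v) i = update_comp i v.
Proof.
rewrite /update_comp; case: eqP => [ji|/eqP ji]; last by rewrite dfwithout.
by case: _ / ji; rewrite dfwithin.
Qed.

Definition mor_update : morphism V (fs_prod Y) := init_lift update_compE.

End ProductMaps.

Section Dependence.
Variables (K : closedFieldType) (J : finType) (Y : J -> fspace K).
Variables (S : Type) (f : (forall j, Y j) -> S).

Definition depends_on j := exists y s s', f (dfwith y j s) <> f (dfwith y j s').

Lemma dfwith_same (y : forall j, Y j) j : dfwith y j (y j) = y.
Proof.
apply: functional_extensionality_dep => i; have [<-|ij] := eqVneq j i.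
  by rewrite dfwithin.
by rewrite dfwithout.
Qed.

(** Pass from [y] to [y'] by changing the coordinates one by one. *)
Lemma coordinate_induction (P : (forall j, Y j) -> Prop) (y y' : forall j, Y j) :
  P y -> (forall z j, y j <> y' j -> P z -> P (dfwith z j (y' j))) -> P y'.
Proof.
move=> Py step.
pose z (s : seq J) : forall j, Y j := fun j => if j \in s then y' j else y j.
suff : P (z (enum J)).
  congr P; apply: functional_extensionality_dep => j.
  by rewrite /z mem_enum.
elim: (enum J) => [|j s IHs].
  by move: Py; congr P; apply: functional_extensionality_dep => j; rewrite /z.
have [yj|yj] := pselect (y j = y' j).
  move: IHs; congr P; apply: functional_extensionality_dep => i.
  rewrite /z inE; have [->|_ //] := eqVneq i j.
  by case: ifP.
move: (step _ _ yj IHs); congr P; apply: functional_extensionality_dep => i.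
rewrite /z inE; have [->|ij] := eqVneq i j; first by rewrite dfwithin.
by rewrite dfwithout // eq_sym.
Qed.

Lemma independent_eq (y y' : forall j, Y j) :
  (forall j, y j <> y' j -> ~ depends_on j) -> f y = f y'.
Proof.
move=> h; apply: (coordinate_induction (P := fun z => f y = f z) (y := y)) => // z j yj ->.
apply: contrapT => fz; apply: (h j yj); exists z, (z j), (y' j).
by rewrite dfwith_same.
Qed.

End Dependence.

(** * Dependence between the coordinates of the two products *)

Section Decomposition.
Variables (K : closedFieldType) (I J : finType).
Hypothesis Kunc : ~ countable [set: K].
Variables (X : I -> fspace K) (Y : J -> fspace K).
Hypotheses (eX : forall i, proj_emb (X i)) (eY : forall j, proj_emb (Y j)).
Hypotheses (irrX : forall i, irreducible_set [set: X i])
  (irrY : forall j, irreducible_set [set: Y j]).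
Hypothesis rhoY : forall j, picard_number (Y j) 1.
Hypothesis picY : forall j, pic0_trivial (Y j).
Variables (f : morphism (fs_prod X) (fs_prod Y)) (g : morphism (fs_prod Y) (fs_prod X)).
Hypothesis fK : cancel f g.

Let fc j (x : forall i, X i) : Y j := (f x : forall j, Y j) j.
Let gc i (y : forall j, Y j) : X i := (g y : forall i, X i) i.

Lemma cross_constant (T Z : fspace K) j (eT : proj_emb T) (eZ : proj_emb Z)
    (irrT : irreducible_set [set: T]) (psi : morphism (fs_pair (Y j) T) Z)
    (W : fspace K) (eW : proj_emb W) (irrW : irreducible_set [set: W])
    (a a' : morphism W (Y j)) (b b' : morphism W T) z1 z2 :
  (forall w, psi (a w, b' w) = z1) -> (forall w, psi (a' w, b w) = z2) ->
  forall w1 w2, psi (a w1, b w1) = psi (a w2, b w2).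
Proof.
have [[t0 _] _] := irrT.
have [A [B hAB]] := pic0_trivial_product t0
  (lb_pullback psi (hyperplane_bundle eZ)) (picY j) (emb_locally_affine eT)
  (irreducible_connected irrT).
exact: (constant_cross_ratio eW Kunc irrW hAB).
Qed.

(** Rigidity, one coordinate [l] other than [j] at a time: on [Y j * Y l] the map is constant in the
    first variable over [z l], and the cross-ratio argument with constant [b], [b'] carries this to
    [z' l]. *)
Lemma slice_constant_everywhere i j (z z' : forall j, Y j) :
  (forall y y', gc i (dfwith z j y) = gc i (dfwith z j y')) ->
  forall y y', gc i (dfwith z' j y) = gc i (dfwith z' j y').
Proof.
move=> hz; apply: (coordinate_induction (y := z) (P := fun z =>
  forall y y', gc i (dfwith z j y) = gc i (dfwith z j y'))) => // {hz} {}z l _ hz.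
have [jl|jl] := eqVneq j l.
  subst l; have E y : dfwith (dfwith z j (z' j)) j y = dfwith z j y.
    apply: functional_extensionality_dep => k; have [<-|jk] := eqVneq j k.
      by rewrite !dfwithin.
    by rewrite !dfwithout.
  by move=> y y'; rewrite !E.
pose V := fs_pair (Y j) (Y l).
pose u1 : morphism V (fs_prod Y) := mor_update (mor_cst V (z : fs_prod Y)) (pair_snd (Y j) (Y l)).
pose u2 : morphism V (fs_prod Y) := mor_update u1 (pair_fst (Y j) (Y l)).
pose psi : morphism V (X i) := mor_comp (mor_proj X i) (mor_comp g u2).
have psiE y s : psi (y, s) = gc i (dfwith (dfwith z l s) j y) by [].
have [[y0 _] _] := irrY j.
move=> y y'; rewrite -!psiE.
apply: (cross_constant (eY l) (eX i) (irrY l) (eY j) (irrY j) (psi := psi)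
  (a := mor_id (Y j)) (b := mor_cst (Y j) (z' l)) (a' := mor_cst (Y j) y0)
  (b' := mor_cst (Y j) (z l)) (z1 := gc i (dfwith z j y0))
  (z2 := psi (y0, z' l)) _ _ y y') => w //.
by rewrite -[LHS]/(psi (w, z l)) psiE dfwith_same.
Qed.

Lemma dependence_unique i k j : depends_on (fc j) k -> depends_on (gc i) j -> i = k.
Proof.
move=> [x [t1 [t2 ft]]] [z [y1 [y2 gy]]]; apply: contrapT => /eqP ik; apply: gy.
pose sl : morphism (X k) (fs_prod X) := mor_update (mor_cst (X k) (x : fs_prod X)) (mor_id (X k)).
pose u := mor_comp f sl.
pose h : morphism (X k) (Y j) := mor_comp (mor_proj Y j) u.
pose V := fs_pair (Y j) (X k).
pose u2 : morphism V (fs_prod Y) :=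
  mor_update (mor_comp u (pair_snd (Y j) (X k))) (pair_fst (Y j) (X k)).
pose psi : morphism V (X i) := mor_comp (mor_proj X i) (mor_comp g u2).
have psiE y w : psi (y, w) = gc i (dfwith (u w : forall j, Y j) j y) by [].
have [[y0 _] _] := irrY j.
pose phi : morphism (Y j) (X i) := mor_comp psi (pair_slice (Y j) t1).
(* On the graph of [h] the coordinate [j] is overwritten by its own value, so [psi] returns the
   coordinate [i] of [x], untouched since [i != k]. This is the constant [z1], with [a = h] and [b']
   the identity. *)
have phih w w' : phi (h w) = phi (h w').
  apply: (cross_constant (eX k) (eX i) (irrX k) (eX k) (irrX k) (psi := psi)
    (a := h) (b := mor_cst (X k) t1) (a' := mor_cst (X k) y0) (b' := mor_id (X k))
    (z1 := x i) (z2 := psi (y0, t1)) _ _ w w') => // v.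
  rewrite psiE -[h v]/((u v : forall j, Y j) j) dfwith_same.
  rewrite /gc -[u v]/(f (sl v)) fK -[sl v]/(dfwith x k v).
  by rewrite dfwithout // eq_sym.
have phiC := composite_nonconst (eY j) Kunc (eX i) (irrY j) (irrX k) (rhoY j)
  (phi := phi) (h := h) ft phih.
(* Constancy of [phi] says that [gc i] ignores the coordinate [j] at the single base point [u t1];
   rigidity extends this to the [z] of the assumed dependence. *)
apply: (slice_constant_everywhere (z := u t1)) => y y'.
exact: phiC y y'.
Qed.

(** Otherwise [gc i] would be constant, although composed with [f] it is a coordinate projection,
    and [X i] has two points. *)
Lemma depends_exists i : picard_number (X i) 1 -> exists j, depends_on (gc i) j.
Proof.
move=> /picard_number1_nonpoint[a [b ab]].
pose x0 k : X k := projT1 (cid (irrX k).1).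
apply: contrapT => h; apply: ab.
have E c : gc i (f (dfwith x0 i c)) = c by rewrite /gc fK dfwithin.
rewrite -(E a) -(E b); apply: independent_eq => j _ hj.
by apply: h; exists j.
Qed.

End Decomposition.

(** * Uncountability of the complex numbers, and conclusion *)

Lemma uncountable_complex (R : realType) : ~ countable [set: R[i]].
Proof.
move=> /countable_injP[h hinj].
pose enc (x : R) := h (x%:C)%C.
have encI : injective enc.
  by move=> x y /hinj; rewrite !in_setT => /(_ isT isT) [].
have [f hf] : exists f : nat -> R, forall x, f (enc x) = x.
  have /choice[f hf] : forall n, exists x : R, forall y, enc y = n -> x = y.
    move=> n; have [[x xn]|hn] := pselect (exists x, enc x = n).
      by exists x => y yn; apply: encI; rewrite xn yn.
    by exists 0 => y yn; exfalso; apply: hn; exists y.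
  by exists f => x; apply: hf.
(* Nested intervals from [(ab n).1] to [(ab n).2] avoiding the first [n] values of [f]. *)
pose next (n : nat) (c : R * R) : R * R :=
  let m := (c.1 + c.2) / 2 in
  if f n < m then (m, c.2) else (c.1, (c.1 + m) / 2).
pose ab := fix ab n := if n is k.+1 then next k (ab k) else (0, 1) : R * R.
have ab_lt n : (ab n).1 < (ab n).2.
  elim: n => [|n IHn] /=; first exact: ltr01.
  by rewrite /next; case: ifP => _ /=; lra.
have abS n : (ab n).1 <= (ab n.+1).1 /\ (ab n.+1).2 <= (ab n).2.
  have := ab_lt n; rewrite /= /next; case: ifP => _ /=; split; lra.
have ab_le n m : (n <= m)%N -> (ab n).1 <= (ab m).1 /\ (ab m).2 <= (ab n).2.
  elim: m => [|m IHm]; first by rewrite leqn0 => /eqP ->.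
  rewrite leq_eqVlt => /predU1P[-> //|/IHm[h1 h2]].
  by have [h3 h4] := abS m; split; [exact: le_trans h1 h3|exact: le_trans h4 h2].
pose E := range (fun n => (ab n).1).
have ubE n : ubound E (ab n).2.
  move=> _ [m _ <-]; have [nm|mn] := leqP n m.
    exact: le_trans (ltW (ab_lt m)) (ab_le _ _ nm).2.
  exact: le_trans (ab_le _ _ (ltnW mn)).1 (ltW (ab_lt n)).
have Ene : E !=set0 by exists (ab 0%N).1, 0%N.
pose x := sup E.
have x_ge n : (ab n).1 <= x.
  by apply: ub_le_sup; [exists (ab 0%N).2; exact: ubE|exists n].
have x_le n : x <= (ab n).2 by apply: ge_sup.
(* The interval of index [(enc x).+1] was chosen to exclude [f (enc x)], which is [x] itself. *)
have := x_ge (enc x).+1; have := x_le (enc x).+1; have := ab_lt (enc x).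
by rewrite /= /next hf; case: ifP => /= [|/negbT]; rewrite -?leNgt; lra.
Qed.

(** Uniqueness of dependence, for [f] and for [g], makes [s] and [t] mutually inverse. The
    isomorphism from [X i] to [Y (s i)] is [f] along a slice through base points: [gc i] reads only
    the coordinate [s i], so resetting the others to base points does not disturb [cancel f g]. *)
Lemma product_decomposition (K : closedFieldType) (I J : finType)
    (X : I -> fspace K) (Y : J -> fspace K) : ~ countable [set: K] ->
  (forall i, normal_projective_variety (X i)) ->
  (forall j, normal_projective_variety (Y j)) ->
  (forall i, picard_number (X i) 1) -> (forall j, picard_number (Y j) 1) ->
  (forall i, pic0_trivial (X i)) -> (forall j, pic0_trivial (Y j)) ->
  isomorphic (fs_prod X) (fs_prod Y) ->
  exists s : I -> J, bijective s /\ forall i, isomorphic (X i) (Y (s i)).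
Proof.
move=> Kunc varX varY rhoX rhoY picX picY [f [g [fK gK]]].
have emb (V : fspace K) : normal_projective_variety V -> proj_emb V.
  by move=> [/projective_emb/cid[e _]].
pose eX i := emb _ (varX i); pose eY j := emb _ (varY j).
have irrX i : irreducible_set [set: X i] by have [] := varX i.
have irrY j : irreducible_set [set: Y j] by have [] := varY j.
pose fc j (x : forall i, X i) : Y j := (f x : forall j, Y j) j.
pose gc i (y : forall j, Y j) : X i := (g y : forall i, X i) i.
have uX i k j : depends_on (fc j) k -> depends_on (gc i) j -> i = k.
  exact: (dependence_unique Kunc eX eY irrX irrY rhoY picY fK).
have uY j k i : depends_on (gc i) k -> depends_on (fc j) i -> j = k.
  exact: (dependence_unique Kunc eY eX irrY irrX rhoX picX gK).
have /choice[s hs] : forall i, exists j, depends_on (gc i) j.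
  by move=> i; exact: (depends_exists irrX fK (rhoX i)).
have /choice[t ht] : forall j, exists i, depends_on (fc j) i.
  by move=> j; exact: (depends_exists irrY gK (rhoY j)).
have st i : t (s i) = i by apply/esym; exact: uX (ht (s i)) (hs i).
have ts j : s (t j) = j by apply/esym; exact: uY (hs (t j)) (ht j).
exists s; split; first by exists t.
move=> i; pose x0 k : X k := projT1 (cid (irrX k).1).
pose y0 k : Y k := projT1 (cid (irrY k).1).
pose slX : morphism (X i) (fs_prod X) :=
  mor_update (mor_cst (X i) (x0 : fs_prod X)) (mor_id (X i)).
pose slY : morphism (Y (s i)) (fs_prod Y) :=
  mor_update (mor_cst (Y (s i)) (y0 : fs_prod Y)) (mor_id (Y (s i))).
have hti : depends_on (fc (s i)) i by have := ht (s i); rewrite st.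
exists (mor_comp (mor_proj Y (s i)) (mor_comp f slX)).
exists (mor_comp (mor_proj X i) (mor_comp g slY)); split.
- move=> v; rewrite -[LHS]/(gc i (dfwith y0 (s i) (fc (s i) (dfwith x0 i v)))).
  transitivity (gc i (f (dfwith x0 i v))); last by rewrite /gc fK dfwithin.
  apply: independent_eq => j yj dj; apply: yj.
  have sj : s i = j by exact: uY dj hti.
  by subst j; rewrite dfwithin.
- move=> v; rewrite -[LHS]/(fc (s i) (dfwith x0 i (gc i (dfwith y0 (s i) v)))).
  transitivity (fc (s i) (g (dfwith y0 (s i) v))); last by rewrite /fc gK dfwithin.
  apply: independent_eq => k xk dk; apply: xk.
  have ik : i = k by exact: uX dk (hs i).
  by subst k; rewrite dfwithin.
Qed.

Theorem theorem1p3 (R : realType) (m n : nat)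
  (X : 'I_m -> fspace R[i]) (Y : 'I_n -> fspace R[i])
  (varX : forall i, normal_projective_variety (X i))
  (varY : forall j, normal_projective_variety (Y j))
  (rhoX : forall i, picard_number (X i) 1)
  (rhoY : forall j, picard_number (Y j) 1)
  (pic0X : forall i, pic0_trivial (X i))
  (pic0Y : forall j, pic0_trivial (Y j))
  (isoXY : isomorphic (fs_prod X) (fs_prod Y)) :
  exists (mn : m = n) (s : {perm 'I_m}),
    forall i : 'I_m, isomorphic (X i) (Y (cast_ord mn (s i))).
Proof.
have [s [bij_s iso_s]] := product_decomposition (@uncountable_complex R)
  varX varY rhoX rhoY pic0X pic0Y isoXY.
have mn : m = n by have := bij_eq_card bij_s; rewrite !card_ord.
have inj_s : injective (fun i => cast_ord (esym mn) (s i)).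
  by move=> i i' /cast_ord_inj/(bij_inj bij_s).
exists mn, (perm inj_s) => i; rewrite permE cast_ordKV.
exact: iso_s.
Qed.
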